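(* Let $\mathcal{E}=\bigsqcup_{L\in\operatorname{GL}_{2d}(\mathbb{R})}\mathcal{E}_L(\mathbb{R}^d)$ with projection $\kappa:\mathcal{E}\to\operatorname{GL}_{2d}(\mathbb{R})$, $\kappa^{-1}(L)=\mathcal{E}_L(\mathbb{R}^d)$. Regard each $f\in M^1_\nu(\mathbb{R}^d)$ as the constant section $L\mapsto f\in\mathcal{E}_L(\mathbb{R}^d)$ of $\kappa$. Then these sections satisfy: (1) for each $f\in M^1_\nu(\mathbb{R}^d)$ the map $L\mapsto\|f\|_{\mathcal{E}_L(\mathbb{R}^d)}$ is continuous, and (2) for each $L$ the space $M^1_\nu(\mathbb{R}^d)$ is dense in $\mathcal{E}_L(\mathbb{R}^d)$; and $\kappa$ becomes a Banach bundle over $\operatorname{GL}_{2d}(\mathbb{R})$ when $\mathcal{E}$ is equipped with the topology having as basis the sets $$W(f,U,\varepsilon)=\{s\in\mathcal{E}:\kappa(s)\in U,\ \|s-f\|_{\mathcal{E}_{\kappa(s)}(\mathbb{R}^d)}<\varepsilon\},\quad f\in M^1_\nu(\mathbb{R}^d),\ U\subseteq\operatorname{GL}_{2d}(\mathbb{R})\text{ open},\ \varepsilon>0,$$ which is the unique topology making $\kappa$ a Banach bundle for which all the constant sections $f\in M^1_\nu(\mathbb{R}^d)$ are continuous. As a consequence, a section $\Upsilon\in\prod_{L\in\operatorname{GL}_{2d}(\mathbb{R})}\mathcal{E}_L(\mathbb{R}^d)$ is continuous if and only if for all $\varepsilon>0$ and $L_0\in\operatorname{GL}_{2d}(\mathbb{R})$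 there exist $f_0\in M^1_\nu(\mathbb{R}^d)$ and an open neighborhood $U_0$ of $L_0$ such that $$\|\Upsilon(L)-f_0\|_{\mathcal{E}_L(\mathbb{R}^d)}<\varepsilon\qquad\text{for all }L\in U_0.$$
   Context: Fix $d\ge1$; $\operatorname{GL}_{2d}(\mathbb{R})$ carries its usual topology. For $z=(x,\omega)\in\mathbb{R}^{2d}$, $(\pi(z)f)(t)=e^{2\pi i\,t\cdot\omega}f(t-x)$ on $L^2(\mathbb{R}^d)$. Put $\mathcal{V}_gf(z)=\langle f,\pi(z)g\rangle_2$, $\phi(t)=e^{-\pi\|t\|^2}$, $\nu(z)=1+\sum_i|z_i|$, and $M^1_\nu(\mathbb{R}^d)=\{f\in L^2(\mathbb{R}^d):\mathcal{V}_\phi f\cdot\nu\in L^1(\mathbb{R}^{2d})\}$. For $g\in L^2(\mathbb{R}^d)$, $L\in\operatorname{GL}_{2d}(\mathbb{R})$, let $\mathcal{G}(g,L)=\{\pi(Lk)g\}_{k\in\mathbb{Z}^{2d}}$; $B>0$ is a Bessel bound for it if $\sum_k|\langle f,\pi(Lk)g\rangle|^2\le B\|f\|_2^2$ for all $f\in L^2(\mathbb{R}^d)$. The Heisenberg module $\mathcal{E}_L(\mathbb{R}^d)$ is the completion of $M^1_\nu(\mathbb{R}^d)$, realized inside $L^2(\mathbb{R}^d)$ (one has continuous dense embeddings $M^1_\nu(\mathbb{R}^d)\subseteq\mathcal{E}_L(\mathbb{R}^d)\subseteq L^2(\mathbb{R}^d)$), in the norm $\|f\|_{\mathcal{E}_L(\mathbb{R}^d)}=\inf\{C^{1/2}:C\text{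 is a Bessel bound for }\mathcal{G}(f,L)\}$. A Banach bundle over a Hausdorff space $X$ is an open continuous surjection $\rho:\mathcal{B}\to X$ from a Hausdorff space $\mathcal{B}$ with a Banach space structure on each fiber $\mathcal{B}_x=\rho^{-1}(x)$ such that: $s\mapsto\|s\|$ is continuous on $\mathcal{B}$; addition is continuous on $\{(s,t):\rho(s)=\rho(t)\}$; for each $\lambda\in\mathbb{C}$, $s\mapsto\lambda s$ is continuous; and if $(s_i)$ is a net with $\rho(s_i)\to x$ and $\|s_i\|\to0$, then $s_i\to0_x$ (the zero of $\mathcal{B}_x$). A section is a map $\gamma:X\to\mathcal{B}$ with $\gamma(x)\in\mathcal{B}_x$ for all $x$. *)

(* Defs.v *)
(* R^n is the type 'cV[R]_n of column vectors and C is R[i]. *)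
From HB Require Import structures.
From mathcomp Require Import all_boot all_order all_algebra.
From mathcomp Require Import all_classical all_reals all_analysis.
From mathcomp Require Import measurable_realfun complex ring lra.

Set Implicit Arguments.
Unset Strict Implicit.
Unset Printing Implicit Defensive.

Import Order.TTheory GRing.Theory Num.Theory.
Import numFieldNormedType.Exports.
Import ComplexField.Normc.

Local Open Scope classical_set_scope.
Local Open Scope ring_scope.
Local Open Scope complex_scope.
Local Open Scope quotient_scope.

Local Notation Re := (@complex.Re _).
Local Notation Im := (@complex.Im _).

Definition matrix_display : measure_display -> measure_display.
Proof. exact. Qed.

Section measurable_matrix.
Context {R : realType} (m n : nat).

(* these generate the Borel sigma-algebra of 'M[R]_(m, n) *)
Definition mx_cylinders : set (set 'M[R]_(m, n)) :=
  [set B | exists i j (A : set R),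
     measurable A /\ B = (fun M : 'M[R]_(m, n) => M i j) @^-1` A].

HB.instance Definition _ := @isMeasurable.Build
  (matrix_display default_measure_display) 'M[R]_(m, n) <<s mx_cylinders >>
  (@sigma_algebra0 _ setT mx_cylinders)
  (@sigma_algebraC _ mx_cylinders)
  (@sigma_algebra_bigcup _ setT mx_cylinders).

Lemma measurable_mxentry i j :
  measurable_fun [set: 'M[R]_(m, n)] (fun M => M i j : R).
Proof.
move=> _ A mA; rewrite setTI; apply: sub_sigma_algebra.
by exists i, j, A.
Qed.

Lemma measurable_fun_mxP d (T : measurableType d) (f : T -> 'M[R]_(m, n)) :
  (forall i j, measurable_fun setT (fun t => f t i j)) ->
  measurable_fun setT f.
Proof.
move=> mf.
apply: (@measurability _ _ _ _ setT f mx_cylinders) => //.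
move=> _ [_ [i [j [A [mA ->]]]] <-].
by have := mf i j measurableT A mA; rewrite !setTI.
Qed.

End measurable_matrix.

Section lebesgue_cV.
Context {R : realType}.

Definition consc n (p : measurableTypeR R * 'cV[R]_n) : 'cV[R]_n.+1 :=
  col_mx p.1%:M p.2.

Lemma consc0 n p : @consc n p ord0 ord0 = p.1.
Proof.
rewrite (_ : ord0 = lshift n (ord0 : 'I_1)); last exact/val_inj.
by rewrite (@col_mxEu _ 1 n 1) mxE eqxx mulr1n.
Qed.

Lemma consc_lift n p i : @consc n p (lift ord0 i) ord0 = p.2 i ord0.
Proof.
rewrite (_ : lift ord0 i = rshift 1 i); last exact/val_inj.
by rewrite (@col_mxEd _ 1 n 1).
Qed.

Lemma measurable_consc n : measurable_fun setT (@consc n).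
Proof.
apply: measurable_fun_mxP => i j; rewrite (ord1 j).
case: (unliftP ord0 i) => [k|] ->.
  under eq_fun do rewrite consc_lift.
  exact: (measurableT_comp (measurable_mxentry k ord0) measurable_snd).
under eq_fun do rewrite consc0.
exact: measurable_fst.
Qed.

Definition unconsc n (v : 'cV[R]_n.+1) : measurableTypeR R * 'cV[R]_n :=
  (v ord0 ord0, \col_i v (lift ord0 i) ord0).

Lemma conscK n : cancel (@consc n) (@unconsc n).
Proof.
move=> p; rewrite /unconsc consc0; case: p => x v /=; congr pair.
by apply/colP => i; rewrite mxE consc_lift.
Qed.

Lemma unconscK n : cancel (@unconsc n) (@consc n).
Proof.
move=> v; apply/colP => i.
by case: (unliftP ord0 i) => [k|] ->; rewrite ?consc_lift ?consc0 /= ?mxE.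
Qed.

Lemma measurable_unconsc n : measurable_fun setT (@unconsc n).
Proof.
apply/measurable_fun_pairP; split.
  exact: (@measurable_mxentry R n.+1 1).
apply: measurable_fun_mxP => i j /=.
under eq_fun do rewrite mxE.
exact: measurable_mxentry.
Qed.


Section step.
Variables (n : nat) (mu : {sigma_finite_measure set 'cV[R]_n -> \bar R}).

Definition lebesgue_step : set 'cV[R]_n.+1 -> \bar R :=
  pushforward (lebesgue_measure \x mu)%E (@consc n).

HB.instance Definition _ := Measure.copy lebesgue_step
  (measure_function_pushforward__canonical__measure_function_Measure
    (lebesgue_measure \x mu)%E (@measurable_consc n)).

Let lebesgue_step_sigma_finite : sigma_finite setT lebesgue_step.
Proof.
have /sigma_finiteP[F [TF ndF Foo]] := sigma_finiteT (@lebesgue_measure R).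
have /sigma_finiteP[G [TG ndG Goo]] := sigma_finiteT mu.
exists (fun k => @unconsc n @^-1` (F k `*` G k)).
  rewrite -preimage_bigcup (_ : \bigcup_k _ = setT) ?preimage_setT//.
  apply/seteqP; split=> // -[t v] _.
  have [k1 _ Fk1] : (\bigcup_k F k) t by rewrite -TF.
  have [k2 _ Gk2] : (\bigcup_k G k) v by rewrite -TG.
  exists (maxn k1 k2) => //; split.
    by move: t Fk1; exact/subsetPset/ndF/leq_maxl.
  by move: v Gk2; exact/subsetPset/ndG/leq_maxr.
move=> k; have [mF Fk] := Foo k; have [mG Gk] := Goo k; split.
  rewrite -[X in measurable X]setTI.
  by apply: measurable_unconsc => //; exact: measurableX.
rewrite /lebesgue_step /pushforward -comp_preimage.
rewrite (_ : _ \o _ = id); last by apply/funext => p /=; rewrite conscK.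
rewrite preimage_id product_measure1E//.
by rewrite lte_mul_pinfty// ge0_fin_numE.
Qed.

HB.instance Definition _ := Measure_isSigmaFinite.Build _ _ _ lebesgue_step
  lebesgue_step_sigma_finite.

End step.

(* the n-fold product of the one-dimensional Lebesgue measure *)
Fixpoint lebesgue_cV n : {sigma_finite_measure set 'cV[R]_n -> \bar R} :=
  match n with
  | 0 => dirac (0 : 'cV[R]_0)
  | n.+1 => lebesgue_step (lebesgue_cV n)
  end.

Lemma measurable_addcV n (x : 'cV[R]_n) : measurable_fun setT (fun v : 'cV[R]_n => v + x).
Proof.
apply: measurable_fun_mxP => i j; under eq_fun do rewrite mxE.
by apply: measurable_funD; [exact: measurable_mxentry|exact: measurable_cst].
Qed.

Lemma lebesgue_measure_shift (x : R) (A : set (measurableTypeR R)) :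
  measurable A -> lebesgue_measure ((fun t : R => t + x) @^-1` A) = lebesgue_measure A.
Proof.
move=> mA; apply/esym.
have mD : measurable_fun setT ((fun t => t + x) : measurableTypeR R -> measurableTypeR R).
  by apply: measurable_funD.
pose mu := measure_function_pushforward__canonical__measure_function_Measure
  (lebesgue_measure : {measure set (measurableTypeR R) -> \bar R}) mD.
apply: (@lebesgue_measure_unique R mu) => // X [[a b] _ <-].
rewrite /mu/= /pushforward.
rewrite (_ : _ @^-1` _ = `]a - x, b - x]%classic); last first.
  by apply/seteqP; split=> t; rewrite /= !in_itv/= ltrBlDr lerBrDr.
rewrite !lebesgue_measure_itv/= !lte_fin ltrD2r.
by case: ifP => // _; rewrite -!EFinB; congr EFin; ring.
Qed.

Lemma lebesgue_cV_shift n (x : 'cV[R]_n) (A : set 'cV[R]_n) : measurable A ->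
  lebesgue_cV n ((fun v => v + x) @^-1` A) = lebesgue_cV n A.
Proof.
elim: n x A => [|n IHn] x A mA /=.
  by rewrite (_ : _ @^-1` A = A)//; apply/funext => v; congr A; apply/colP => -[].
rewrite /lebesgue_step /pushforward.
pose s (p : measurableTypeR R * 'cV[R]_n) : measurableTypeR R * 'cV[R]_n :=
  (p.1 + x ord0 ord0, p.2 + (unconsc x).2).
have ms : measurable_fun setT s.
  apply/measurable_fun_pairP; split.
    by apply: measurable_funD => //; exact: measurable_fst.
  exact: (measurableT_comp (measurable_addcV _) measurable_snd).
rewrite -comp_preimage (_ : _ \o _ = @consc n \o s); last first.
  apply/funext => p; apply/colP => i /=; rewrite mxE.
  case: (unliftP ord0 i) => [k|] ->; first by rewrite !consc_lift /= !mxE.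
  by rewrite !consc0.
rewrite comp_preimage.
have mB : measurable (@consc n @^-1` A).
  by rewrite -[X in measurable X]setTI; exact: measurable_consc.
move: (_ @^-1` A) mB => B mB; apply/esym.
pose mu := measure_function_pushforward__canonical__measure_function_Measure
  ((lebesgue_measure \x lebesgue_cV n)%E : {measure set _ -> \bar R}) ms.
apply: (@product_measure_unique _ _ _ _ _ _ _ mu) => // C D mC mD.
rewrite /mu/= /pushforward.
rewrite (_ : s @^-1` _ = ((fun t => t + x ord0 ord0) @^-1` C) `*`
  ((fun v => v + (unconsc x).2) @^-1` D))//.
rewrite product_measure1E//.
- by congr (_ * _)%E; [exact: lebesgue_measure_shift|exact: IHn].
- by rewrite -[X in measurable X]setTI; apply: (measurable_funD (@measurable_id _ _ _)).
- by rewrite -[X in measurable X]setTI; exact: measurable_addcV.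
Qed.

End lebesgue_cV.

Section normc.
Context {R : realType}.
Implicit Types z w : R[i].

Lemma normc_ge0 z : 0 <= normc z.
Proof. by case: z => a b; exact: sqrtr_ge0. Qed.

Lemma sqr_normc z : normc z ^+ 2 = Re z ^+ 2 + Im z ^+ 2.
Proof. by case: z => a b /=; rewrite sqr_sqrtr// addr_ge0 ?sqr_ge0. Qed.

Lemma ReD z w : Re (z + w) = Re z + Re w. Proof. by case: z; case: w. Qed.
Lemma ImD z w : Im (z + w) = Im z + Im w. Proof. by case: z; case: w. Qed.
Lemma ReM z w : Re (z * w) = Re z * Re w - Im z * Im w.
Proof. by case: z; case: w. Qed.
Lemma ImM z w : Im (z * w) = Re z * Im w + Im z * Re w.
Proof. by case: z; case: w. Qed.
Lemma Re_conjc z : Re z^* = Re z. Proof. by case: z. Qed.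
Lemma Im_conjc z : Im z^* = - Im z. Proof. by case: z. Qed.
Lemma complex_eqP z w : Re z = Re w -> Im z = Im w -> z = w.
Proof. by case: z; case: w => /= ? ? ? ? -> ->. Qed.
Lemma sqr_normcD z w : normc (z + w) ^+ 2 <= 2 * normc z ^+ 2 + 2 * normc w ^+ 2.
Proof.
rewrite !sqr_normc ReD ImD.
have := sqr_ge0 (Re z - Re w); have := sqr_ge0 (Im z - Im w); lra.
Qed.

End normc.

Section complex_integral.
Context {R : realType} {d : measure_display} {T : measurableType d}.
Variable mu : {measure set T -> \bar R}.
Implicit Types f g h : T -> R[i].

Definition cmeasurable f :=
  measurable_fun setT (Re \o f) /\ measurable_fun setT (Im \o f).

Definition cintegrable f :=
  mu.-integrable setT (EFin \o (Re \o f)) /\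
  mu.-integrable setT (EFin \o (Im \o f)).

Definition cintegral f : R[i] :=
  (\int[mu]_t Re (f t)) +i* (\int[mu]_t Im (f t)).

Definition L2fun f :=
  cmeasurable f /\ (\int[mu]_t (normc (f t) ^+ 2)%:E < +oo)%E.

Lemma measurable_sqr_normc f : cmeasurable f ->
  measurable_fun setT (fun t => normc (f t) ^+ 2).
Proof.
move=> [mr mi]; under eq_fun do rewrite sqr_normc.
by apply: measurable_funD; apply: measurable_funX.
Qed.

Lemma cmeasurableD f g : cmeasurable f -> cmeasurable g -> cmeasurable (f + g).
Proof.
move=> [fr fi] [gr gi]; split.
  rewrite (_ : _ \o _ = (Re \o f) \+ (Re \o g)); last first.
    by apply/funext => t /=; rewrite ReD.
  exact: measurable_funD.
rewrite (_ : _ \o _ = (Im \o f) \+ (Im \o g)); last first.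
  by apply/funext => t /=; rewrite ImD.
exact: measurable_funD.
Qed.

Lemma cmeasurableM f g : cmeasurable f -> cmeasurable g ->
  cmeasurable (fun t => f t * g t).
Proof.
move=> [fr fi] [gr gi]; split.
  rewrite (_ : _ \o _ = (Re \o f) \* (Re \o g) \- (Im \o f) \* (Im \o g)).
    by apply: measurable_funB; apply: measurable_funM.
  by apply/funext => t /=; rewrite ReM.
rewrite (_ : _ \o _ = (Re \o f) \* (Im \o g) \+ (Im \o f) \* (Re \o g)).
  by apply: measurable_funD; apply: measurable_funM.
by apply/funext => t /=; rewrite ImM.
Qed.

Lemma cmeasurable_cst c : cmeasurable (fun=> c).
Proof. by split; exact: measurable_cst. Qed.

Lemma cmeasurable_conjc f : cmeasurable f -> cmeasurable (fun t => (f t)^*).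
Proof.
move=> [fr fi]; split.
  by rewrite (_ : _ \o _ = Re \o f)//; apply/funext => t /=; rewrite Re_conjc.
rewrite (_ : _ \o _ = \- (Im \o f)); last first.
  by apply/funext => t /=; rewrite Im_conjc.
exact: measurable_funN.
Qed.

Lemma L2fun_integrable f : L2fun f ->
  mu.-integrable setT (fun t => (normc (f t) ^+ 2)%:E).
Proof.
move=> [mf f2]; apply/integrableP; split.
  by apply/measurable_EFinP; exact: measurable_sqr_normc.
by under eq_integral do rewrite gee0_abs ?lee_fin ?sqr_ge0//.
Qed.

Lemma L2fun_le f (h : T -> R) : cmeasurable f ->
  mu.-integrable setT (EFin \o h) ->
  (forall t, normc (f t) ^+ 2 <= h t) -> L2fun f.
Proof.
move=> mf ih fh; split=> //.
apply: le_lt_trans (integrable_lty measurableT ih).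
apply: ge0_le_integral => //.
- by move=> t _; rewrite lee_fin sqr_ge0.
- by apply/measurable_EFinP; exact: measurable_sqr_normc.
- exact: measurable_int ih.
- by move=> t _; rewrite lee_fin.
Qed.

Lemma L2fun_submod_closed : submod_closed [pred f | `[< L2fun f >]].
Proof.
split.
  apply/asboolP; split; first exact: cmeasurable_cst.
  rewrite integral0_eq// => t _; rewrite -[(0 : T -> R[i]) t]/(0 : R[i]).
  by rewrite normc0 expr0n.
move=> a f g /asboolP Lf /asboolP Lg; apply/asboolP.
have [[mf _] [mg _]] := (Lf, Lg).
apply: (@L2fun_le _ (fun t => 2 * normc a ^+ 2 * normc (f t) ^+ 2 + 2 * normc (g t) ^+ 2)).
- apply: cmeasurableD => //; apply: (@cmeasurableM (fun=> a)) => //.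
  exact: cmeasurable_cst.
- apply: (@integrableD _ _ _ mu setT measurableT (fun t => (2 * normc a ^+ 2)%:E * (normc (f t) ^+ 2)%:E)%E (fun t => 2%:E * (normc (g t) ^+ 2)%:E)%E).
  - by apply: integrableZl => //; exact: L2fun_integrable.
  - by apply: integrableZl => //; exact: L2fun_integrable.
- move=> t; apply: le_trans (sqr_normcD _ _) _.
  by rewrite /GRing.scale/= normcM exprMn mulrA.
Qed.

(* |Re (f g^* )| and |Im (f g^* )| are dominated by |f|^2 + |g|^2 *)
Lemma L2fun_mul f g : L2fun f -> L2fun g ->
  cintegrable (fun t => f t * (g t)^*).
Proof.
move=> Lf Lg; have [[mf _] [mg _]] := (Lf, Lg).
have [mr mi] := cmeasurableM mf (cmeasurable_conjc mg).
have ih : mu.-integrable setT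
    (fun t => (normc (f t) ^+ 2)%:E + (normc (g t) ^+ 2)%:E)%E.
  by apply: integrableD => //; exact: L2fun_integrable.
split; apply: le_integrable ih => //.
- exact/measurable_EFinP.
- move=> t _ /=; rewrite lee_fin [leRHS]ger0_norm ?addr_ge0 ?sqr_ge0//.
  rewrite !sqr_normc ReM Re_conjc Im_conjc ler_norml; apply/andP; split.
    have := sqr_ge0 (Re (f t) + Re (g t)); have := sqr_ge0 (Im (f t) + Im (g t)).
    have := sqr_ge0 (Re (f t)); have := sqr_ge0 (Im (f t)).
    have := sqr_ge0 (Re (g t)); have := sqr_ge0 (Im (g t)).
    lra.
  have := sqr_ge0 (Re (f t) - Re (g t)); have := sqr_ge0 (Im (f t) - Im (g t)).
  have := sqr_ge0 (Re (f t)); have := sqr_ge0 (Im (f t)).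
  have := sqr_ge0 (Re (g t)); have := sqr_ge0 (Im (g t)).
  lra.
- exact/measurable_EFinP.
- move=> t _ /=; rewrite lee_fin [leRHS]ger0_norm ?addr_ge0 ?sqr_ge0//.
  rewrite !sqr_normc ImM Re_conjc Im_conjc ler_norml; apply/andP; split.
    have := sqr_ge0 (Re (f t) - Im (g t)); have := sqr_ge0 (Im (f t) + Re (g t)).
    have := sqr_ge0 (Re (f t)); have := sqr_ge0 (Im (f t)).
    have := sqr_ge0 (Re (g t)); have := sqr_ge0 (Im (g t)).
    lra.
  have := sqr_ge0 (Re (f t) + Im (g t)); have := sqr_ge0 (Im (f t) - Re (g t)).
  have := sqr_ge0 (Re (f t)); have := sqr_ge0 (Im (f t)).
  have := sqr_ge0 (Re (g t)); have := sqr_ge0 (Im (g t)).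
  lra.
Qed.

Lemma cintegrableD f g : cintegrable f -> cintegrable g -> cintegrable (f + g).
Proof.
move=> [fr fi] [gr gi]; split.
  rewrite (_ : _ \o _ = (EFin \o (Re \o f)) \+ (EFin \o (Re \o g)))%E.
    exact: integrableD.
  by apply/funext => t /=; rewrite ReD.
rewrite (_ : _ \o _ = (EFin \o (Im \o f)) \+ (EFin \o (Im \o g)))%E.
  exact: integrableD.
by apply/funext => t /=; rewrite ImD.
Qed.

Lemma cintegrableZ c f : cintegrable f -> cintegrable (fun t => c * f t).
Proof.
move=> [fr fi]; split.
  rewrite (_ : _ \o _ = (fun t => (Re c)%:E * (EFin \o (Re \o f)) t) \+
     (fun t => (- Im c)%:E * (EFin \o (Im \o f)) t))%E.
    by apply: integrableD => //; exact: integrableZl.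
  by apply/funext => t /=; rewrite ReM -EFinM -EFinM -EFinD mulNr.
rewrite (_ : _ \o _ = (fun t => (Re c)%:E * (EFin \o (Im \o f)) t) \+
     (fun t => (Im c)%:E * (EFin \o (Re \o f)) t))%E.
  by apply: integrableD => //; exact: integrableZl.
by apply/funext => t /=; rewrite ImM.
Qed.

Lemma cintegralD f g : cintegrable f -> cintegrable g ->
  cintegral (f + g) = cintegral f + cintegral g.
Proof.
move=> [fr fi] [gr gi]; apply: complex_eqP; rewrite ?ReD ?ImD /=.
  rewrite -RintegralD//; apply: eq_Rintegral => t _; exact: ReD.
rewrite -RintegralD//; apply: eq_Rintegral => t _; exact: ImD.
Qed.

Lemma cintegralZ c f : cintegrable f ->
  cintegral (fun t => c * f t) = c * cintegral f.
Proof.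
move=> [fr fi]; apply: complex_eqP; rewrite ?ReM ?ImM /=.
  rewrite -RintegralZl// -RintegralZl// -RintegralB//; last 2 first.
  - exact: (integrableZl _ (Re c) fr).
  - exact: (integrableZl _ (Im c) fi).
  by apply: eq_Rintegral => t _; rewrite ReM.
rewrite -RintegralZl// -RintegralZl// -RintegralD//; last 2 first.
- exact: (integrableZl _ (Re c) fi).
- exact: (integrableZl _ (Im c) fr).
by apply: eq_Rintegral => t _; rewrite ImM.
Qed.

Lemma ae_eq_cintegral f g : cmeasurable f -> cmeasurable g ->
  {ae mu, forall t, f t = g t} -> cintegral f = cintegral g.
Proof.
move=> [fr fi] [gr gi] fg; congr Complex; congr fine.
  apply: ae_eq_integral => //; [exact/measurable_EFinP|exact/measurable_EFinP|].
  by apply: filterS fg => t /= ->.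
apply: ae_eq_integral => //; [exact/measurable_EFinP|exact/measurable_EFinP|].
by apply: filterS fg => t /= ->.
Qed.

End complex_integral.

Section L2.
Context {R : realType} {d : measure_display} {T : measurableType d}.
Variable mu : {measure set T -> \bar R}.

Definition L2fun_pred : {pred T -> R[i]} := [pred f | `[< L2fun mu f >]].

HB.instance Definition _ := GRing.isSubmodClosed.Build R[i] (T -> R[i])
  L2fun_pred (L2fun_submod_closed mu).

Record L2fun_type := L2Fun { L2fun_val : T -> R[i] ; _ : L2fun_val \in L2fun_pred }.

HB.instance Definition _ := [isSub for L2fun_val].
HB.instance Definition _ := [Choice of L2fun_type by <:].
HB.instance Definition _ := [SubChoice_isSubLmodule of L2fun_type by <:].

Lemma L2fun_typeP (f : L2fun_type) : L2fun mu (L2fun_val f).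
Proof. by apply/asboolP; exact: (valP f). Qed.

Definition L2null : {pred L2fun_type} :=
  [pred f | `[< {ae mu, forall t, L2fun_val f t = 0} >]].

Lemma L2null_submod_closed : submod_closed L2null.
Proof.
split; first by apply/asboolP; exact: aeW.
move=> a f g /asboolP f0 /asboolP g0; apply/asboolP.
near=> t; rewrite /= -[LHS]/(a * L2fun_val f t + L2fun_val g t).
rewrite (near f0 t)// (near g0 t)// mulr0 addr0//.
Unshelve. all: by end_near. Qed.

HB.instance Definition _ := GRing.isSubmodClosed.Build R[i] L2fun_type
  L2null L2null_submod_closed.

Definition L2 : Type := Quotient.quot L2null.
HB.instance Definition _ := GRing.Zmodule.on L2.
HB.instance Definition _ := EqQuotient.on L2.

Definition L2scale (a : R[i]) (f : L2) : L2 := \pi_L2 (a *: repr f).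

Lemma pi_L2_eq (f g : L2fun_type) :
  \pi_L2 f = \pi_L2 g <-> {ae mu, forall t, L2fun_val f t = L2fun_val g t}.
Proof.
split.
  move=> /eqP; rewrite -Quotient.idealrBE => /asboolP h; move: h.
  by apply: filterS => t /eqP; rewrite subr_eq0 => /eqP.
move=> fg; apply/eqP; rewrite -Quotient.idealrBE; apply/asboolP.
by apply: filterS fg => t /= E; apply/eqP; rewrite subr_eq0 E.
Qed.

Lemma pi_L2D f g : \pi_L2 (f + g) = \pi_L2 f + \pi_L2 g.
Proof. exact: (Quotient.pi_add L2null f g). Qed.

Lemma repr_piL2 f : {ae mu, forall t, L2fun_val (repr (\pi_L2 f)) t = L2fun_val f t}.
Proof. by apply/pi_L2_eq; rewrite reprK. Qed.

Lemma pi_L2Z a f : \pi_L2 (a *: f) = L2scale a (\pi_L2 f).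
Proof.
apply/pi_L2_eq; apply: filterS (repr_piL2 f) => t E.
by rewrite -[LHS]/(a * L2fun_val f t) -[RHS]/(a * L2fun_val (repr (\pi_L2 f)) t) E.
Qed.

Lemma L2scaleA a b f : L2scale a (L2scale b f) = L2scale (a * b) f.
Proof.
by elim/quotW: f => f; rewrite -(pi_L2Z b f) -(pi_L2Z a) -(pi_L2Z _ f) scalerA.
Qed.

Lemma L2scale1 : left_id 1 L2scale.
Proof. by elim/quotW=> f; rewrite -(pi_L2Z 1 f) scale1r. Qed.

Lemma L2scaleDr : right_distributive L2scale +%R.
Proof.
move=> a; elim/quotW=> f; elim/quotW=> g.
by rewrite -pi_L2D -(pi_L2Z a f) -(pi_L2Z a g) -(pi_L2Z a (f + g)) -pi_L2D scalerDr.
Qed.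

Lemma L2scaleDl f : {morph L2scale^~ f : a b / a + b}.
Proof.
move=> a b; elim/quotW: f => f.
by rewrite -(pi_L2Z a f) -(pi_L2Z b f) -(pi_L2Z _ f) -pi_L2D scalerDl.
Qed.

HB.instance Definition _ := GRing.Zmodule_isLmodule.Build R[i] L2
  L2scaleA L2scale1 L2scaleDr L2scaleDl.

(* the representative chosen by the quotient; only its almost everywhere
   class is meaningful *)
Definition L2_fun (f : L2) : T -> R[i] := L2fun_val (repr f).
Coercion L2_fun : L2 >-> Funclass.

Definition mkL2 (f : T -> R[i]) (Lf : L2fun mu f) : L2 :=
  \pi_L2 (L2Fun (asboolT Lf)).

Lemma L2_funP (f : L2) : L2fun mu f.
Proof. exact: L2fun_typeP. Qed.

Lemma mkL2E f Lf : {ae mu, forall t, @mkL2 f Lf t = f t}.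
Proof. exact: repr_piL2. Qed.

Lemma L2_funZD a (f g : L2) : {ae mu, forall t, (a *: f + g : L2) t = a * f t + g t}.
Proof.
have -> : a *: f + g = \pi_L2 (a *: repr f + repr g).
  by rewrite pi_L2D reprK.
exact: repr_piL2.
Qed.

Lemma L2_eqP (f g : L2) : {ae mu, forall t, f t = g t} -> f = g.
Proof. by move=> fg; rewrite -[f]reprK -[g]reprK; apply/pi_L2_eq. Qed.

Definition inner (f g : L2) : R[i] := cintegral mu (fun t => f t * (g t)^*).

Definition L2norm (f : L2) : R := Num.sqrt (\int[mu]_t (normc (f t) ^+ 2)).

Lemma inner_linear a (f g h : L2) :
  inner (a *: f + g) h = a * inner f h + inner g h.
Proof.
rewrite /inner.
have If := L2fun_mul (L2_funP f) (L2_funP h).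
have Ig := L2fun_mul (L2_funP g) (L2_funP h).
rewrite -(cintegralZ a If) -cintegralD//; last exact: cintegrableZ.
apply: ae_eq_cintegral.
- exact: cmeasurableM (L2_funP _).1 (cmeasurable_conjc (L2_funP _).1).
- apply: cmeasurableD; last exact: cmeasurableM (L2_funP _).1 (cmeasurable_conjc (L2_funP _).1).
  apply: (@cmeasurableM _ _ _ (fun=> a)); first exact: cmeasurable_cst.
  exact: cmeasurableM (L2_funP _).1 (cmeasurable_conjc (L2_funP _).1).
- apply: filterS (L2_funZD a f g) => t ->.
  by rewrite mulrDl -mulrA.
Qed.

Lemma cintegral_conjc f : cintegrable mu f ->
  cintegral mu (fun t => (f t)^*) = (cintegral mu f)^*.
Proof.
move=> [fr fi]; apply: complex_eqP; rewrite ?Re_conjc ?Im_conjc /=.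
  by apply: eq_Rintegral => t _; rewrite Re_conjc.
rewrite -mulN1r -RintegralZl//.
by apply: eq_Rintegral => t _; rewrite Im_conjc mulN1r.
Qed.

Lemma innerC (f g : L2) : inner f g = (inner g f)^*.
Proof.
rewrite /inner -cintegral_conjc; last exact: L2fun_mul (L2_funP _) (L2_funP _).
congr cintegral; apply/funext => t.
by rewrite rmorphM/= conjcK mulrC.
Qed.

End L2.

Section L2norm.
Context {R : realType} {d : measure_display} {T : measurableType d}.
Variable mu : {measure set T -> \bar R}.

Lemma L2norm_ge0 (f : L2 mu) : 0 <= L2norm f.
Proof. exact: sqrtr_ge0. Qed.

Lemma sqr_L2norm (f : L2 mu) : L2norm f ^+ 2 = \int[mu]_t (normc (f t) ^+ 2).
Proof. by rewrite sqr_sqrtr// Rintegral_ge0// => t _; exact: sqr_ge0. Qed.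

Lemma sqr_L2normZD a (f g : L2 mu) :
  L2norm (a *: f + g) ^+ 2 <=
  2 * normc a ^+ 2 * L2norm f ^+ 2 + 2 * L2norm g ^+ 2.
Proof.
have If := L2fun_integrable (L2_funP f).
have Ig := L2fun_integrable (L2_funP g).
have Iaf : mu.-integrable setT
    (EFin \o (fun t => 2 * normc a ^+ 2 * normc (f t) ^+ 2)).
  exact: (integrableZl _ (2 * normc a ^+ 2) If).
have I2g : mu.-integrable setT (EFin \o (fun t => 2 * normc (g t) ^+ 2)).
  exact: (integrableZl _ 2 Ig).
rewrite !sqr_L2norm -!RintegralZl// -RintegralD//.
have Iaffg := L2fun_integrable (L2_funP (a *: f + g)).
have Isum : mu.-integrable setT (EFin \o (fun t =>
    2 * normc a ^+ 2 * normc (f t) ^+ 2 + 2 * normc (g t) ^+ 2)).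
  exact: (integrableD _ Iaf I2g).
rewrite /Rintegral fine_le//.
- exact: (integrable_fin_num _ Iaffg).
- exact: (integrable_fin_num _ Isum).
apply: ae_ge0_le_integral => //.
- by move=> t _; rewrite lee_fin sqr_ge0.
- exact: measurable_int Iaffg.
- move=> t _; rewrite lee_fin; apply: addr_ge0; [apply: mulr_ge0; [apply: mulr_ge0|]|apply: mulr_ge0]; by rewrite ?sqr_ge0.
- exact: measurable_int Isum.
- apply: filterS (L2_funZD a f g) => t E _; rewrite lee_fin E.
  apply: le_trans (sqr_normcD _ _) _.
  by rewrite normcM exprMn mulrA.
Qed.

End L2norm.

Section timefreq.
Context {R : realType} (d : nat).
Local Notation leb := (@lebesgue_cV R d).

Definition expi (x : R) : R[i] := cos x +i* sin x.

Lemma normc_expi x : normc (expi x) = 1.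
Proof. by rewrite /= cos2Dsin2 sqrtr1. Qed.

Definition dotcV (x y : 'cV[R]_d) : R := \sum_i x i ord0 * y i ord0.

(* z = (x, omega) with x the upper and omega the lower half of z:
   (pi(z) f)(t) = e^(2 pi i t.omega) f(t - x) *)
Definition tf_shift (z : 'cV[R]_(d + d)) (f : 'cV[R]_d -> R[i]) :
    'cV[R]_d -> R[i] :=
  fun t => expi (2 * pi * dotcV t (dsubmx z)) * f (t - usubmx z).

Lemma cmeasurable_modulation (w : 'cV[R]_d) :
  cmeasurable (fun t => expi (2 * pi * dotcV t w)).
Proof.
have m : measurable_fun setT (fun t => 2 * pi * dotcV t w).
  apply: measurable_funM => //; apply: measurable_sum => i.
  by apply: measurable_funM => //; exact: measurable_mxentry.
split.
  exact: (measurableT_comp (continuous_measurable_fun (@continuous_cos R)) m).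
exact: (measurableT_comp (continuous_measurable_fun (@continuous_sin R)) m).
Qed.

Lemma measurable_subcV (x : 'cV[R]_d) :
  measurable_fun setT (fun t : 'cV[R]_d => t - x).
Proof. exact: measurable_addcV. Qed.

Lemma lebesgue_subcV_ae (x : 'cV[R]_d) (P : 'cV[R]_d -> Prop) :
  {ae leb, forall t, P t} -> {ae leb, forall t, P (t - x)}.
Proof.
move=> [N [mN N0 PN]]; exists ((fun t => t - x) @^-1` N); split.
- by rewrite -[X in measurable X]setTI; exact: measurable_subcV.
- by rewrite -[RHS]N0; exact: lebesgue_cV_shift.
- by move=> t /= Pt; exact: PN.
Qed.

Lemma L2fun_tf_shift z f : L2fun leb f -> L2fun leb (tf_shift z f).
Proof.
move=> [mf f2]; have ms := measurable_subcV (usubmx z); split.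
  apply: cmeasurableM; first exact: cmeasurable_modulation.
  by split; [exact: (measurableT_comp mf.1 ms)|exact: (measurableT_comp mf.2 ms)].
under eq_integral do rewrite normcM normc_expi mul1r.
have mn : measurable_fun setT (fun t => (normc (f t) ^+ 2)%:E).
  by apply/measurable_EFinP; exact: measurable_sqr_normc.
rewrite -(@ge0_integral_pushforward _ _ _ _ _ _ ms leb setT
  (fun t => (normc (f t) ^+ 2)%:E))//; last first.
  by move=> t _; rewrite lee_fin sqr_ge0.
rewrite (@eq_measure_integral _ _ _ _ leb)//.
by move=> A mA _; exact: lebesgue_cV_shift.
Qed.

Definition tf (z : 'cV[R]_(d + d)) (f : L2 leb) : L2 leb :=
  mkL2 (L2fun_tf_shift z (L2_funP f)).

Lemma tf_linear z a (f g : L2 leb) : tf z (a *: f + g) = a *: tf z f + tf z g.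
Proof.
apply: L2_eqP; near=> t.
rewrite (near (L2_funZD a (tf z f) (tf z g)) t)//.
rewrite (near (mkL2E (L2fun_tf_shift z (L2_funP f))) t)//.
rewrite (near (mkL2E (L2fun_tf_shift z (L2_funP g))) t)//.
rewrite (near (mkL2E (L2fun_tf_shift z (L2_funP (a *: f + g)))) t)//.
rewrite /tf_shift.
rewrite (near (lebesgue_subcV_ae (usubmx z) (L2_funZD a f g)) t)//.
by rewrite mulrDr mulrCA.
Unshelve. all: by end_near. Qed.

End timefreq.

Section gaussian.
Context {R : realType}.

Let g n (v : 'cV[R]_n) : R := expR (- \sum_i v i ord0 ^+ 2).

Let mg n : measurable_fun setT (@g n).
Proof.
apply: measurableT_comp; first exact: measurable_expR.
apply: measurable_funN; apply: measurable_sum => i.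
by apply: measurable_funX; exact: measurable_mxentry.
Qed.

Let g_consc n p : g (@consc R n p) = gauss_fun p.1 * g p.2.
Proof.
rewrite /g big_ord_recl consc0 opprD expRD; congr (_ * expR (- _)).
by apply: eq_bigr => i _; rewrite consc_lift.
Qed.

Let g_finite n : (\int[lebesgue_cV n]_v (g v)%:E < +oo)%E.
Proof.
elim: n => [|n IHn].
rewrite integral_dirac//; last by apply/measurable_EFinP; exact: mg.
  by rewrite diracT mul1e ltry.
rewrite /= /lebesgue_step ge0_integral_pushforward//; last 3 first.
- exact: measurable_consc.
- by apply/measurable_EFinP; exact: mg.
- by move=> v _; rewrite lee_fin expR_ge0.
rewrite preimage_setT.
have mgc : measurable_fun setT (EFin \o @g n.+1 \o @consc R n).
  have mg' : measurable_fun setT (EFin \o @g n.+1) by apply/measurable_EFinP; exact: mg.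
  exact: (measurableT_comp mg' (@measurable_consc R n)).
rewrite fubini_tonelli1//; last by move=> p; rewrite lee_fin expR_ge0.
pose c := (\int[lebesgue_cV n]_v (g v)%:E)%E.
have c0 : (0 <= c)%E by apply: integral_ge0 => v _; rewrite lee_fin expR_ge0.
have cf : c \is a fin_num by rewrite ge0_fin_numE.
rewrite (eq_integral (fun x : measurableTypeR R => (fine c)%:E * (gauss_fun x)%:E)%E); last first.
  move=> x _; rewrite /fubini_F fineK// muleC.
  rewrite (eq_integral (fun v => (gauss_fun x)%:E * (g v)%:E)%E); last first.
    by move=> v _; rewrite /= g_consc.
  rewrite ge0_integralZl_EFin//; last exact: gauss_fun_ge0.
  - by move=> v _; rewrite lee_fin expR_ge0.
  - by apply/measurable_EFinP; exact: mg.
rewrite integralZl//; last exact: integrableT_gauss.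
by rewrite integralT_gauss -EFinM ltry.
Qed.

(* the Euclidean norm of t, whereas `|t| is the max norm *)
Definition gauss_cV n (t : 'cV[R]_n) : R[i] :=
  (expR (- (pi * \sum_i t i ord0 ^+ 2)))%:C.

Lemma L2fun_gauss_cV n : L2fun (lebesgue_cV n) (@gauss_cV n).
Proof.
have mG : cmeasurable (@gauss_cV n).
  split; last exact: measurable_cst.
  apply: measurableT_comp; first exact: measurable_expR.
  apply: measurable_funN; apply: measurable_funM => //.
  by apply: measurable_sum => i; apply: measurable_funX; exact: measurable_mxentry.
split => //; apply: le_lt_trans (g_finite n); apply: ge0_le_integral => //.
- by move=> t _; rewrite lee_fin sqr_ge0.
- by apply/measurable_EFinP; exact: measurable_sqr_normc.
- by apply/measurable_EFinP; exact: mg.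
move=> t _; rewrite lee_fin sqr_normc /= expr0n addr0 -expRM_natl ler_expR.
set s := \sum_i _; have s0 : 0 <= s by apply: sumr_ge0 => i _; exact: sqr_ge0.
have := pi_ge2 R; nra.
Qed.

End gaussian.

Lemma esumZ_le (R : realType) (T : choiceType) (c : R) (a : T -> \bar R) :
  0 <= c -> (forall t, 0 <= a t)%E ->
  (\esum_(t in [set: T]) (c%:E * a t) <= c%:E * \esum_(t in [set: T]) a t)%E.
Proof.
move=> c0 a0; apply: ub_ereal_sup => _ [X fX <-].
rewrite -ge0_mule_fsumr//; apply: lee_wpmul2l; first by rewrite lee_fin.
by apply: esum_ge; exists X.
Qed.

Section heisenberg.
Context {R : realType} (d : nat).
Local Notation leb := (@lebesgue_cV R d).
Local Notation L2Rd := (L2 leb).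
Implicit Types f g : L2Rd.

Definition gaussian : L2Rd := mkL2 (L2fun_gauss_cV d).

Definition stft g f (z : 'cV[R]_(d + d)) : R[i] := inner f (tf z g).

Definition weight (z : 'cV[R]_(d + d)) : R := 1 + \sum_i `|z i ord0|.

Definition M1 f : Prop :=
  cintegrable (@lebesgue_cV R (d + d)) (fun z => stft gaussian f z * (weight z)%:C).

Definition lattice_pt (L : 'M[R]_(d + d)) (k : 'cV[int]_(d + d)) :
  'cV[R]_(d + d) := L *m map_mx intr k.

Definition bessel_bound g (L : 'M[R]_(d + d)) (B : R) : Prop :=
  0 < B /\ forall f,
  (\esum_(k in [set: 'cV[int]_(d + d)])
     (normc (inner f (tf (lattice_pt L k) g)) ^+ 2)%:E <= (B * L2norm f ^+ 2)%:E)%E.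

(* valued in \bar R, so that the infimum is +oo if there is no Bessel bound *)
Definition heis_norm (L : 'M[R]_(d + d)) g : \bar R :=
  ereal_inf [set (Num.sqrt B)%:E | B in bessel_bound g L].

(* The completion of M^1_nu for heis_norm L, realized inside L^2: the L^2-limits
   of the sequences of M^1_nu that are Cauchy for heis_norm L. *)
Definition heis (L : 'M[R]_(d + d)) f : Prop :=
  exists u : nat -> L2Rd,
  [/\ forall n, M1 (u n),
      forall e : R, 0 < e -> exists N, forall m n, (N <= m)%N -> (N <= n)%N ->
        (heis_norm L (u m - u n)%R < e%:E)%E &
      L2norm (u n - f) @[n --> \oo] --> (0 : R)].

Lemma stft_linear a f g h z :
  stft h (a *: f + g) z = a * stft h f z + stft h g z.
Proof. exact: inner_linear. Qed.

Lemma inner_linearr a f g h :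
  inner h (a *: f + g) = a^* * inner h f + inner h g.
Proof.
rewrite innerC inner_linear (innerC h f) (innerC h g).
by rewrite (rmorphD (@conjc R)) (rmorphM (@conjc R)).
Qed.

Lemma inner0l g : inner (0 : L2Rd) g = 0.
Proof.
have := inner_linear 1 0 0 g.
by rewrite scale1r addr0 mul1r => /eqP; rewrite -subr_eq0 opprD addrA subrr sub0r oppr_eq0 => /eqP.
Qed.

Lemma M1_submod_closed : submod_closed [pred f | `[< M1 f >]].
Proof.
split.
  apply/asboolP; rewrite /M1.
  rewrite (_ : (fun z => _) = (fun=> 0)); last first.
    by apply/funext => z; rewrite /stft inner0l mul0r.
  by split; exact: integrable0.
move=> a f g /asboolP Mf /asboolP Mg; apply/asboolP; rewrite /M1.
rewrite (_ : (fun z => _) = (fun z => a * (stft gaussian f z * (weight z)%:C)) +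
   (fun z => stft gaussian g z * (weight z)%:C)).
  by apply: cintegrableD => //; exact: cintegrableZ.
by apply/funext => z; rewrite stft_linear mulrDl -mulrA.
Qed.

Lemma bessel_boundZD L a f g B C : bessel_bound f L B -> bessel_bound g L C ->
  bessel_bound (a *: f + g) L (2 * (normc a ^+ 2 * B) + 2 * C).
Proof.
move=> [B0 hB] [C0 hC]; split.
  have := mulr_ge0 (sqr_ge0 (normc a)) (ltW B0); lra.
move=> h.
pose F k := (normc (inner h (tf (lattice_pt L k) f)) ^+ 2)%:E.
pose G k := (normc (inner h (tf (lattice_pt L k) g)) ^+ 2)%:E.
have F0 k : (0 <= F k)%E by rewrite lee_fin sqr_ge0.
have G0 k : (0 <= G k)%E by rewrite lee_fin sqr_ge0.
have a0 : 0 <= 2 * normc a ^+ 2 by rewrite mulr_ge0 ?sqr_ge0.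
apply: (@le_trans _ _ (\esum_(k in [set: 'cV[int]_(d + d)])
  ((2 * normc a ^+ 2)%:E * F k + 2%:E * G k))%E).
  apply: le_esum => k _; rewrite lee_fin tf_linear inner_linearr.
  apply: le_trans (sqr_normcD _ _) _.
  rewrite normcM exprMn !mulrA (_ : normc a^* = normc a)//.
  by case: (a) => x y /=; rewrite sqrrN.
rewrite esumD; last 2 first.
- by move=> k _; apply: mule_ge0.
- by move=> k _; apply: mule_ge0.
rewrite [X in (_ <= X%:E)%E]mulrDl [X in (_ <= X)%E]EFinD; apply: leeD.
  apply: le_trans (esumZ_le _ _) _ => //.
  have -> : 2 * (normc a ^+ 2 * B) * L2norm h ^+ 2 =
    (2 * normc a ^+ 2) * (B * L2norm h ^+ 2) by ring.
  by rewrite [leRHS]EFinM; apply: lee_wpmul2l; [rewrite lee_fin|exact: hB].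
apply: le_trans (esumZ_le _ _) _ => //.
by rewrite -mulrA [leRHS]EFinM; apply: lee_wpmul2l; [rewrite lee_fin|exact: hC].
Qed.

Lemma heis_norm_lt L f e : (heis_norm L f < e%:E)%E ->
  exists2 B, bessel_bound f L B & Num.sqrt B < e.
Proof. by move=> /ereal_inf_lt[_ [B hB <-]]; rewrite lte_fin; exists B. Qed.

Lemma heis_norm_le L f B : bessel_bound f L B -> (heis_norm L f <= (Num.sqrt B)%:E)%E.
Proof. by move=> hB; apply: ereal_inf_lbound; exists B. Qed.

Lemma heis_norm0_lt L e : 0 < e -> (heis_norm L 0%R < e%:E)%E.
Proof.
move=> e0; have e20 : 0 < e / 2 by lra.
apply: le_lt_trans (@heis_norm_le L 0 ((e / 2) ^+ 2) _) _.
  split; first by rewrite exprn_gt0.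
  move=> f; rewrite esum1; first by rewrite lee_fin mulr_ge0 ?sqr_ge0.
  move=> k _; suff -> : tf (lattice_pt L k) 0 = 0.
    by rewrite innerC inner0l conjc0 normc0 expr0n.
  have := tf_linear (lattice_pt L k) 1 0 0.
  rewrite !scale1r addr0 => /eqP.
  by rewrite -subr_eq0 opprD addrA subrr sub0r oppr_eq0 => /eqP.
by rewrite lte_fin sqrtr_sqr gtr0_norm//; lra.
Qed.

Lemma L2norm0 : L2norm (0 : L2Rd) = 0.
Proof.
have z0 : {ae leb, forall t, (0 : L2Rd) t = 0}.
  rewrite -(addNr (0 : L2Rd)) -scaleN1r.
  by apply: filterS (L2_funZD (-1) 0 0) => t ->; rewrite mulN1r addNr.
apply/eqP; rewrite -sqrf_eq0 sqr_L2norm; apply/eqP.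
rewrite /Rintegral (ae_eq_integral (cst 0%E))// ?integral0//.
  by apply/measurable_EFinP; exact: measurable_sqr_normc (L2_funP _).1.
by apply: filterS z0 => t -> _; rewrite normc0 expr0n.
Qed.

Lemma heis_submod_closed L : submod_closed [pred f | `[< heis L f >]].
Proof.
split.
  apply/asboolP; exists (fun=> 0); split.
  - by move=> _; exact/asboolP/(proj1 M1_submod_closed).
  - by move=> e e0; exists 0%N => m n _ _; rewrite subrr; exact: heis_norm0_lt.
  - by rewrite subrr L2norm0; exact: cvg_cst.
move=> a f g /asboolP[u [uM uC uf]] /asboolP[v [vM vC vg]]; apply/asboolP.
exists (fun n => a *: u n + v n); split.
- move=> n; apply/asboolP; apply: (proj2 M1_submod_closed) => /=; exact/asboolP.
- move=> e e0; pose r := normc a.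
  have r0 : 0 <= r := normc_ge0 a.
  pose del := e / (2 * (r + 2)).
  have r2 : 0 < 2 * (r + 2) by lra.
  have d0 : 0 < del by rewrite divr_gt0.
  have [N1 h1] := uC _ d0; have [N2 h2] := vC _ d0.
  exists (maxn N1 N2) => m n; rewrite !geq_max => /andP[m1 m2] /andP[n1 n2].
  have [B bB lB] := heis_norm_lt (h1 _ _ m1 n1).
  have [C bC lC] := heis_norm_lt (h2 _ _ m2 n2).
  rewrite (_ : _ - _ = a *: (u m - u n) + (v m - v n)); last first.
    by rewrite scalerBr opprD addrACA.
  apply: le_lt_trans (heis_norm_le (bessel_boundZD a bB bC)) _.
  rewrite lte_fin -(gtr0_norm e0) -sqrtr_sqr ltr_sqrt ?exprn_gt0//.
  have sq x : 0 < x -> Num.sqrt x < del -> x < del ^+ 2.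
    by move=> x0 xd; rewrite -[x]sqr_sqrtr ?ltW// ltrXn2r// ?nnegrE ?sqrtr_ge0 ?ltW.
  have Bd := sq _ bB.1 lB; have Cd := sq _ bC.1 lC.
  have -> : e = del * (2 * (r + 2)) by rewrite divfK// gt_eqF.
  have := sqr_ge0 del; have := bB.1; rewrite -/r; nra.
- apply: (@squeeze_cvgr _ _ _ _ (fun=> 0)
    (fun n => 2 * normc a * L2norm (u n - f) + 2 * L2norm (v n - g))).
  + near=> n; rewrite L2norm_ge0/=.
    rewrite (_ : _ - _ = a *: (u n - f) + (v n - g)); last first.
      by rewrite scalerBr opprD addrACA.
    have p0 := L2norm_ge0 (u n - f); have q0 := L2norm_ge0 (v n - g).
    have a0 : 0 <= normc a := normc_ge0 a.
    have ap0 : 0 <= normc a * L2norm (u n - f) by exact: mulr_ge0.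
    rewrite -(@ler_pXn2r _ 2)// ?nnegrE ?L2norm_ge0//; last by lra.
    by apply: le_trans (sqr_L2normZD _ _ _) _; nra.
  + exact: cvg_cst.
  + rewrite -[X in _ --> X](_ : 2 * normc a * 0 + 2 * 0 = 0); last by ring.
    by apply: cvgD; apply: cvgMr.
Unshelve. all: by end_near. Qed.

Record M1space := M1Space { M1_val :> L2Rd ; M1P : M1 M1_val }.

Section heis_module.
Variable L : 'M[R]_(d + d).

Definition heis_pred : {pred L2Rd} := [pred f | `[< heis L f >]].

HB.instance Definition _ := GRing.isSubmodClosed.Build R[i] L2Rd
  heis_pred (heis_submod_closed L).

Record heis_module := HeisModule {
  heis_val : L2Rd ; _ : heis_val \in heis_pred }.

HB.instance Definition _ := [isSub for heis_val].
HB.instance Definition _ := [Choice of heis_module by <:].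
HB.instance Definition _ := [SubChoice_isSubLmodule of heis_module by <:].

(* for L invertible, heis_norm L is finite on heis L: fine loses nothing *)
Definition heis_fiber_norm (s : heis_module) : R :=
  fine (heis_norm L (heis_val s)).

Lemma M1_heis (f : M1space) : (f : L2Rd) \in heis_pred.
Proof.
apply/asboolP; exists (fun=> f : L2Rd); split; first by move=> _; exact: M1P.
  by move=> e e0; exists 0%N => m n _ _; rewrite subrr; exact: heis_norm0_lt.
by rewrite subrr L2norm0; exact: cvg_cst.
Qed.

Definition M1_to_heis (f : M1space) : heis_module := HeisModule (M1_heis f).

End heis_module.

End heisenberg.

Arguments M1space R d : clear implicits.
Arguments heis_module {R d} L.

Record topology_on (T : Type) := TopologyOn {
  opens : set (set T) ;
  opensT : opens setT ;
  opensI : setI_closed opens ;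
  opens_bigcup : forall (I : Type) (f : I -> set T),
    (forall i, opens (f i)) -> opens (\bigcup_i f i) }.

(* T seen as a topologicalType through tau; for T a sigma type, this avoids the
   canonical topology of the library on {x & F x}, the disjoint union one *)
Definition topologized (T : Type) (tau : topology_on T) : Type := T.

Section topologized.
Variables (T : Type) (tau : topology_on T).

HB.instance Definition _ := gen_eqMixin (topologized tau).
HB.instance Definition _ := gen_choiceMixin (topologized tau).
HB.instance Definition _ := isOpenTopological.Build (topologized tau)
  (opensT tau) (@opensI _ tau) (@opens_bigcup _ tau).

End topologized.

Record directed (I : Type) (le : I -> I -> Prop) : Prop := Directed {
  directed_inhabited : exists i : I, True ;
  directed_refl : forall i, le i i ;
  directed_trans : forall i j k, le i j -> le j k -> le i k ;
  directed_ub : forall i j, exists2 k, le i k & le j k }.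

(* a net (s_i) indexed by (I, le) converges to x if s @ net_tails le --> x *)
Definition net_tails (I : Type) (le : I -> I -> Prop) : set_system I :=
  filter_from [set: I] (fun i => [set j | le i j]).

Section banach_bundle.
Context {R : realType}.

Record banach_norm (V : lmodType R[i]) (N : V -> R) : Prop := BanachNorm {
  banach_norm_ge0 : forall v, 0 <= N v ;
  banach_norm_eq0 : forall v, N v = 0 -> v = 0 ;
  banach_normZ : forall a v, N (a *: v) = normc a * N v ;
  banach_normD : forall v w, N (v + w) <= N v + N w ;
  banach_complete : forall u : nat -> V,
    (forall e : R, 0 < e -> exists n0, forall m n, (n0 <= m)%N -> (n0 <= n)%N ->
       N (u m - u n) < e) ->
    exists v, N (u n - v) @[n --> \oo] --> (0 : R) }.

Context {X : topologicalType} (F : X -> lmodType R[i]).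
Variable N : forall x, F x -> R.
Local Notation total := {x : X & F x}.

(* the sum of two elements of the same fiber; the value s for elements of
   different fibers is never used *)
Definition fiber_add (s t : total) : total :=
  match pselect (projT1 t = projT1 s) with
  | left e => existT F (projT1 s)
                (projT2 s + eq_rect _ (fun x => F x) (projT2 t) _ e)
  | right _ => s
  end.

Definition fiber_scale (a : R[i]) (s : total) : total :=
  existT F (projT1 s) (a *: projT2 s).

(* Banach bundles whose total space is the disjoint union of the fibers F x,
   with topology tau, and whose projection is projT1 *)
Record banach_bundle (tau : topology_on total) : Prop := BanachBundle {
  bundle_base_hausdorff : hausdorff_space X ;
  bundle_total_hausdorff : hausdorff_space (topologized tau) ;
  bundle_proj_continuous :
    continuous (fun s : topologized tau => projT1 (s : total)) ;
  bundle_proj_open : forall A : set (topologized tau), open A ->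
    open [set projT1 (s : total) | s in A] ;
  bundle_proj_surjective : forall x : X, exists s : total, projT1 s = x ;
  bundle_fiber_banach : forall x, banach_norm (@N x) ;
  bundle_norm_continuous :
    continuous (fun s : topologized tau => N (projT2 (s : total))) ;
  bundle_add_continuous :
    {within [set p : topologized tau * topologized tau |
               projT1 (p.1 : total) = projT1 (p.2 : total)],
       continuous (fun p => fiber_add p.1 p.2 : topologized tau)} ;
  bundle_scale_continuous : forall a : R[i],
    continuous (fun s : topologized tau => fiber_scale a s : topologized tau) ;
  bundle_net0 : forall (I : Type) (le : I -> I -> Prop)
      (s : I -> topologized tau) (x : X), directed le ->
    projT1 (s i : total) @[i --> net_tails le] --> x ->
    N (projT2 (s i : total)) @[i --> net_tails le] --> (0 : R) ->
    s i @[i --> net_tails le] --> (existT F x 0 : topologized tau) }.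

Definition section_of (tau : topology_on total) (g : forall x, F x) :
  X -> topologized tau := fun x => existT F x (g x).

End banach_bundle.

Definition GL (R : realType) (n : nat) : set 'M[R]_n := [set L | L \in unitmx].
Arguments GL R n : clear implicits.

Section heisenberg_bundle.
Context {R : realType} {d : nat}.

Definition heis_fiber (L : GL R (d + d)) : lmodType R[i] :=
  heis_module (set_val L).

Definition heis_total : Type := {L : GL R (d + d) & heis_fiber L}.

Definition fiber_norm (L : GL R (d + d)) (s : heis_fiber L) : R :=
  heis_fiber_norm s.

Definition const_section (f : M1space R d) (L : GL R (d + d)) : heis_fiber L :=
  M1_to_heis (set_val L) f.

Definition W (f : M1space R d) (U : set (GL R (d + d))) (e : R) : set heis_total :=
  [set s | U (projT1 s) /\
     fiber_norm (projT2 s - const_section f (projT1 s)) < e].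

Definition W_basis : set (set heis_total) :=
  [set A | exists f U e, [/\ open U, 0 < e & A = W f U e]].

End heisenberg_bundle.

Arguments heis_total R d : clear implicits.
Arguments W_basis R d : clear implicits.

(* Main.v *)
From Pilot Require Import Defs.
From HB Require Import structures.
From mathcomp Require Import all_boot all_order all_algebra.
From mathcomp Require Import all_classical all_reals all_analysis.
From mathcomp Require Import measurable_realfun complex ring lra zify.

(** The norm of the fiber over L is the norm of the synthesis operator, which maps a
finite sequence (c_k) to sum_k c_k pi(Lk) g, from l^2 to L^2: it is the adjoint of the
analysis operator that defines the Bessel bounds ([bessel_synthesis],
[heis_norm_leP]). In this form it is visibly a norm, it dominates the L^2 norm, and it
is lower semicontinuous in g and in L, because each inequality that bounds it involves
finitely many atoms. The fibers are therefore Banach spaces in which M^1 is dense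
([heis_banach_norm], [M1_dense]).

The core is the continuity of the norm of a fixed g in M^1 as a function of L, and of
this the upper semicontinuity. The Gram matrix <pi(Lk) g, pi(Ll) g> cannot be
perturbed as a whole: the moduli of its entries depend on l - k only, but their phases
vary with L the faster the farther k is from the origin. Translation by a lattice
point is however unitary and permutes the atoms up to unimodular factors, so that the
synthesis operator has the same norm on the sequences supported in any translate of a
box of indices; and for one box, finitely many atoms matter, which depend continuously
on L ([tf_lipschitz]). Averaging over the translates of a box of side N recovers the
norm on all sequences up to an error O(1/N) ([window_estimate]). The Schur test
controls this error by sum_m |m| |<g, pi(Lm) g>|, which is finite, and bounded locally
uniformly in L, because of the weight in the definition of M^1
([autocorrelation_summable]).

That last fact and [tf_lipschitz] both come from Moyal's formula against the Gaussian
window ([moyal], [moyal_le]): it transfers to g the decay and the regularity of the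
shifts of the Gaussian, whose ambiguity function is explicit
([stft_gaussian_gaussian]). For g in M^1 the formula follows from the Fourier
inversion theorem ([fourier_inversion_ae], [parseval]), which rests on Gaussian means
and on the Fourier transform of the Gaussian ([fourier_egauss]).

The rest holds for every field of Banach spaces over a Hausdorff space with a linear
space of sections whose norms are continuous and whose values are dense: the tubes
around the sections form the basis of a bundle topology ([section_topology_bundle]),
the continuous sections are those that are locally approximated by the given ones
([section_continuousP]), and the topology is unique ([bundle_topology_unique]). For
the uniqueness, tubes are open in any bundle topology that makes the given sections
continuous, since the distance to a continuous section is continuous; conversely the
condition on nets puts a tube around the zero section into any neighbourhood of a
zero vector, and addition carries this tube to any other vector. *)

Set Implicit Arguments.
Unset Strict Implicit.
Unset Printing Implicit Defensive.

Import Order.TTheory GRing.Theory Num.Theory.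
Import numFieldNormedType.Exports.
Import ComplexField.Normc.
Import Pilot.Defs.

Local Open Scope classical_set_scope.
Local Open Scope ring_scope.
Local Open Scope complex_scope.

Local Notation Re := (@complex.Re _).
Local Notation Im := (@complex.Im _).
Local Notation "z ^*" := (conjc z) : ring_scope.

(** * Complex moduli and integrals of complex functions *)

Section complex_modulus.
Context {R : realType}.
Implicit Types z w : R[i].

Lemma normcD_le z w : normc (z + w) <= normc z + normc w.
Proof. exact: le_normcD. Qed.

Lemma normcBC z w : normc (z - w) = normc (w - z).
Proof. by rewrite -normcN opprB. Qed.

Lemma normc_conjc z : normc z^* = normc z.
Proof. by case: z => a b /=; rewrite sqrrN. Qed.

Lemma normc_real (x : R) : normc x%:C = `|x|.
Proof. by rewrite /= expr0n addr0 sqrtr_sqr. Qed.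

Lemma Re_le_normc z : `|Re z| <= normc z.
Proof.
rewrite -(@ler_pXn2r _ 2)// ?nnegrE ?normc_ge0// sqr_normc real_normK ?num_real//.
by rewrite lerDl sqr_ge0.
Qed.

Lemma Im_le_normc z : `|Im z| <= normc z.
Proof.
rewrite -(@ler_pXn2r _ 2)// ?nnegrE ?normc_ge0// sqr_normc real_normK ?num_real//.
by rewrite lerDr sqr_ge0.
Qed.

Lemma normc_le_ReIm z : normc z <= `|Re z| + `|Im z|.
Proof.
rewrite -(@ler_pXn2r _ 2)// ?nnegrE ?normc_ge0 ?addr_ge0// sqr_normc.
rewrite -[Re z ^+ 2]real_normK ?num_real// -[Im z ^+ 2]real_normK ?num_real//.
have := normr_ge0 (Re z); have := normr_ge0 (Im z); nra.
Qed.

Lemma mulr_conjc z : z * z^* = (normc z ^+ 2)%:C.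
Proof.
apply: complex_eqP; rewrite ?ReM ?ImM Re_conjc Im_conjc ?sqr_normc /=; ring.
Qed.

Lemma conjcM z w : (z * w)^* = z^* * w^*.
Proof. exact: (rmorphM (@conjc R)). Qed.

Lemma conjc_realC (a : R) : (a%:C)^* = a%:C.
Proof. by rewrite /= oppr0. Qed.

Lemma Re_realM (a : R) z : Re (a%:C * z) = a * Re z.
Proof. by rewrite ReM /= mul0r subr0. Qed.

Lemma Im_realM (a : R) z : Im (a%:C * z) = a * Im z.
Proof. by rewrite ImM /= mul0r addr0. Qed.

Lemma Re_sum (I : Type) (s : seq I) (P : pred I) (F : I -> R[i]) :
  Re (\sum_(i <- s | P i) F i) = \sum_(i <- s | P i) Re (F i).
Proof. by elim/big_rec2: _ => // i y z _ <-; rewrite ReD. Qed.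

(** Turns estimates of moduli into estimates of real parts. *)
Lemma normc_rot z : exists2 u : R[i], normc u = 1 & u * z = (normc z)%:C.
Proof.
have [->|z0] := eqVneq z 0; first by exists 1; rewrite ?normc1// mulr0 normc0.
have nz0 : normc z != 0 by apply: contra z0 => /eqP/eq0_normc ->.
exists ((normc z)^-1%:C * z^*).
  rewrite normcM normc_conjc normc_real ger0_norm ?invr_ge0 ?normc_ge0//.
  by rewrite mulVf.
rewrite -mulrA [_^* * _]mulrC mulr_conjc -rmorphM/=; congr (_%:C).
by rewrite expr2 mulrA mulVf// mul1r.
Qed.

End complex_modulus.

Section complex_integral_theory.
Context {R : realType} {d : measure_display} {T : measurableType d}.
Variable mu : {measure set T -> \bar R}.
Implicit Types f g h : T -> R[i].

Lemma measurable_normc f : cmeasurable f -> measurable_fun setT (fun t => normc (f t)).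
Proof.
move=> mf.
rewrite (_ : (fun t => _) = (fun t => Num.sqrt (normc (f t) ^+ 2))); last first.
  by apply/funext => t; rewrite sqrtr_sqr ger0_norm ?normc_ge0.
apply: measurableT_comp; last exact: measurable_sqr_normc.
exact: continuous_measurable_fun (@sqrt_continuous R).
Qed.

Lemma cintegrable_cmeasurable f : cintegrable mu f -> cmeasurable f.
Proof.
by move=> [/measurable_int/measurable_EFinP fr /measurable_int/measurable_EFinP fi].
Qed.

Lemma cintegrable_le f (h : T -> R) : cmeasurable f ->
  mu.-integrable setT (EFin \o h) -> (forall t, normc (f t) <= h t) ->
  cintegrable mu f.
Proof.
move=> [mr mi] ih fh; split; apply: le_integrable ih => //.
- exact/measurable_EFinP.
- move=> t _ /=; rewrite lee_fin; apply: le_trans (Re_le_normc _) _.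
  exact: le_trans (fh t) (ler_norm _).
- exact/measurable_EFinP.
- move=> t _ /=; rewrite lee_fin; apply: le_trans (Im_le_normc _) _.
  exact: le_trans (fh t) (ler_norm _).
Qed.

Lemma cintegrable_normc f : cintegrable mu f ->
  mu.-integrable setT (EFin \o (fun t => normc (f t))).
Proof.
move=> If; have [fr fi] := If.
have ih : mu.-integrable setT (EFin \o (fun t => `|Re (f t)| + `|Im (f t)|)).
  by apply: (integrableD _ (integrable_abse fr) (integrable_abse fi)).
apply: le_integrable ih => //.
  by apply/measurable_EFinP/measurable_normc; exact: cintegrable_cmeasurable If.
move=> t _ /=; rewrite lee_fin [leLHS]ger0_norm ?normc_ge0// [leRHS]ger0_norm ?addr_ge0//.
exact: normc_le_ReIm.
Qed.

Lemma cintegrableP f : cmeasurable f ->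
  (\int[mu]_t (normc (f t))%:E < +oo)%E -> cintegrable mu f.
Proof.
move=> mf fi; apply: (@cintegrable_le _ (fun t => normc (f t))) => //.
apply/integrableP; split; first exact/measurable_EFinP/measurable_normc.
by under eq_integral do rewrite gee0_abs ?lee_fin ?normc_ge0//.
Qed.

Lemma eq_cintegral f g : f =1 g -> cintegral mu f = cintegral mu g.
Proof. by move=> /funext ->. Qed.

Lemma cintegrable_conjc f : cintegrable mu f -> cintegrable mu (fun t => (f t)^*).
Proof.
move=> If; apply: (cintegrable_le _ (cintegrable_normc If)).
  by apply: cmeasurable_conjc; exact: cintegrable_cmeasurable If.
by move=> t; rewrite normc_conjc.
Qed.

Lemma cintegrableM_bounded f g (C : R) : cintegrable mu f -> cmeasurable g ->
  (forall t, normc (g t) <= C) -> cintegrable mu (fun t => f t * g t).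
Proof.
move=> If mg gC.
have ih : mu.-integrable setT (EFin \o (fun t => C * normc (f t))).
  exact: (integrableZl _ C (cintegrable_normc If)).
apply: (cintegrable_le _ ih).
  by apply: cmeasurableM => //; exact: cintegrable_cmeasurable If.
by move=> t; rewrite normcM mulrC; apply: ler_wpM2r => //; exact: normc_ge0.
Qed.

Lemma cintegralB f g : cintegrable mu f -> cintegrable mu g ->
  cintegral mu (fun t => f t - g t) = cintegral mu f - cintegral mu g.
Proof.
move=> If Ig; rewrite -mulN1r -(cintegralZ (-1) Ig) -cintegralD//.
  apply: eq_cintegral => t; rewrite -[RHS]/(f t + -1 * g t).
  by rewrite mulN1r.
exact: cintegrableZ.
Qed.

Lemma cintegrableB f g : cintegrable mu f -> cintegrable mu g ->
  cintegrable mu (fun t => f t - g t).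
Proof.
move=> If Ig.
rewrite (_ : (fun t => _) = f + (fun t => -1 * g t)); last first.
  by apply/funext => t; rewrite -[RHS]/(f t + -1 * g t) mulN1r.
by apply: cintegrableD => //; exact: cintegrableZ.
Qed.

Lemma normc_cintegral_le f : cintegrable mu f ->
  normc (cintegral mu f) <= \int[mu]_t normc (f t).
Proof.
move=> If; have [u u1 uz] := normc_rot (cintegral mu f).
have -> : normc (cintegral mu f) = Re (u * cintegral mu f) by rewrite uz.
rewrite -cintegralZ//= -[leLHS]/(\int[mu]_t Re (u * f t)).
apply: le_Rintegral => //; first exact: (cintegrableZ u If).1.
  exact: cintegrable_normc.
move=> t _; apply: le_trans (ler_norm _) _; apply: le_trans (Re_le_normc _) _.
by rewrite normcM u1 mul1r.
Qed.

Lemma cintegral_real (h : T -> R) :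
  cintegral mu (fun t => (h t)%:C) = (\int[mu]_t h t)%:C.
Proof.
apply: complex_eqP => //=; rewrite /Rintegral integral0_eq//.
Qed.

Lemma cintegrable_real (h : T -> R) : mu.-integrable setT (EFin \o h) ->
  cintegrable mu (fun t => (h t)%:C).
Proof. by move=> ih; split => //; exact: integrable0. Qed.

Lemma cdominated_convergence (f_ : nat -> T -> R[i]) f (h : T -> R) :
  (forall n, cmeasurable (f_ n)) -> cmeasurable f ->
  {ae mu, forall t, normc (f_ n t - f t) @[n --> \oo] --> (0 : R)} ->
  mu.-integrable setT (EFin \o h) ->
  (forall n t, normc (f_ n t) <= h t) ->
  normc (cintegral mu (f_ n) - cintegral mu f) @[n --> \oo] --> (0 : R).
Proof.
move=> mf_ mf f_f ih fh.
have part (p : R[i] -> R) : (forall z, `|p z| <= normc z) ->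
    (forall z w, p (z - w) = p z - p w) ->
    (forall g, cmeasurable g -> measurable_fun setT (fun t => p (g t))) ->
    (\int[mu]_t p (f_ n t)) @[n --> \oo] --> \int[mu]_t p (f t).
  move=> pn pB pm.
  have [|||||i1 _ i2] := @dominated_convergence _ _ _ mu setT measurableT
    (fun n t => (p (f_ n t))%:E) (fun t => (p (f t))%:E) (EFin \o h).
  - by move=> n; exact/measurable_EFinP/pm.
  - exact/measurable_EFinP/pm.
  - apply: filterS f_f => t ft _; apply: cvg_EFin; first exact: nearW.
    apply/cvgrPdist_lt => e e0.
    move/cvgrPdist_lt: ft => /(_ _ e0); apply: filterS => n.
    rewrite sub0r normrN ger0_norm ?normc_ge0// => /(le_lt_trans _); apply.
    by rewrite /= -pB normcBC; exact: pn.
  - exact: ih.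
  - apply: aeW => t n _; rewrite /= lee_fin; exact: le_trans (pn _) (fh n t).
  - by apply: fine_cvg; rewrite /Rintegral fineK//; exact: integrable_fin_num i1.
have cr := part Re Re_le_normc (raddfB (@complex.Re R)).
have ci := part Im Im_le_normc (raddfB (@complex.Im R)).
have {}cr := cr (fun g mg => mg.1); have {}ci := ci (fun g mg => mg.2).
apply: (@squeeze_cvgr _ _ _ _ (fun=> 0) (fun n =>
  `|\int[mu]_t Re (f_ n t) - \int[mu]_t Re (f t)| +
  `|\int[mu]_t Im (f_ n t) - \int[mu]_t Im (f t)|)).
- apply: nearW => n; apply/andP; split; first exact: normc_ge0.
  by apply: le_trans (normc_le_ReIm _) _; rewrite !raddfB.
- exact: cvg_cst.
- rewrite -[X in _ --> X](addr0 (0 : R)); apply: cvgD.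
    apply/norm_cvg0P; rewrite -(subrr (\int[mu]_t Re (f t))).
    by apply: cvgB => //; exact: cvg_cst.
  apply/norm_cvg0P; rewrite -(subrr (\int[mu]_t Im (f t))).
  by apply: cvgB => //; exact: cvg_cst.
Qed.

End complex_integral_theory.

Section complex_fubini.
Context {R : realType} {d1 d2 : measure_display}.
Context {T1 : measurableType d1} {T2 : measurableType d2}.
Variable m1 : {sigma_finite_measure set T1 -> \bar R}.
Variable m2 : {sigma_finite_measure set T2 -> \bar R}.
Implicit Types f : T1 * T2 -> R[i].

Lemma cintegrable_prodP f : cmeasurable f ->
  (\int[m1]_x \int[m2]_y (normc (f (x, y)))%:E < +oo)%E ->
  cintegrable (m1 \x m2)%E f.
Proof.
move=> mf fi; apply: cintegrableP => //; rewrite fubini_tonelli1//.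
  by apply/measurable_EFinP; exact: measurable_normc.
by move=> z; rewrite lee_fin normc_ge0.
Qed.

Lemma cintegrable_prodP' f : cmeasurable f ->
  (\int[m2]_y \int[m1]_x (normc (f (x, y)))%:E < +oo)%E ->
  cintegrable (m1 \x m2)%E f.
Proof.
move=> mf fi; apply: cintegrable_prodP => //.
rewrite (fubini_tonelli (fun z => (normc (f z))%:E))//.
  by apply/measurable_EFinP; exact: measurable_normc.
by move=> z; rewrite lee_fin normc_ge0.
Qed.

Lemma cintegrable_prod_le f (h1 : T1 -> R) (h2 : T2 -> R) : cmeasurable f ->
  m1.-integrable setT (EFin \o h1) -> m2.-integrable setT (EFin \o h2) ->
  (forall x, 0 <= h1 x) -> (forall y, 0 <= h2 y) ->
  (forall x y, normc (f (x, y)) <= h1 x * h2 y) ->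
  cintegrable (m1 \x m2)%E f.
Proof.
move=> mf i1 i2 h10 h20 fh; apply: cintegrable_prodP => //.
have m2h := measurable_int _ i2; have m1h := measurable_int _ i1.
apply: (@le_lt_trans _ _ (\int[m1]_x ((h1 x)%:E * \int[m2]_y (h2 y)%:E))%E).
  apply: ge0_le_integral => //.
  - by move=> x _; apply: integral_ge0 => y _; rewrite lee_fin normc_ge0.
  - apply: (measurable_fun_fubini_tonelli_F (fun z => (normc (f z))%:E)).
      by apply/measurable_EFinP; exact: measurable_normc.
    by move=> z; rewrite lee_fin normc_ge0.
  - by apply: emeasurable_funM => //; exact: measurable_cst.
  - move=> x _; rewrite -ge0_integralZl_EFin//; last first.
      by move=> y _; rewrite lee_fin.
    apply: ge0_le_integral => //.
    + by move=> y _; rewrite lee_fin normc_ge0.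
    + apply/measurable_EFinP.
      have := measurableT_comp (measurable_normc mf) (measurable_pair1 x).
      exact.
    + by apply: emeasurable_funM => //; exact: measurable_cst.
    + by move=> y _; rewrite -EFinM lee_fin.
rewrite ge0_integralZr//; last 2 first.
- by move=> x _; rewrite lee_fin.
- by apply: integral_ge0 => y _; rewrite lee_fin.
rewrite lte_mul_pinfty//.
- by apply: integral_ge0 => x _; rewrite lee_fin.
- exact: integrable_fin_num i1.
- exact: integrable_lty i2.
Qed.

(** The integral is the difference of the integrals of the positive and the negative
part, whose measurability is part of Tonelli's theorem. *)
Lemma cmeasurable_param f : cmeasurable f ->
  cmeasurable (fun x => cintegral m2 (fun y => f (x, y))).
Proof.
move=> [mr mi].
have part (p : R[i] -> R) : measurable_fun setT (fun z => p (f z)) ->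
    measurable_fun setT (fun x => \int[m2]_y p (f (x, y))).
  move=> mp; apply: (measurableT_comp (@fine_measurable R setT measurableT)).
  have mpE : measurable_fun setT (EFin \o (fun z => p (f z))) by exact/measurable_EFinP.
  apply: (eq_measurable_fun (fun x =>
     \int[m2]_y ((EFin \o (fun z => p (f z)))^\+ (x, y)) -
     \int[m2]_y ((EFin \o (fun z => p (f z)))^\- (x, y)))%E).
    move=> x _; rewrite [RHS]integralE.
    by congr (_ - _)%E; apply: eq_integral => y _; rewrite !(funeposE, funenegE).
  apply: emeasurable_funB.
    apply: (measurable_fun_fubini_tonelli_F ((EFin \o (fun z => p (f z)))^\+)%E) => //.
    exact: measurable_funepos.
  apply: (measurable_fun_fubini_tonelli_F ((EFin \o (fun z => p (f z)))^\-)%E) => //.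
  exact: measurable_funeneg.
by split; [exact: (part Re mr)|exact: (part Im mi)].
Qed.

Section integrable.
Variable f : T1 * T2 -> R[i].
Hypothesis If : cintegrable (m1 \x m2)%E f.

Lemma ae_cintegrable1 : {ae m1, forall x, cintegrable m2 (fun y => f (x, y))}.
Proof.
have := ae_integrable1 If.1; have := ae_integrable1 If.2.
by apply: filterS2 => x ? ?; split.
Qed.

Let Rfubini (p : R[i] -> R) :
  (m1 \x m2)%E.-integrable setT (EFin \o (p \o f)) ->
  [/\ m1.-integrable setT (EFin \o (fun x => \int[m2]_y p (f (x, y)))),
      m2.-integrable setT (EFin \o (fun y => \int[m1]_x p (f (x, y)))),
      \int[m1]_x \int[m2]_y p (f (x, y)) = \int[(m1 \x m2)%E]_z p (f z) &
      \int[m2]_y \int[m1]_x p (f (x, y)) = \int[(m1 \x m2)%E]_z p (f z)].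
Proof.
move=> ip.
have iF := integrable_fubini_F ip.
have iG : m2.-integrable setT (fubini_G m1 (EFin \o (p \o f))).
  apply/integrableP; split; first exact: measurable_fubini_G ip.
  have mp := measurable_int _ ip.
  apply: le_lt_trans ((integrable21ltyP _ _ mp).1 ip).
  apply: ge0_le_integral => //.
  - by apply: measurableT_comp => //; exact: measurable_fubini_G ip.
  - apply: (measurable_fun_fubini_tonelli_G (abse \o (EFin \o (p \o f)))) => //=.
    exact: measurableT_comp.
  - move=> y _; apply: le_abse_integral => //.
    exact: measurableT_comp mp (measurable_pair2 y).
have mF : measurable_fun setT (fun x => \int[m2]_y p (f (x, y))).
  by apply: measurableT_comp (measurable_fubini_F ip); exact: fine_measurable.
have mG : measurable_fun setT (fun y => \int[m1]_x p (f (x, y))).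
  by apply: measurableT_comp (measurable_fubini_G ip); exact: fine_measurable.
(* The inner integral is made real by [fine], so that it agrees with the extended
   one only where the section is integrable, that is, almost everywhere. *)
have aeF : {ae m1, forall x, setT x ->
    (\int[m2]_y p (f (x, y)))%:E = fubini_F m2 (EFin \o (p \o f)) x}.
  have := ae_integrable1 ip; apply: filterS => x /= ix _.
  by rewrite /Rintegral fineK//; exact: integrable_fin_num ix.
have aeG : {ae m2, forall y, setT y ->
    (\int[m1]_x p (f (x, y)))%:E = fubini_G m1 (EFin \o (p \o f)) y}.
  have := ae_integrable2 ip; apply: filterS => x /= ix _.
  by rewrite /Rintegral fineK//; exact: integrable_fin_num ix.
have e1 := ae_eq_integral _ _ measurableT ((measurable_EFinP _ _).2 mF) (measurable_int _ iF) aeF.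
have e2 := ae_eq_integral _ _ measurableT ((measurable_EFinP _ _).2 mG) (measurable_int _ iG) aeG.
split.
- apply/integrableP; split; first exact/measurable_EFinP.
  rewrite (ae_eq_integral (fun x => `|fubini_F m2 (EFin \o (p \o f)) x|)%E)//.
  + by have /integrableP[] := iF.
  + by apply: measurableT_comp => //; exact/measurable_EFinP.
  + by apply: measurableT_comp => //; exact: measurable_int iF.
  + by apply: filterS aeF => x /= h _; rewrite -h.
- apply/integrableP; split; first exact/measurable_EFinP.
  rewrite (ae_eq_integral (fun x => `|fubini_G m1 (EFin \o (p \o f)) x|)%E)//.
  + by have /integrableP[] := iG.
  + by apply: measurableT_comp => //; exact/measurable_EFinP.
  + by apply: measurableT_comp => //; exact: measurable_int iG.
  + by apply: filterS aeG => x /= h _; rewrite -h.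
- by rewrite /Rintegral -(integral12_prod_meas1 ip) -e1.
- by rewrite /Rintegral -(integral21_prod_meas1 ip) -e2.
Qed.

Lemma cfubini1 :
  cintegral m1 (fun x => cintegral m2 (fun y => f (x, y))) =
  cintegral (m1 \x m2)%E f.
Proof.
have [_ _ e1 _] := Rfubini If.1; have [_ _ e2 _] := Rfubini If.2.
by apply: complex_eqP.
Qed.

Lemma cfubini2 :
  cintegral m2 (fun y => cintegral m1 (fun x => f (x, y))) =
  cintegral (m1 \x m2)%E f.
Proof.
have [_ _ _ e1] := Rfubini If.1; have [_ _ _ e2] := Rfubini If.2.
by apply: complex_eqP.
Qed.

Lemma cfubini :
  cintegral m1 (fun x => cintegral m2 (fun y => f (x, y))) =
  cintegral m2 (fun y => cintegral m1 (fun x => f (x, y))).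
Proof. by rewrite cfubini1 cfubini2. Qed.

Lemma cintegrable_fubini1 : cintegrable m1 (fun x => cintegral m2 (fun y => f (x, y))).
Proof. by have [i1 _ _ _] := Rfubini If.1; have [i2 _ _ _] := Rfubini If.2. Qed.

End integrable.

End complex_fubini.

Section complex_pushforward.
Context {R : realType} {d1 d2 : measure_display}.
Context {T1 : measurableType d1} {T2 : measurableType d2}.
Variable m1 : {measure set T1 -> \bar R}.
Variable m2 : {measure set T2 -> \bar R}.
Variable phi : T1 -> T2.
Hypothesis mphi : measurable_fun setT phi.
Hypothesis m2E : forall A, measurable A -> m2 A = m1 (phi @^-1` A).

Lemma ge0_integral_transfer (f : T2 -> \bar R) : measurable_fun setT f ->
  (forall y, 0 <= f y)%E ->
  (\int[m2]_y f y = \int[m1]_x f (phi x))%E.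
Proof.
move=> mf f0.
rewrite (@eq_measure_integral _ _ _ setT (pushforward m1 phi)); last first.
  by move=> A mA _; rewrite m2E.
by rewrite ge0_integral_pushforward.
Qed.

Lemma cmeasurable_transfer (f : T2 -> R[i]) : cmeasurable f ->
  cmeasurable (fun x => f (phi x)).
Proof.
by move=> [mr mi]; split; [exact: (measurableT_comp mr mphi)|exact: (measurableT_comp mi mphi)].
Qed.

Lemma cintegrable_transfer (f : T2 -> R[i]) : cmeasurable f ->
  cintegrable m2 f <-> cintegrable m1 (fun x => f (phi x)).
Proof.
move=> mf; have e : (\int[m2]_y (normc (f y))%:E = \int[m1]_x (normc (f (phi x)))%:E)%E.
  rewrite ge0_integral_transfer//.
    by apply/measurable_EFinP; exact: measurable_normc.
  by move=> y; rewrite lee_fin normc_ge0.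
split=> [If|If]; apply: cintegrableP => //.
- exact: cmeasurable_transfer.
- rewrite -e; have /integrableP[_] := cintegrable_normc If.
  by under eq_integral do rewrite /= ger0_norm ?normc_ge0//.
- rewrite e; have /integrableP[_] := cintegrable_normc If.
  by under eq_integral do rewrite /= ger0_norm ?normc_ge0//.
Qed.

Lemma cintegral_transfer (f : T2 -> R[i]) : cintegrable m2 f ->
  cintegral m2 f = cintegral m1 (fun x => f (phi x)).
Proof.
move=> If; have mf := cintegrable_cmeasurable If.
have [ir ii] := (cintegrable_transfer mf).1 If.
have e h : measurable_fun setT h ->
    m1.-integrable setT (EFin \o (fun x => h (phi x))) ->
    (\int[m2]_y (h y)%:E = \int[m1]_x (h (phi x))%:E)%E.
  move=> mh ih.
  rewrite (@eq_measure_integral _ _ _ setT (pushforward m1 phi)); last first.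
    by move=> A mA _; rewrite m2E.
  by rewrite integral_pushforward//; exact/measurable_EFinP.
apply: complex_eqP; rewrite /= /Rintegral; congr fine.
  by apply: e => //; exact: mf.1.
by apply: e => //; exact: mf.2.
Qed.

End complex_pushforward.

(** * The Hilbert space L^2 and its completeness *)

Section L2_hilbert.
Context {R : realType} {d : measure_display} {T : measurableType d}.
Variable mu : {measure set T -> \bar R}.
Implicit Types f g h : L2 mu.

Lemma innerE f g : inner f g = cintegral mu (fun t => f t * (g t)^*).
Proof. by []. Qed.

Lemma inner_conj f g : inner f g = (inner g f)^*.
Proof. exact: innerC. Qed.

Lemma innerDl f g h : inner (f + g) h = inner f h + inner g h.
Proof. by rewrite -[f]scale1r inner_linear mul1r scale1r. Qed.

Lemma inner_0l h : inner (0 : L2 mu) h = 0.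
Proof. by apply: (@addrI _ (inner 0 h)); rewrite -innerDl !addr0. Qed.

Lemma innerZl a f h : inner (a *: f) h = a * inner f h.
Proof. by rewrite -[X in inner X h]addr0 inner_linear inner_0l addr0. Qed.

Lemma innerBl f g h : inner (f - g) h = inner f h - inner g h.
Proof. by rewrite innerDl -scaleN1r innerZl mulN1r. Qed.

Lemma inner_0r h : inner h (0 : L2 mu) = 0.
Proof. by rewrite inner_conj inner_0l (rmorph0 (@conjc R)). Qed.

Lemma innerDr f g h : inner f (g + h) = inner f g + inner f h.
Proof.
by rewrite inner_conj innerDl (inner_conj f g) (inner_conj f h) (rmorphD (@conjc R)).
Qed.

Lemma innerZr a f h : inner f (a *: h) = a^* * inner f h.
Proof. by rewrite inner_conj innerZl (inner_conj f h) (rmorphM (@conjc R)). Qed.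

Lemma innerBr f g h : inner f (g - h) = inner f g - inner f h.
Proof.
by rewrite innerDr -scaleN1r innerZr (rmorphN (@conjc R)) (rmorph1 (@conjc R)) mulN1r.
Qed.

Lemma inner_suml (I : Type) (s : seq I) (F : I -> L2 mu) h :
  inner (\sum_(i <- s) F i) h = \sum_(i <- s) inner (F i) h.
Proof.
by elim/big_rec2: _ => [|i y z _ <-]; rewrite ?inner_0l// innerDl.
Qed.

Lemma inner_sumr (I : Type) (s : seq I) (F : I -> L2 mu) h :
  inner h (\sum_(i <- s) F i) = \sum_(i <- s) inner h (F i).
Proof.
by elim/big_rec2: _ => [|i y z _ <-]; rewrite ?inner_0r// innerDr.
Qed.

Lemma inner_self f : inner f f = (L2norm f ^+ 2)%:C.
Proof.
rewrite sqr_L2norm -cintegral_real innerE; apply: eq_cintegral => t.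
exact: mulr_conjc.
Qed.

Lemma sqr_L2norm_inner f : L2norm f ^+ 2 = Re (inner f f).
Proof. by rewrite inner_self. Qed.

Lemma sqr_L2normD f g :
  L2norm (f + g) ^+ 2 = L2norm f ^+ 2 + 2 * Re (inner f g) + L2norm g ^+ 2.
Proof.
rewrite !sqr_L2norm_inner innerDl !innerDr !ReD (inner_conj g f) Re_conjc; ring.
Qed.

Lemma L2normZ a f : L2norm (a *: f) = normc a * L2norm f.
Proof.
apply/eqP; rewrite -(@eqrXn2 _ 2)// ?L2norm_ge0 ?mulr_ge0 ?normc_ge0 ?L2norm_ge0//.
rewrite exprMn sqr_L2norm_inner innerZl innerZr mulrA mulr_conjc inner_self.
by rewrite -rmorphM.
Qed.

Lemma L2norm_0 : L2norm (0 : L2 mu) = 0.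
Proof. by rewrite -(scale0r (0 : L2 mu)) L2normZ normc0 mul0r. Qed.

Lemma L2normN f : L2norm (- f) = L2norm f.
Proof. by rewrite -scaleN1r L2normZ normcN normc1 mul1r. Qed.

Lemma L2normBC f g : L2norm (f - g) = L2norm (g - f).
Proof. by rewrite -L2normN opprB. Qed.

Lemma cauchy_schwarz f g : normc (inner f g) <= L2norm f * L2norm g.
Proof.
have [u u1 ub] := normc_rot (inner f g).
set b := normc _ in ub *; set A := L2norm f; set B := L2norm g.
have b0 : 0 <= b := normc_ge0 _.
have A0 : 0 <= A := L2norm_ge0 _; have B0 : 0 <= B := L2norm_ge0 _.
(* the squared norm of f - s u^* g, a nonnegative polynomial in the real s *)
have key (s : R) : 0 <= A ^+ 2 - 2 * s * b + s ^+ 2 * B ^+ 2.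
  have := sqr_ge0 (L2norm (f + ((- s)%:C * u^*) *: g)).
  rewrite sqr_L2normD innerZr L2normZ exprMn normcM normc_conjc u1 mulr1.
  rewrite conjcM conjc_realC conjcK.
  rewrite -mulrA ub normc_real real_normK ?num_real// sqrrN Re_realM.
  by rewrite -/A -/B -[Re b%:C]/b; lra.
have [B00|Bneq] := eqVneq B 0.
  rewrite B00 mulr0; rewrite leNgt; apply/negP => bgt.
  (* the polynomial is affine here, and this s would make it negative *)
  have := key ((A ^+ 2 + 1) / b); rewrite B00 expr0n mulr0 addr0.
  have -> : 2 * ((A ^+ 2 + 1) / b) * b = 2 * (A ^+ 2 + 1).
    by field; rewrite gt_eqF.
  have := sqr_ge0 A; lra.
have Bgt : 0 < B by rewrite lt_def Bneq.
(* the minimum of the polynomial *)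
have := key (b / B ^+ 2).
have -> : A ^+ 2 - 2 * (b / B ^+ 2) * b + (b / B ^+ 2) ^+ 2 * B ^+ 2 =
  (A ^+ 2 * B ^+ 2 - b ^+ 2) / B ^+ 2 by field; rewrite gt_eqF.
rewrite pmulr_lge0 ?invr_gt0 ?exprn_gt0// subr_ge0 -exprMn.
by rewrite ler_pXn2r// ?nnegrE ?mulr_ge0.
Qed.

Lemma L2normD_le f g : L2norm (f + g) <= L2norm f + L2norm g.
Proof.
rewrite -(@ler_pXn2r _ 2)// ?nnegrE ?addr_ge0 ?L2norm_ge0//.
rewrite sqr_L2normD.
have := le_trans (ler_norm _) (le_trans (Re_le_normc _) (cauchy_schwarz f g)).
by rewrite sqrrD; lra.
Qed.

Lemma L2norm_eq0 f : L2norm f = 0 -> f = 0.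
Proof.
move=> f0; have If := L2fun_integrable (L2_funP f).
have /ae_eq_integral_abs : (\int[mu]_t `|(normc (f t) ^+ 2)%:E| = 0)%E.
  under eq_integral do rewrite gee0_abs ?lee_fin ?sqr_ge0//.
  rewrite -[LHS]fineK; last exact: integrable_fin_num If.
  by rewrite -[fine _]/(\int[mu]_t (normc (f t) ^+ 2)) -sqr_L2norm f0 expr0n.
move=> /(_ measurableT (measurable_int _ If)) ae0.
have z0 : {ae mu, forall t, (0 : L2 mu) t = 0}.
  rewrite -(addNr (0 : L2 mu)) -scaleN1r.
  by apply: filterS (L2_funZD (-1) 0 0) => t ->; rewrite mulN1r addNr.
apply: L2_eqP; apply: filterS2 ae0 z0 => t /(_ I) [] /eqP.
by rewrite sqrf_eq0 => /eqP/eq0_normc -> ->.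
Qed.

Lemma L2_funB f g : {ae mu, forall t, (f - g : L2 mu) t = f t - g t}.
Proof.
rewrite addrC -scaleN1r; apply: filterS (L2_funZD (-1) g f) => t ->.
by rewrite mulN1r addrC.
Qed.

Lemma sqr_L2norm_ae f (F : T -> R[i]) : cmeasurable F ->
  {ae mu, forall t, f t = F t} ->
  ((L2norm f ^+ 2)%:E = \int[mu]_t (normc (F t) ^+ 2)%:E)%E.
Proof.
move=> mF fF; rewrite sqr_L2norm /Rintegral fineK; last first.
  exact: integrable_fin_num (L2fun_integrable (L2_funP f)).
apply: ae_eq_integral => //.
- by apply/measurable_EFinP; exact: measurable_sqr_normc (L2_funP _).1.
- by apply/measurable_EFinP; exact: measurable_sqr_normc.
- by apply: filterS fF => t -> _.
Qed.

End L2_hilbert.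

Section geometric_increments.
Context {R : realType}.

(** The telescoped bounds pass to the limit and give a rate of convergence with an
explicit constant, as domination arguments need it. *)
Lemma geometric_cvg (a : nat -> R) s : 0 <= s ->
  (forall k, `|a k.+1 - a k| <= 2^-1 ^+ k * s) ->
  a @ \oo --> lim (a @ \oo) /\
  forall k, `|lim (a @ \oo) - a k| <= 2 * 2^-1 ^+ k * s.
Proof.
move=> s0 ha; pose q : R := 2^-1.
have q0 j : 0 <= q ^+ j by rewrite exprn_ge0// /q invr_ge0.
have step k j : `|a (k + j)%N - a k| <= 2 * s * (q ^+ k - q ^+ (k + j)).
  elim: j => [|j IHj]; first by rewrite addn0 !subrr normr0 mulr0.
  rewrite addnS -(subrKA (a (k + j)%N)).
  apply: le_trans (ler_normD _ _) _; apply: le_trans (lerD (ha _) IHj) _.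
  rewrite -/q exprS /q; lra.
have step' k n : (k <= n)%N -> `|a n - a k| <= 2 * s * q ^+ k.
  move=> kn; rewrite -(subnKC kn); apply: le_trans (step _ _) _.
  by apply: ler_wpM2l; rewrite ?mulr_ge0// gerBl q0.
have q_cvg : (fun k => 2 * s * q ^+ k) @ \oo --> (0 : R).
  rewrite -(mulr0 (2 * s)); apply: cvgMr; apply: cvg_expr.
  by rewrite /q ger0_norm ?invr_ge0//; lra.
have ca : cvg (a @ \oo).
  apply/cauchy_cvgP/cauchy_ballP => e e0; near_simpl.
  have e20 : 0 < e / 2 by lra.
  have [N _ hN] : \forall k \near \oo, 2 * s * q ^+ k < e / 2.
    move/cvgrPdist_lt: q_cvg => /(_ _ e20); apply: filterS => k.
    by rewrite sub0r normrN; exact: le_lt_trans (ler_norm _).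
  exists ([set n | N <= n]%N, [set n | N <= n]%N).
    by split; exists N.
  move=> [m n] /= [Nm Nn]; rewrite /ball/= -(subrKA (a N)).
  apply: le_lt_trans (ler_normD _ _) _; rewrite (distrC (a N)).
  apply: le_lt_trans (lerD (step' _ _ Nm) (step' _ _ Nn)) _.
  by have := hN N (leqnn N); rewrite /=; lra.
split=> // k; rewrite ler_distl; apply/andP; split.
  apply: limr_ge => //; exists k => // n /= kn.
  by have := step' _ _ kn; rewrite ler_norml -/q => /andP[+ _]; lra.
apply: limr_le => //; exists k => // n /= kn.
by have := step' _ _ kn; rewrite ler_norml -/q => /andP[_ +]; lra.
Qed.

End geometric_increments.

Section L2_complete.
Context {R : realType} {d : measure_display} {T : measurableType d}.
Variable mu : {measure set T -> \bar R}.

(** Riesz-Fischer: along a subsequence with rapidly decreasing increments, the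
    weighted sum of the squared increments is integrable, hence finite almost
    everywhere; where it is finite it makes the subsequence converge
    geometrically, and it dominates the error. *)
Lemma L2_rapid_cvg (v : nat -> L2 mu) :
  (forall k, L2norm (v k.+1 - v k) <= 4^-1 ^+ k) ->
  exists f : L2 mu, L2norm (v n - f) @[n --> \oo] --> (0 : R).
Proof.
move=> hv; have q4 : 2^-1 ^+ 2 = 4^-1 :> R by rewrite expr2; lra.
(* The increments have squared norms at most 16^-k, so that the weighted sum is
   integrable; where it is finite, the weights 4^k make the increments O(2^-k). *)
pose D k t := ((4 ^+ k * normc (v k.+1 t - v k t) ^+ 2)%:E : \bar R).
have mv k : cmeasurable (v k) := (L2_funP (v k)).1.
have mdiff k : cmeasurable (fun t => v k.+1 t - v k t).
  rewrite (_ : (fun t => _) = (fun t => v k.+1 t) + (fun t => (-1) * v k t)); last first.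
    by apply/funext => t; rewrite -[RHS]/(_ + (-1) * v k t) mulN1r.
  by apply: cmeasurableD => //; apply: cmeasurableM => //; exact: cmeasurable_cst.
have mD k : measurable_fun setT (D k).
  by apply/measurable_EFinP; apply: measurable_funM => //; exact: measurable_sqr_normc.
have D0 k t : (0 <= D k t)%E.
  by rewrite lee_fin mulr_ge0 ?sqr_ge0// exprn_ge0.
pose S t := (\sum_(k <oo) D k t)%E.
have intD k : (\int[mu]_t D k t <= (4^-1 ^+ k)%:E)%E.
  rewrite (_ : (fun t => D k t) =
    (fun t => (4 ^+ k)%:E * (normc (v k.+1 t - v k t) ^+ 2)%:E)%E); last first.
    by apply/funext => t; rewrite -EFinM.
  rewrite ge0_integralZl_EFin ?exprn_ge0//; last 2 first.
  - by move=> t _; rewrite lee_fin sqr_ge0.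
  - by apply/measurable_EFinP; exact: measurable_sqr_normc.
  rewrite -(sqr_L2norm_ae (mdiff k) (L2_funB _ _)) -EFinM lee_fin.
  apply: (@le_trans _ _ (4 ^+ k * (4^-1 ^+ k) ^+ 2)).
    by apply: ler_wpM2l; rewrite ?exprn_ge0// ler_pXn2r// nnegrE ?L2norm_ge0// exprn_ge0.
  by rewrite expr2 mulrA -exprMn divff// expr1n mul1r.
have SN : (\int[mu]_t S t < +oo)%E.
  rewrite integral_nneseries//.
  apply: (@le_lt_trans _ _ (\sum_(k <oo) (4^-1 ^+ k : R)%:E)%E).
    by apply: lee_nneseries => [k _ _|k _]; [exact: integral_ge0|exact: intD].
  apply: (@le_lt_trans _ _ 2%:E); last exact: ltry.
  apply: lime_le.
    by apply: is_cvg_nneseries => k _ _; rewrite lee_fin exprn_ge0// invr_ge0.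
  apply: nearW => n; rewrite sumEFin lee_fin big_mkord.
  suff : \sum_(i < n) 4^-1 ^+ i <= 2 - 2 * 4^-1 ^+ n :> R.
    by move=> /le_trans; apply; rewrite gerBl mulr_ge0// exprn_ge0// invr_ge0.
  elim: n => [|n IHn]; first by rewrite big_ord0 expr0; lra.
  rewrite big_ord_recr /= exprS; have : 0 <= 4^-1 ^+ n :> R by rewrite exprn_ge0// invr_ge0.
  lra.
have S0 t : (0 <= S t)%E by exact: nneseries_ge0.
have mS : measurable_fun setT S by exact: ge0_emeasurable_sum.
have IS : mu.-integrable setT S.
  by apply/integrableP; split => //; under eq_integral do rewrite gee0_abs//.
pose E := [set t | (S t < +oo)%E].
have mE : measurable E.
  rewrite (_ : E = setT `&` S @^-1` [set` `]-oo, (+oo)%E[%O]); last first.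
    by rewrite setTI; apply/seteqP; split=> t; rewrite /E /= in_itv.
  by apply: mS => //; exact: emeasurable_itv.
have aeE : {ae mu, forall t, E t}.
  by have := integrable_ae measurableT IS; apply: filterS => t /(_ I); rewrite ge0_fin_numE.
pose s t := Num.sqrt (fine (S t)).
have inc k t : E t -> normc (v k.+1 t - v k t) <= 2^-1 ^+ k * s t.
  move=> Et; rewrite -(@ler_pXn2r _ 2)// ?nnegrE ?normc_ge0 ?mulr_ge0 ?sqrtr_ge0 ?exprn_ge0//.
  rewrite exprMn sqr_sqrtr ?fine_ge0// -exprM mulnC exprM.
  rewrite q4 exprVn mulrC ler_pdivlMr ?exprn_gt0// mulrC -lee_fin fineK ?ge0_fin_numE//.
  apply: le_trans (nneseries_lim_ge k.+1 _); last by move=> *; exact: D0.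
  rewrite big_nat_recr//= leeDr// sume_ge0//.
(* [p] is the real or the imaginary part; the indicator makes the sequence converge
   everywhere, which gives a measurable limit *)
pose a p k t := \1_E t * p (v k t) : R.
pose F t : R[i] := lim (a Re ^~ t @ \oo) +i* lim (a Im ^~ t @ \oo).
have ca (p : R[i] -> R) : (forall z, `|p z| <= normc z) ->
    (forall z w, p (z - w) = p z - p w) -> forall t,
    a p ^~ t @ \oo --> lim (a p ^~ t @ \oo) /\
    (E t -> forall k, `|lim (a p ^~ t @ \oo) - p (v k t)| <= 2 * 2^-1 ^+ k * s t).
  move=> pn pB t; have [Et|nEt] := pselect (E t); last first.
    split=> //; have e0 : a p ^~ t = fun=> 0.
      by apply/funext => k; rewrite /a indicE memNset// mul0r.
    by rewrite e0 lim_cst//; exact: cvg_cst.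
  have e1 : a p ^~ t = fun k => p (v k t).
    by apply/funext => k; rewrite /a indicE mem_set// mul1r.
  rewrite e1; have [|h1 h2] := @geometric_cvg R (fun k => p (v k t)) (s t) (sqrtr_ge0 _).
    by move=> k; rewrite -pB; apply: le_trans (pn _) _; exact: inc.
  by split.
have cr := ca Re Re_le_normc (raddfB (@complex.Re R)).
have ci := ca Im Im_le_normc (raddfB (@complex.Im R)).
have mF : cmeasurable F.
  split; apply: measurable_fun_cvg.
  - by move=> k; apply: measurable_funM; [exact: (measurable_indic mE)|exact: (mv k).1].
  - by move=> t _; exact: (cr t).1.
  - by move=> k; apply: measurable_funM; [exact: (measurable_indic mE)|exact: (mv k).2].
  - by move=> t _; exact: (ci t).1.
have err k t : E t -> normc (F t - v k t) ^+ 2 <= 16 * 4^-1 ^+ k * fine (S t).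
  move=> Et; have := (cr t).2 Et k; have := (ci t).2 Et k.
  have q0 : 0 <= 2^-1 ^+ k * s t by rewrite mulr_ge0 ?exprn_ge0 ?sqrtr_ge0.
  move=> hi hr; have h := le_trans (normc_le_ReIm (F t - v k t)) (_ : _ <= 4 * (2^-1 ^+ k * s t)).
  have {}h : normc (F t - v k t) <= 4 * (2^-1 ^+ k * s t).
    by apply: h; rewrite !raddfB /=; lra.
  apply: (@le_trans _ _ ((4 * (2^-1 ^+ k * s t)) ^+ 2)).
    by rewrite ler_pXn2r// ?nnegrE ?normc_ge0// mulr_ge0.
  rewrite !exprMn sqr_sqrtr ?fine_ge0// -exprM mulnC exprM.
  by rewrite q4; lra.
have mFv k : cmeasurable (fun t => F t - v k t).
  rewrite (_ : (fun t => _) = F + (fun t => (-1) * v k t)); last first.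
    by apply/funext => t; rewrite -[RHS]/(_ + (-1) * v k t) mulN1r.
  by apply: cmeasurableD => //; apply: cmeasurableM => //; exact: cmeasurable_cst.
have intF k : (\int[mu]_t (normc (F t - v k t) ^+ 2)%:E <=
    (16 * 4^-1 ^+ k)%:E * \int[mu]_t S t)%E.
  rewrite -ge0_integralZl_EFin ?mulr_ge0 ?exprn_ge0//.
  apply: ae_ge0_le_integral => //.
  - by move=> t _; rewrite lee_fin sqr_ge0.
  - by apply/measurable_EFinP; exact: measurable_sqr_normc.
  - by move=> t _; rewrite mule_ge0// lee_fin mulr_ge0 ?exprn_ge0.
  - by apply: emeasurable_funM => //; exact: measurable_cst.
  - apply: filterS aeE => t Et _.
    rewrite -[S t]fineK ?ge0_fin_numE// -EFinM lee_fin; exact: err.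
have LF : L2fun mu F.
  split=> //; apply: (@le_lt_trans _ _ (\int[mu]_t
    (2%:E * (normc (F t - v 0%N t) ^+ 2)%:E + 2%:E * (normc (v 0%N t) ^+ 2)%:E))%E).
    apply: ge0_le_integral => //.
    - by move=> t _; rewrite lee_fin sqr_ge0.
    - by apply/measurable_EFinP; exact: measurable_sqr_normc.
    - apply: emeasurable_funD; apply: emeasurable_funM; try exact: measurable_cst.
        by apply/measurable_EFinP; exact: measurable_sqr_normc.
      by apply/measurable_EFinP; exact: measurable_sqr_normc.
    - move=> t _; rewrite -!EFinM -EFinD lee_fin.
      by rewrite -{1}[F t](subrK (v 0%N t)); exact: sqr_normcD.
  rewrite ge0_integralD//; last 4 first.
  - by move=> t _; rewrite -EFinM lee_fin mulr_ge0 ?sqr_ge0.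
  - apply: emeasurable_funM; first exact: measurable_cst.
    by apply/measurable_EFinP; exact: measurable_sqr_normc.
  - by move=> t _; rewrite -EFinM lee_fin mulr_ge0 ?sqr_ge0.
  - apply: emeasurable_funM; first exact: measurable_cst.
    by apply/measurable_EFinP; exact: measurable_sqr_normc.
  rewrite !ge0_integralZl_EFin//; last 4 first.
  - by move=> t _; rewrite lee_fin sqr_ge0.
  - by apply/measurable_EFinP; exact: measurable_sqr_normc.
  - by move=> t _; rewrite lee_fin sqr_ge0.
  - by apply/measurable_EFinP; exact: measurable_sqr_normc.
  apply: lte_add_pinfty; apply: lte_mul_pinfty => //.
    by apply: le_lt_trans (intF 0%N) _; apply: lte_mul_pinfty.
  exact: (L2_funP (v 0%N)).2.
exists (mkL2 LF).
have IN : (\int[mu]_t S t)%E \is a fin_num.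
  by rewrite ge0_fin_numE// integral_ge0.
pose I := fine (\int[mu]_t S t).
have bound k : L2norm (v k - mkL2 LF) ^+ 2 <= 16 * I * 4^-1 ^+ k.
  rewrite L2normBC -lee_fin (sqr_L2norm_ae (mFv k)); last first.
    by apply: filterS2 (L2_funB (mkL2 LF) (v k)) (mkL2E LF) => t -> ->.
  apply: le_trans (intF k) _.
  by rewrite -[X in (_ * X)%E]fineK// -EFinM lee_fin /I; lra.
have : (fun k => L2norm (v k - mkL2 LF) ^+ 2) @ \oo --> (0 : R).
  apply: (@squeeze_cvgr _ _ _ _ (fun=> 0) (fun k => 16 * I * 4^-1 ^+ k)).
  - by apply: nearW => k; rewrite sqr_ge0 bound.
  - exact: cvg_cst.
  - rewrite -[X in _ --> X](mulr0 (16 * I)); apply: cvgMr; apply: cvg_expr.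
    by rewrite ger0_norm ?invr_ge0//; lra.
move=> /(continuous_cvg _ (@sqrt_continuous R 0)).
rewrite sqrtr0; apply: cvg_trans; apply: near_eq_cvg; apply: nearW => k /=.
by rewrite sqrtr_sqr ger0_norm// L2norm_ge0.
Qed.

Lemma L2_complete (u : nat -> L2 mu) :
  (forall e : R, 0 < e -> exists N, forall m n, (N <= m)%N -> (N <= n)%N ->
     L2norm (u m - u n) < e) ->
  exists f : L2 mu, L2norm (u n - f) @[n --> \oo] --> (0 : R).
Proof.
move=> uC.
have /choice[N hN] : forall k, exists N, forall m n, (N <= m)%N -> (N <= n)%N ->
    L2norm (u m - u n) < 4^-1 ^+ k.
  by move=> k; apply: uC; rewrite exprn_gt0// invr_gt0.
(* a nondecreasing sequence of indices with M k >= N k and M k >= k *)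
pose M k := (\sum_(i < k.+1) (N i).+1)%N.
have MN k : (N k <= M k)%N by rewrite /M big_ord_recr /= (leq_trans (leqnSn _))// leq_addl.
have MS k : (M k <= M k.+1)%N by rewrite /M [X in (_ <= X)%N]big_ord_recr leq_addr.
have [k|f hf] := @L2_rapid_cvg (fun k => u (M k)).
  by apply/ltW/hN => //; exact: leq_trans (MS _).
exists f; apply/cvgrPdist_lt => e e0; have e20 : 0 < e / 2 by lra.
have [K hK] := uC _ e20.
have [k kM kf] : exists2 k, (K <= k)%N & L2norm (u (M k) - f) < e / 2.
  move/cvgrPdist_lt: hf => /(_ _ e20)[k0 _ hk0]; exists (maxn K k0).
    exact: leq_maxl.
  have := hk0 (maxn K k0) (leq_maxr _ _).
  by rewrite /= sub0r normrN ger0_norm ?L2norm_ge0.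
have KM : (k <= M k)%N.
  elim: (k) => // j IHj; rewrite /M big_ord_recr /= -/(M j) addnS ltnS.
  by rewrite (leq_trans IHj)// leq_addr.
exists K => // n /= Kn; rewrite sub0r normrN ger0_norm ?L2norm_ge0//.
have := hK n (M k) Kn (leq_trans kM KM).
have := L2normD_le (u n - u (M k)) (u (M k) - f).
rewrite subrKA; lra.
Qed.

End L2_complete.

(** * Product structure of Lebesgue measure on R^n *)

Section lebesgue_cV_structure.
Context {R : realType}.
Local Notation leb1 := (@lebesgue_measure R : {sigma_finite_measure set (measurableTypeR R) -> \bar R}).
Local Notation leb n := (@lebesgue_cV R n).

Lemma lebesgue_cVS n (A : set 'cV[R]_n.+1) : measurable A ->
  leb n.+1 A = (leb1 \x leb n)%E (@consc R n @^-1` A).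
Proof. by []. Qed.

Lemma ge0_integral_cVS n (f : 'cV[R]_n.+1 -> \bar R) : measurable_fun setT f ->
  (forall v, 0 <= f v)%E ->
  (\int[leb n.+1]_v f v = \int[leb1]_t \int[leb n]_v f (consc (t, v)))%E.
Proof.
move=> mf f0.
rewrite (ge0_integral_transfer (@measurable_consc R n) (@lebesgue_cVS n))//.
rewrite (fubini_tonelli1 (fun p => f (consc p)))//.
exact: measurableT_comp mf (@measurable_consc R n).
Qed.

Let leb0T : leb 0 setT = 1%E.
Proof. exact: diracT. Qed.

Lemma cintegral_cV0 (f : 'cV[R]_0 -> R[i]) : cintegral (leb 0) f = f 0.
Proof.
have f0 v : f v = f 0 by congr f; apply/colP => -[].
have -> : f = fun=> f 0 by apply/funext.
by apply: complex_eqP; apply: etrans (mulr1 _);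
  apply: etrans (congr1 (fun x => _ * fine x) leb0T); exact: Rintegral_cst.
Qed.

Lemma cintegrable_cV0 (f : 'cV[R]_0 -> R[i]) : cintegrable (leb 0) f.
Proof.
have f0 v : f v = f 0 by congr f; apply/colP => -[].
have -> : f = fun=> f 0 by apply/funext.
apply: cintegrableP; first exact: cmeasurable_cst.
rewrite integral_cst//; apply: (@le_lt_trans _ _ ((normc (f 0))%:E * 1)%E).
  by rewrite lee_wpmul2l ?lee_fin ?normc_ge0// leb0T.
by rewrite mule1 ltry.
Qed.

(** [consc] is a measurable isomorphism. *)
Lemma cmeasurable_of_consc n (f : 'cV[R]_n.+1 -> R[i]) :
  cmeasurable (fun p => f (@consc R n p)) -> cmeasurable f.
Proof.
move=> mf.
have -> : f = (fun v => f (consc (unconsc v))) by apply/funext => v; rewrite unconscK.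
exact: (cmeasurable_transfer (@measurable_unconsc R n) mf).
Qed.

Section product_functions.
Variable n : nat.
Variables (h : measurableTypeR R -> R[i]) (H : 'cV[R]_n -> R[i]).
Hypotheses (Ih : cintegrable leb1 h) (IH : cintegrable (leb n) H).
Variable f : 'cV[R]_n.+1 -> R[i].
Hypothesis fE : forall p, f (consc p) = h p.1 * H p.2.

Let mhH : cmeasurable (fun p : measurableTypeR R * 'cV[R]_n => h p.1 * H p.2).
Proof.
have mh := cintegrable_cmeasurable Ih; have mH := cintegrable_cmeasurable IH.
apply: cmeasurableM; first exact: (cmeasurable_transfer (@measurable_fst _ _ _ _) mh).
exact: (cmeasurable_transfer (@measurable_snd _ _ _ _) mH).
Qed.

Let IhH : cintegrable (leb1 \x leb n)%E (fun p => h p.1 * H p.2).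
Proof.
apply: (cintegrable_prod_le mhH (cintegrable_normc Ih) (cintegrable_normc IH)).
- by move=> t; exact: normc_ge0.
- by move=> t; exact: normc_ge0.
- by move=> t v; rewrite normcM.
Qed.

Let fEE : (fun p => f (consc p)) = (fun p => h p.1 * H p.2).
Proof. exact/funext. Qed.

Lemma cintegrable_cVS : cintegrable (leb n.+1) f.
Proof.
apply/(cintegrable_transfer (@measurable_consc R n) (@lebesgue_cVS n)); rewrite ?fEE//.
by apply: cmeasurable_of_consc; rewrite fEE.
Qed.

Lemma cintegral_cVS : cintegral (leb n.+1) f = cintegral leb1 h * cintegral (leb n) H.
Proof.
rewrite (cintegral_transfer (@measurable_consc R n) (@lebesgue_cVS n) cintegrable_cVS).
rewrite fEE -(cfubini1 IhH) mulrC -(cintegralZ _ Ih).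
by apply: eq_cintegral => t /=; rewrite cintegralZ// mulrC.
Qed.

End product_functions.

(** The form of Fubini's theorem that reduces Gaussian integrals on R^n to the
line. *)
Lemma cintegral_prod n (h : 'I_n -> measurableTypeR R -> R[i]) :
  (forall i, cintegrable leb1 (h i)) ->
  cintegrable (leb n) (fun v => \prod_i h i (v i ord0)) /\
  cintegral (leb n) (fun v => \prod_i h i (v i ord0)) = \prod_i cintegral leb1 (h i).
Proof.
elim: n h => [|n IHn] h Ih.
  by split; [exact: cintegrable_cV0|rewrite cintegral_cV0 !big_ord0].
have [I1 I2] := IHn (fun i => h (lift ord0 i)) (fun i => Ih (lift ord0 i)).
have E p : \prod_i h i (@consc R n p i ord0) =
    h ord0 p.1 * \prod_i h (lift ord0 i) (p.2 i ord0).
  rewrite big_ord_recl consc0; congr (_ * _); apply: eq_bigr => i _.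
  by rewrite consc_lift.
split; first exact: (cintegrable_cVS (Ih ord0) I1 E).
by rewrite (cintegral_cVS (Ih ord0) I1 E) I2 big_ord_recl.
Qed.

Lemma lebesgue_cV_coord_null n (i : 'I_n) (N : set (measurableTypeR R)) :
  measurable N -> leb1 N = 0%E -> leb n ((fun v => v i ord0) @^-1` N) = 0%E.
Proof.
elim: n i => [[]//|n IHn] i mN N0.
have mC k : measurable ((fun v : 'cV[R]_n => v k ord0) @^-1` N).
  by rewrite -[X in measurable X]setTI; exact: measurable_mxentry.
rewrite lebesgue_cVS; last first.
  by rewrite -[X in measurable X]setTI; exact: measurable_mxentry.
case: (unliftP ord0 i) => [k|] ->.
  rewrite (_ : _ @^-1` _ = setT `*` ((fun v : 'cV[R]_n => v k ord0) @^-1` N)).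
    by rewrite product_measure1E// IHn ?mule0.
  by apply/seteqP; split=> p /=; rewrite consc_lift// => -[].
rewrite (_ : _ @^-1` _ = N `*` setT).
  rewrite product_measure1E//; apply: (etrans _ (mul0e (leb n setT))).
  by congr (_ * _)%E.
by apply/seteqP; split=> p /=; rewrite consc0// => -[].
Qed.

Lemma lebesgue_cV_coord_ae n (i : 'I_n) (P : R -> Prop) :
  {ae leb1, forall t, P t} -> {ae leb n, forall v : 'cV[R]_n, P (v i ord0)}.
Proof.
move=> [N [mN N0 PN]]; exists ((fun v : 'cV[R]_n => v i ord0) @^-1` N); split.
- by rewrite -[X in measurable X]setTI; exact: measurable_mxentry.
- exact: lebesgue_cV_coord_null.
- by move=> v /= Pv; exact: PN.
Qed.

Definition colp m n (p : 'cV[R]_m * 'cV[R]_n) : 'cV[R]_(m + n) := col_mx p.1 p.2.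

Lemma measurable_colp m n : measurable_fun setT (@colp m n).
Proof.
apply: measurable_fun_mxP => i j; rewrite /colp.
under eq_fun do rewrite mxE.
case: (fintype.split i) => k.
  exact: (measurableT_comp (measurable_mxentry k j) measurable_fst).
exact: (measurableT_comp (measurable_mxentry k j) measurable_snd).
Qed.

Lemma colp_consc m n t (v : 'cV[R]_m) (w : 'cV[R]_n) :
  colp (consc (t, v), w) = @consc R (m + n) (t, colp (v, w)).
Proof.
apply/colP => i; rewrite /colp /=.
case: (unliftP ord0 i) => [k|] ->.
  rewrite (@consc_lift R (m + n)) /=.
  case: (split_ordP k) => l ->.
    rewrite col_mxEu (_ : lift _ _ = lshift n (lift ord0 l)); last exact/val_inj.
    by rewrite col_mxEu consc_lift.
  rewrite col_mxEd (_ : lift _ _ = rshift m.+1 l); last exact/val_inj.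
  by rewrite col_mxEd.
rewrite (@consc0 R (m + n)) (_ : ord0 = lshift n ord0); last exact/val_inj.
by rewrite col_mxEu consc0.
Qed.

(** By induction on m, peeling off the first coordinate on both sides. It splits the
phase space R^(2d) into time and frequency. *)
Lemma lebesgue_cVD m n (A : set 'cV[R]_(m + n)) : measurable A ->
  leb (m + n) A = (leb m \x leb n)%E (@colp m n @^-1` A).
Proof.
have xs k l (B : set 'cV[R]_(k + l)) v :
    xsection (@colp k l @^-1` B) v = [set w | B (colp (v, w))].
  by apply/seteqP; split=> w; rewrite /xsection /= inE.
elim: m A => [|m IHm] A mA.
  rewrite /= /product_measure1 integral_dirac//=; last first.
    apply: measurable_fun_xsection; rewrite -[X in measurable X]setTI.
    exact: measurable_colp.
  rewrite diracT mul1e xs; congr (leb n _); apply/funext => w.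
  congr A; apply/colP => i; rewrite /colp /=.
  by rewrite -[i in RHS](_ : rshift 0 i = i) ?col_mxEd//; exact/val_inj.
have mcA : measurable (@colp m.+1 n @^-1` A).
  by rewrite -[X in measurable X]setTI; exact: measurable_colp.
rewrite /= /product_measure1 /=.
have -> : (\int[leb m.+1]_v leb n (xsection (@colp m.+1 n @^-1` A) v) =
   \int[leb1]_t \int[leb m]_v leb n [set w | A (consc (t, colp (v, w)))])%E.
  rewrite ge0_integral_cVS//; last exact: measurable_fun_xsection.
  apply: eq_integral => t _; apply: eq_integral => v _; rewrite xs.
  by congr (leb n _); apply/funext => w /=; rewrite colp_consc.
rewrite /lebesgue_step /pushforward /= /product_measure1 /=.
apply: eq_integral => t _.
have mAt : measurable (xsection (@consc R (m + n) @^-1` A) t).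
  apply: measurable_xsection.
  by rewrite -[X in measurable X]setTI; exact: measurable_consc.
rewrite (IHm _ mAt) /= /product_measure1 /=.
apply: eq_integral => v _; rewrite xs; congr (leb n _); apply/funext => w /=.
by rewrite /xsection/= inE.
Qed.

End lebesgue_cV_structure.

(** * Functions determined by their integrals over boxes *)

Section density_measure.
Context {R : realType} {d : measure_display} {T : measurableType d}.
Variables (mu : {measure set T -> \bar R}) (f : T -> \bar R).
Hypotheses (mf : measurable_fun setT f) (f0 : forall t, (0 <= f t)%E).

Definition density of measurable_fun setT f & (forall t, (0 <= f t)%E) :=
  fun A : set T => (\int[mu]_(t in A) f t)%E.

Local Notation nu := (density mf f0).

Let nu0 : nu set0 = 0%E.
Proof. exact: integral_set0. Qed.

Let nu_ge0 A : (0 <= nu A)%E.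
Proof. by apply: integral_ge0. Qed.

Let nu_sigma : semi_sigma_additive nu.
Proof.
move=> A mA tA mUA; rewrite /density ge0_integral_bigcup//; last first.
  exact: measurable_funTS.
by apply: is_cvg_ereal_nneg_natsum_cond => n _ _; exact: integral_ge0.
Qed.

HB.instance Definition _ := isMeasure.Build _ _ _ nu nu0 nu_ge0 nu_sigma.

Definition density_measure : {measure set T -> \bar R} := nu.

End density_measure.

Section boxes.
Context {R : realType} (n : nat).
Local Notation leb := (@lebesgue_cV R n).

Definition box (a b : 'I_n -> R) : set 'cV[R]_n :=
  [set v | forall i, a i < v i ord0 <= b i].

Definition boxes : set (set 'cV[R]_n) := [set B | exists a b, B = box a b].

Lemma measurable_box a b : measurable (box a b).
Proof.
have -> : box a b =
    \bigcap_(i in [set: 'I_n]) ((fun v : 'cV[R]_n => v i ord0) @^-1` `]a i, b i]).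
  apply/seteqP; split=> v h; first by move=> i _; rewrite /= in_itv/= h.
  by move=> i; have := h i I; rewrite /= in_itv.
apply: fin_bigcap_measurable => // i _.
by rewrite -[X in measurable X]setTI; exact: measurable_mxentry.
Qed.

Lemma setI_closed_boxes : setI_closed boxes.
Proof.
move=> _ _ [a [b ->]] [a' [b' ->]].
exists (fun i => Num.max (a i) (a' i)), (fun i => Num.min (b i) (b' i)).
apply/seteqP; split=> v.
  by move=> [h h'] i; rewrite gt_max le_min; have /andP[-> ->] := h i; have /andP[-> ->] := h' i.
by move=> h; split=> i; have := h i; rewrite gt_max le_min => /andP[/andP[? ?] /andP[? ?]]; apply/andP.
Qed.

Definition cube (k : nat) : set 'cV[R]_n := box (fun=> - k%:R) (fun=> k%:R).

Lemma bigcup_cube : \bigcup_k cube k = setT.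
Proof.
apply/seteqP; split=> // v _.
pose s := \sum_i `|v i ord0|.
have [k sk] : exists k : nat, s < k%:R.
  by exists (Num.truncn s).+1; rewrite truncnS_gt.
exists k => // i; have vi : `|v i ord0| <= s.
  by rewrite /s (bigD1 i)//= lerDl sumr_ge0.
have := le_lt_trans vi sk; rewrite ltr_norml => /andP[-> /ltW ->].
by [].
Qed.

(** A slab in one coordinate is the union of the boxes that growing cubes cut out of
it, so that the boxes generate the Borel sets. *)
Lemma measurable_boxesE : (@measurable _ 'cV[R]_n) = <<s boxes >>.
Proof.
apply/seteqP; split; last first.
  apply: smallest_sub; first exact: sigma_algebra_measurable.
  by move=> _ [a [b ->]]; exact: measurable_box.
apply: smallest_sub; first exact: smallest_sigma_algebra.
move=> _ [i [j [A [mA ->]]]]; rewrite (ord1 j).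
pose T := g_sigma_algebraType boxes.
suff mi : measurable_fun [set: T] (fun v : T => (v : 'cV[R]_n) i ord0 : measurableTypeR R).
  by have := mi measurableT A mA; rewrite setTI.
apply: (measurability (@ocitv R)) => //.
move=> _ [_ [[a b] _ <-] <-]; rewrite setTI /=.
rewrite (_ : _ @^-1` _ = \bigcup_k (box (fun l => if l == i then a else - k%:R)
    (fun l => if l == i then b else k%:R) : set T)).
  apply: bigcup_measurable => k _; apply: sub_sigma_algebra.
  by do 2 eexists.
apply/seteqP; split=> v.
  rewrite /= in_itv/= => abv.
  have : [set: 'cV[R]_n] v by [].
  rewrite -bigcup_cube => -[k _ kv]; exists k => // l /=.
  by case: eqP => [->//|_]; exact: kv.
by move=> [k _] /(_ i); rewrite eqxx /= in_itv.
Qed.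

(** Boxes form a generating pi-system, so that the densities of the positive and of the
negative part of [f] agree on all measurable sets. *)
Lemma ae_eq0_boxes (f : 'cV[R]_n -> R) : measurable_fun setT f ->
  (forall a b, leb.-integrable (box a b) (EFin \o f)) ->
  (forall a b, \int[leb]_(v in box a b) (f v)%:E = 0)%E ->
  {ae leb, forall v, f v = 0}.
Proof.
move=> mf If f0.
have mfE : measurable_fun setT (EFin \o f) by exact/measurable_EFinP.
have mp := measurable_funepos mfE.
have mn := measurable_funeneg mfE.
(* the positive and the negative part, as densities, agree on boxes *)
pose m1 := density_measure leb mp (funepos_ge0 _).
pose m2 := density_measure leb mn (funeneg_ge0 _).
have fin a b : (m1 (box a b) < +oo)%E.
  have ip := integrable_funepos (measurable_box a b) (If a b).
  exact: (integrable_lty (measurable_box a b) ip).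
have m12 A : measurable A -> m1 A = m2 A.
  apply: (@measure_unique _ _ _ boxes cube) => //.
  - exact: measurable_boxesE.
  - exact: setI_closed_boxes.
  - by move=> k; exists (fun=> - k%:R), (fun=> k%:R).
  - exact: bigcup_cube.
  - move=> _ [a [b ->]]; have := f0 a b; rewrite integralE.
    rewrite -[X in (X - _)%E]/(m1 (box a b)) -[X in (_ - X)%E]/(m2 (box a b)).
    have := fin a b; have := measure_ge0 m1 (box a b).
    case: (m1 _) => [r||]//; case: (m2 _) => [s||]// _ _.
    by move=> [] /eqP; rewrite subr_eq0 => /eqP ->.
  - by move=> k; exact: fin.
have cube0 k : ae_eq leb (cube k) (EFin \o f) (cst 0%E).
  apply: integral_ae_eq => //.
  - exact: measurable_box.
  - exact: If.
  - move=> E Ek mE; rewrite integral0 integralE.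
    rewrite -[X in (X - _)%E]/(m1 E) -[X in (_ - X)%E]/(m2 E) -m12// subee//.
    rewrite ge0_fin_numE; last exact: measure_ge0.
    apply: le_lt_trans (fin (fun=> - k%:R) (fun=> k%:R)).
    by apply: le_measure => //; rewrite inE//; exact: measurable_box.
have : {ae leb, forall v, forall k, cube k v -> f v = 0}.
  apply: ae_foralln => k; apply: filterS (cube0 k) => v /= h /h.
  by move=> [].
apply: filterS => v h; have : [set: 'cV[R]_n] v by [].
by rewrite -bigcup_cube => -[k _ /h].
Qed.

End boxes.

(** * Fourier transforms of Gaussians *)

Section gaussian_line.
Context {R : realType}.
Local Notation mu := (@lebesgue_measure R).
Variable a : R.
Hypothesis a0 : 0 < a.

Definition egauss (b t : R) : R := expR (- (b * t ^+ 2)).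

Lemma egauss_ge0 b t : 0 <= egauss b t. Proof. exact: expR_ge0. Qed.

Lemma continuous_egauss b : continuous (egauss b).
Proof.
move=> t; apply: continuous_comp; last exact: continuous_expR.
by apply: cvgN; apply: cvgMr; exact: exprn_continuous.
Qed.

Lemma measurable_egauss b : measurable_fun setT (egauss b).
Proof. exact: continuous_measurable_fun (@continuous_egauss b). Qed.

(* the standard deviation for which the normal density is a multiple of [egauss a] *)
Let s : R := Num.sqrt (2 * a)^-1.

Let s2 : s ^+ 2 = (2 * a)^-1.
Proof. by rewrite sqr_sqrtr// invr_ge0 mulr_ge0// ltW. Qed.

Let s0 : s != 0.
Proof. by rewrite gt_eqF// sqrtr_gt0 invr_gt0 mulr_gt0. Qed.

Let normalE (x t : R) : normal_pdf x s t = (Num.sqrt (pi / a))^-1 * egauss a (t - x).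
Proof.
rewrite (normal_pdfE x s0) /= /normal_peak /normal_fun /egauss s2.
congr ((Num.sqrt _)^-1 * expR _); last first.
  by field; rewrite gt_eqF.
by field; rewrite gt_eqF.
Qed.

Let c0 : 0 < Num.sqrt (pi / a).
Proof. by rewrite sqrtr_gt0 divr_gt0// pi_gt0. Qed.

Lemma integral_egauss (x : R) : (\int[mu]_t (egauss a (t - x))%:E)%E = (Num.sqrt (pi / a))%:E.
Proof.
have := integral_normal_pdf x s.
under eq_integral do rewrite normalE EFinM.
rewrite ge0_integralZl_EFin ?invr_ge0 ?ltW//; last 2 first.
- by move=> t _; rewrite lee_fin egauss_ge0.
- apply/measurable_EFinP; apply: measurableT_comp; first exact: measurable_egauss.
  exact: measurable_funB.
move=> h; rewrite -[LHS]mul1e -[X in (X%:E * _)%E](@divff _ (Num.sqrt (pi / a))) ?gt_eqF//.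
by rewrite EFinM -muleA h mule1.
Qed.

Lemma integrable_egauss : mu.-integrable setT (EFin \o egauss a).
Proof.
apply/integrableP; split; first by apply/measurable_EFinP; exact: measurable_egauss.
under eq_integral do rewrite /= ger0_norm ?egauss_ge0//.
rewrite (eq_integral (fun t : measurableTypeR R => (egauss a (t - 0))%:E)); last first.
  by move=> t _; rewrite subr0.
by rewrite integral_egauss ltry.
Qed.

End gaussian_line.

Section gaussian_fourier.
Context {R : realType}.
Local Notation mu := (@lebesgue_measure R).
Variable a : R.
Hypothesis a0 : 0 < a.

(* dominates (1 + |t|) exp (- a t^2), hence the integrand f below and its derivative
   with respect to the frequency *)
Let dom (t : R) : R := 2 * (1 + 2 / a) * egauss (a / 2) t.

Let a20 : 0 < a / 2. Proof. by rewrite divr_gt0. Qed.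

Let Idom : mu.-integrable setT (EFin \o dom).
Proof. exact: (integrableZl _ (2 * (1 + 2 / a)) (integrable_egauss a20)). Qed.

Let dom_bound t : (1 + `|t|) * egauss a t <= dom t.
Proof.
have -> : egauss a t = egauss (a / 2) t * egauss (a / 2) t.
  by rewrite /egauss -expRD; congr expR; field.
rewrite mulrA /dom; apply: ler_wpM2r; first exact: egauss_ge0.
have a2 : 0 <= a / 2 * t ^+ 2 by rewrite mulr_ge0 ?sqr_ge0// ltW.
have e1 : (1 + a / 2 * t ^+ 2) * egauss (a / 2) t <= 1.
  rewrite /egauss expRN ler_pdivrMr ?expR_gt0// mul1r.
  exact: expR_ge1Dx.
apply: (@le_trans _ _ (2 * (1 + 2 / a) * ((1 + a / 2 * t ^+ 2) * egauss (a / 2) t))).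
  rewrite mulrA; apply: ler_wpM2r; first exact: egauss_ge0.
  have : `|t| <= 1 + t ^+ 2.
    have := sqr_ge0 (1 - `|t|); have := sqr_ge0 t.
    rewrite -[t ^+ 2]real_normK ?num_real//; nra.
  have -> : 2 * (1 + 2 / a) * (1 + a / 2 * t ^+ 2) =
     2 * (1 + 2 / a + a / 2 * t ^+ 2 + t ^+ 2) by field; rewrite gt_eqF.
  have : 0 <= 2 / a by rewrite divr_ge0// ltW.
  have := sqr_ge0 t; lra.
rewrite -[leRHS]mulr1; apply: ler_wpM2l => //.
by rewrite mulr_ge0// addr_ge0// divr_ge0// ltW.
Qed.

Let h (w : R) : R := \int[mu]_t (egauss a t * cos (w * t)).
Let k (w : R) : R := \int[mu]_t (egauss a t * t * sin (w * t)).

Let f (w t : R) : R := egauss a t * cos (w * t).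

Let derf (w t : R) : is_derive w 1 (f^~ t) (- (egauss a t * t * sin (w * t))).
Proof.
rewrite /f; apply: is_derive_eq.
by rewrite /GRing.scale /=; ring.
Qed.

Let mf_ (g : R -> R) : measurable_fun setT g ->
  (forall t, `|g t| <= 1 + `|t|) ->
  mu.-integrable setT (EFin \o (fun t => egauss a t * g t)).
Proof.
move=> mg gb; apply: le_integrable Idom => //.
  apply/measurable_EFinP; apply: measurable_funM => //.
  exact: measurable_egauss.
move=> t _; rewrite lee_fin /= normrM ger0_norm ?egauss_ge0// mulrC.
apply: le_trans (ler_norm _); apply: le_trans (dom_bound t).
by apply: ler_wpM2r => //; exact: egauss_ge0.
Qed.

Let mcos w : measurable_fun setT (fun t : R => cos (w * t)).
Proof.
by apply: measurableT_comp; [exact: continuous_measurable_fun (@continuous_cos R)|exact: measurable_funM].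
Qed.

Let msin w : measurable_fun setT (fun t : R => sin (w * t)).
Proof.
by apply: measurableT_comp; [exact: continuous_measurable_fun (@continuous_sin R)|exact: measurable_funM].
Qed.

Let If w : mu.-integrable setT (EFin \o f w).
Proof.
apply: mf_ => // t; apply: le_trans (cos_max _) _.
by rewrite lerDl.
Qed.

Let Ik w : mu.-integrable setT (EFin \o (fun t => egauss a t * (t * sin (w * t)))).
Proof.
apply: mf_; first by apply: measurable_funM.
move=> t; rewrite normrM; apply: le_trans (_ : _ <= `|t| * 1) _.
  by apply: ler_wpM2l => //; exact: sin_max.
by rewrite mulr1 lerDr.
Qed.

Let hE w : h w = \int[mu]_t f w t. Proof. by []. Qed.

Let der_h (w : R) : is_derive w 1 h (- k w).
Proof.
have Iw : `]w - 1, w + 1[%classic w by rewrite /= in_itv/=; apply/andP; split; lra.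
have d1 x y : `]w - 1, w + 1[%classic x -> setT y -> derivable (f^~ y) x 1.
  by move=> _ _; have [] := derf x y.
have d1E x y : partial1of2 f x y = - (egauss a y * y * sin (x * y)).
  by rewrite partial1of2E; have [_ ->] := derf x y.
have G0 y : 0 <= dom y.
  apply: le_trans (dom_bound y); apply: mulr_ge0; last exact: egauss_ge0.
  by rewrite addr_ge0.
have Gub x y : `]w - 1, w + 1[%classic x -> setT y -> `|partial1of2 f x y| <= dom y.
  move=> _ _; rewrite d1E normrN !normrM ger0_norm ?egauss_ge0//.
  apply: le_trans (dom_bound y); rewrite -mulrA mulrC.
  apply: ler_wpM2r; first exact: egauss_ge0.
  apply: le_trans (_ : _ <= `|y| * 1) _; last by rewrite mulr1 lerDr.
  by apply: ler_wpM2l => //; exact: sin_max.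
have D := @derivable_under_integral _ _ _ mu f setT measurableT w (w - 1) (w + 1) Iw
  (fun x _ => If x) d1 dom G0 Idom Gub.
have E := @differentiation_under_integral _ _ _ mu f setT measurableT w (w - 1) (w + 1) Iw
  (fun x _ => If x) d1 dom G0 Idom Gub.
apply: DeriveDef; first exact: D.
rewrite -derive1E E /k -mulN1r -RintegralZl//; last first.
  have := Ik w; congr (mu.-integrable _ (EFin \o _)).
  by apply/funext => t; rewrite mulrA.
by apply: eq_Rintegral => t _; rewrite d1E mulN1r.
Qed.

(* the boundary term of the integration by parts that relates h and k *)
Let u (w t : R) : R := egauss a t * sin (w * t).
Let u' (w t : R) : R := w * f w t - 2 * a * (egauss a t * (t * sin (w * t))).

Let der_u (w t : R) : is_derive t 1 (u w) (u' w t).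
Proof.
rewrite /u /egauss; apply: is_derive_eq.
rewrite /GRing.scale /= /u' /f /egauss; ring.
Qed.

Let Iu' w : mu.-integrable setT (EFin \o u' w).
Proof.
have := integrableB measurableT (integrableZl measurableT w (If w))
  (integrableZl measurableT (2 * a) (Ik w)).
exact.
Qed.

Let u_bound w t : `|u w t| <= egauss a t.
Proof.
rewrite normrM ger0_norm ?egauss_ge0// ler_piMr ?egauss_ge0//; exact: sin_max.
Qed.

Let cvg_egauss : (fun n : nat => egauss a n.+1%:R) @ \oo --> (0 : R).
Proof.
apply: (@squeeze_cvgr _ _ _ _ (fun=> 0) (fun n => a^-1 * harmonic n)).
- apply: nearW => n; rewrite egauss_ge0 /= /egauss expRN -invfM.
  rewrite lef_pV2 ?posrE ?expR_gt0 ?mulr_gt0//.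
  apply: le_trans (expR_ge1Dx _); apply: le_trans (_ : a * n.+1%:R ^+ 2 <= _).
    apply: ler_wpM2l; first exact: ltW.
    by rewrite -natrX ler_nat expnS leq_pmulr// expn1.
  by rewrite lerDr.
- exact: cvg_cst.
- by rewrite -(mulr0 a^-1); apply: cvgMr; exact: cvg_harmonic.
Qed.

(* u vanishes at infinity *)
Let int_u' w : \int[mu]_t u' w t = 0.
Proof.
have cu x : {for x, continuous (u w)}.
  by apply: differentiable_continuous; apply/derivable1_diffP; have [] := der_u w x.
have cu' : continuous (u' w).
  move=> x; apply: cvgB; apply: cvgMr.
    apply: cvgM; first exact: continuous_egauss.
    apply: continuous_comp; last exact: continuous_cos.
    by apply: cvgMr; exact: cvg_id.
  apply: cvgM; first exact: continuous_egauss.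
  apply: cvgM; first exact: cvg_id.
  apply: continuous_comp; last exact: continuous_sin.
  by apply: cvgMr; exact: cvg_id.
pose J (n : nat) : set R := `[- n.+1%:R, n.+1%:R]%classic.
have ftc n : \int[mu]_(t in J n) u' w t = u w n.+1%:R - u w (- n.+1%:R).
  rewrite /Rintegral (@continuous_FTC2 _ (u' w) (u w))//.
  - by apply: lt_trans (_ : 0 < _) => //; rewrite oppr_lt0.
  - exact: continuous_subspaceT.
  - split; first by move=> x _; have [] := der_u w x.
      by apply: cvg_at_right_filter; exact: cu.
    by apply: cvg_at_left_filter; exact: cu.
  - by move=> x _; rewrite derive1E; have [_ ->] := der_u w x.
have c1 : (fun n => \int[mu]_(t in J n) u' w t) @ \oo --> (0 : R).
  apply/norm_cvg0P; apply: (@squeeze_cvgr _ _ _ _ (fun=> 0) (fun n : nat => 2 * egauss a n.+1%:R)).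
  - apply: nearW => n; rewrite normr_ge0 /= ftc.
    apply: le_trans (ler_normB _ _) _.
    apply: le_trans (lerD (u_bound _ _) (u_bound _ _)) _.
    by rewrite {2}/egauss sqrrN -/(egauss a n.+1%:R); lra.
  - exact: cvg_cst.
  - by rewrite -(mulr0 2); apply: cvgMr; exact: cvg_egauss.
have c2 : (fun n => \int[mu]_(t in J n) u' w t) @ \oo --> \int[mu]_t u' w t.
  have mJ n : measurable (J n : set (measurableTypeR R)) by exact: measurable_itv.
  under eq_fun do rewrite Rintegral_mkcond.
  have [|||||i1 _ i2] := @dominated_convergence _ _ _ mu setT measurableT
    (fun n t => ((u' w \_ (J n)) t)%:E) (EFin \o u' w) (fun t => `|u' w t|%:E).
  - move=> n; apply/measurable_EFinP; apply/(measurable_restrictT _ (mJ n)).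
    by apply: measurable_funTS; exact: continuous_measurable_fun.
  - by apply/measurable_EFinP; exact: continuous_measurable_fun.
  - apply: aeW => t _; apply: cvg_near_cst.
    have [N tN] : exists N : nat, `|t| < N%:R.
      by exists (Num.truncn `|t|).+1; rewrite truncnS_gt.
    exists N => // n /= Nn; rewrite patchE mem_set// /J /= in_itv/= -ler_norml.
    by apply: le_trans (ltW tN) _; rewrite ler_nat (leq_trans Nn).
  - exact: integrable_abse (Iu' w).
  - apply: aeW => t n _; rewrite /= lee_fin patchE; case: ifPn => // _.
    by rewrite normr0.
  - by apply: fine_cvg; rewrite /Rintegral fineK//; exact: integrable_fin_num i1.
by rewrite -(cvg_lim _ c2)// (cvg_lim _ c1).
Qed.

Let ibp w : 2 * a * k w = w * h w.
Proof.
have := int_u' w; rewrite /u' RintegralB//; last 2 first.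
- exact: (integrableZl measurableT w (If w)).
- exact: (integrableZl measurableT (2 * a) (Ik w)).
rewrite !RintegralZl// -hE => /eqP; rewrite subr_eq0 => /eqP ->.
by congr (_ * _); apply: eq_Rintegral => t _; rewrite mulrA.
Qed.

Let h0 : h 0 = Num.sqrt (pi / a).
Proof.
rewrite /h /Rintegral (eq_integral (fun t : measurableTypeR R => (egauss a (t - 0))%:E)).
  by rewrite integral_egauss.
by move=> t _; rewrite mul0r cos0 mulr1 subr0.
Qed.

(** The transform h satisfies h'(w) = - w h(w) / (2 a), by differentiation under the
integral sign and integration by parts; hence exp (w^2 / (4 a)) h(w) is constant. *)
Lemma fourier_egauss w :
  \int[mu]_t (egauss a t * cos (w * t)) = Num.sqrt (pi / a) * expR (- (w ^+ 2 / (4 * a))).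
Proof.
pose E x := expR (x ^+ 2 / (4 * a)) * h x.
have dE (x : R) : is_derive x 1 E 0.
  have dh := der_h x.
  rewrite /E; apply: is_derive_eq.
  rewrite /GRing.scale /=; have := ibp x.
  set e := expR _ => kh; transitivity (e * ((x * h x - 2 * a * k x) / (2 * a))).
    by field; rewrite gt_eqF.
  by rewrite kh subrr mul0r mulr0.
have : E w = E 0 by apply: is_derive_0_is_cst.
rewrite /E expr0n mul0r expR0 mul1r h0 => <-.
by rewrite mulrAC -expRD subrr expR0 mul1r.
Qed.

End gaussian_fourier.

Section expi_theory.
Context {R : realType}.
Implicit Types x y : R.

Lemma expi0 : expi (0 : R) = 1.
Proof. by rewrite /expi cos0 sin0. Qed.

Lemma expiD x y : expi (x + y) = expi x * expi y.
Proof.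
by apply: complex_eqP; rewrite ?ReM ?ImM /= ?cosD ?sinD //; ring.
Qed.

Lemma conjc_expi x : (expi x)^* = expi (- x).
Proof. by rewrite /expi /= cosN sinN. Qed.

Lemma expiN_mul x : expi (- x) * expi x = 1.
Proof. by rewrite -expiD addNr expi0. Qed.

Lemma expi_sum (I : Type) (s : seq I) (F : I -> R) :
  expi (\sum_(i <- s) F i) = \prod_(i <- s) expi (F i).
Proof.
by elim/big_rec2: _ => [|i y z _ <-]; rewrite ?expi0// expiD.
Qed.

Lemma cmeasurable_expi d (T : measurableType d) (f : T -> R) :
  measurable_fun setT f -> cmeasurable (fun t => expi (f t)).
Proof.
move=> mf; split.
  exact: (measurableT_comp (continuous_measurable_fun (@continuous_cos R)) mf).
exact: (measurableT_comp (continuous_measurable_fun (@continuous_sin R)) mf).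
Qed.

(** The chord has length 2 |sin (x / 2)|, at most the length of the arc. *)
Lemma normc_expiB1 x : normc (expi x - 1) <= `|x|.
Proof.
have s_le y : `|sin y| <= `|y|.
  wlog y0 : y / 0 <= y.
    move=> H; have [/H//|y0] := leP 0 y.
    by rewrite -normrN -sinN -[leRHS]normrN; apply: H; rewrite oppr_ge0 ltW.
  have dsin (z : R) : is_derive z 1 (@sin R) (cos z) by exact: is_derive_sin.
  have [->|yneq] := eqVneq y 0; first by rewrite sin0.
  have ygt : 0 < y by rewrite lt_def yneq.
  have [z _ ] := @MVT R sin cos 0 y ygt (fun z _ => dsin z)
    (continuous_subspaceT (@continuous_sin R)).
  rewrite sin0 !subr0 => ->; rewrite normrM ler_piMl//; exact: cos_max.
rewrite -(@ler_pXn2r _ 2)// ?nnegrE ?normc_ge0// sqr_normc ReD ImD /= oppr0 addr0.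
have -> : (cos x + -1) ^+ 2 + sin x ^+ 2 = (2 * sin (x / 2)) ^+ 2.
  have xx : x = x / 2 + x / 2 by field.
  have -> : cos x = cos (x / 2) ^+ 2 - sin (x / 2) ^+ 2 by rewrite {1}xx cosD.
  have -> : sin x = 2 * (sin (x / 2) * cos (x / 2)) by rewrite {1}xx sinD; ring.
  have := cos2Dsin2 (x / 2); move: (cos _) (sin _) => c s h.
  have -> : c ^+ 2 = 1 - s ^+ 2 by rewrite -h; ring.
  have -> : (2 * (s * c)) ^+ 2 = 4 * s ^+ 2 * c ^+ 2 by ring.
  have -> : c ^+ 2 = 1 - s ^+ 2 by rewrite -h; ring.
  ring.
rewrite -[X in X <= _]real_normK ?num_real//.
rewrite ler_pXn2r ?nnegrE// normrM ger0_norm//.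
apply: le_trans (ler_wpM2l _ (s_le _)) _ => //.
by rewrite normrM [`|2^-1|]ger0_norm ?invr_ge0// mulrCA divff ?mulr1.
Qed.

End expi_theory.

Section gaussian_fourier_cV.
Context {R : realType}.
Local Notation mu := (@lebesgue_measure R : {sigma_finite_measure set (measurableTypeR R) -> \bar R}).

Lemma lebesgue_measure_opp (A : set (measurableTypeR R)) :
  measurable A -> mu A = mu ((-%R : R -> R) @^-1` A).
Proof.
move=> mA; have mD : measurable_fun setT ((-%R : R -> R) : measurableTypeR R -> measurableTypeR R).
  exact: measurable_funN.
pose nu := measure_function_pushforward__canonical__measure_function_Measure
  (lebesgue_measure : {measure set (measurableTypeR R) -> \bar R}) mD.
apply: (@lebesgue_measure_unique R nu) => // X [[a b] _ <-].
rewrite /nu/= /pushforward.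
rewrite (_ : _ @^-1` _ = `[- b, - a[%classic); last first.
  by apply/seteqP; split=> t; rewrite /= !in_itv/= => /andP[? ?]; apply/andP; split; lra.
rewrite !lebesgue_measure_itv/= !lte_fin ltrN2.
by case: ifP => // _; rewrite -!EFinB; congr EFin; ring.
Qed.

(** The reflection t |-> - t shows that the integral is real. *)
Lemma cintegral_egauss (b w : R) : 0 < b ->
  cintegrable mu (fun t => expi (w * t) * (egauss b t)%:C) /\
  cintegral mu (fun t => expi (w * t) * (egauss b t)%:C) =
  (Num.sqrt (pi / b) * expR (- (w ^+ 2 / (4 * b))))%:C.
Proof.
move=> b0; pose f (t : R) : R[i] := expi (w * t) * (egauss b t)%:C.
have If : cintegrable mu f.
  apply: (cintegrable_le _ (integrable_egauss b0)).
    apply: cmeasurableM; first by apply: cmeasurable_expi; exact: measurable_funM.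
    by split; [exact: measurable_egauss|exact: measurable_cst].
  by move=> t; rewrite normcM normc_expi mul1r normc_real ger0_norm ?egauss_ge0.
split=> //.
have E : cintegral mu f = (cintegral mu f)^*.
  have mN : measurable_fun setT ((-%R : R -> R) : measurableTypeR R -> measurableTypeR R).
    exact: measurable_funN.
  rewrite -(cintegral_conjc If) (cintegral_transfer mN lebesgue_measure_opp If).
  apply: eq_cintegral => t; rewrite /f conjcM conjc_realC conjc_expi mulrN.
  by congr (_ * _%:C); rewrite /egauss sqrrN.
apply: complex_eqP.
  rewrite -fourier_egauss//; apply: eq_Rintegral => t _.
  by rewrite -[LHS]/(Re (f t)) /f mulrC Re_realM.
by have /(congr1 (@complex.Im R)) := E; rewrite Im_conjc /= => h; lra.
Qed.

Definition egaussN n (b : R) (v : 'cV[R]_n) : R := expR (- (b * \sum_i v i ord0 ^+ 2)).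

Lemma egaussNE n b (v : 'cV[R]_n) : egaussN b v = \prod_i egauss b (v i ord0).
Proof.
by rewrite /egaussN mulr_sumr -sumrN expR_sum.
Qed.

Lemma cintegral_egaussN n (b : R) (w : 'cV[R]_n) : 0 < b ->
  cintegrable (lebesgue_cV n) (fun v => expi (dotcV w v) * (egaussN b v)%:C) /\
  cintegral (lebesgue_cV n) (fun v => expi (dotcV w v) * (egaussN b v)%:C) =
  (Num.sqrt (pi / b) ^+ n * expR (- ((\sum_i w i ord0 ^+ 2) / (4 * b))))%:C.
Proof.
move=> b0.
pose h (i : 'I_n) (t : R) : R[i] := expi (w i ord0 * t) * (egauss b t)%:C.
have E : (fun v : 'cV[R]_n => expi (dotcV w v) * (egaussN b v)%:C) =
    (fun v => \prod_i h i (v i ord0)).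
  apply/funext => v; rewrite /h big_split /= -expi_sum egaussNE.
  by rewrite (rmorph_prod (real_complex R)).
have [I1 I2] := @cintegral_prod R n h (fun i => (cintegral_egauss (w i ord0) b0).1).
rewrite E; split => //; rewrite I2.
rewrite (eq_bigr (fun i => (Num.sqrt (pi / b) * expR (- (w i ord0 ^+ 2 / (4 * b))))%:C)); last first.
  by move=> i _; exact: (cintegral_egauss (w i ord0) b0).2.
rewrite -(rmorph_prod (real_complex R)) big_split /= prodr_const card_ord -expR_sum.
by rewrite sumrN mulr_suml.
Qed.

End gaussian_fourier_cV.

(** * Gaussian approximate identities *)

Section gaussian_kernel.
Context {R : realType}.
Local Notation mu := (@lebesgue_measure R : {sigma_finite_measure set (measurableTypeR R) -> \bar R}).

(** The Gaussian probability density of variance 1/(2M), an approximate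
    identity as M tends to infinity. *)
Definition gauss_kernel (M u : R) : R := Num.sqrt (M / pi) * egauss M u.

(** The convolution of the kernel with the indicator of the interval ]a, c]. *)
Definition kernel_mass (M a c t : R) : R :=
  \int[mu]_x (\1_(`]a, c]%classic) x * gauss_kernel M (x - t)).

Variable M : R.
Hypothesis M0 : 0 < M.

Let scale_pi (x y : R) : x / pi * (pi / y) = x / y.
Proof. by rewrite mulrA divfK// gt_eqF// pi_gt0. Qed.

Lemma gauss_kernel_ge0 u : 0 <= gauss_kernel M u.
Proof. by rewrite mulr_ge0 ?sqrtr_ge0 ?egauss_ge0. Qed.

Let mk t : measurable_fun setT (fun x : measurableTypeR R => gauss_kernel M (x - t)).
Proof.
apply: measurable_funM => //; apply: measurableT_comp; first exact: measurable_egauss.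
exact: measurable_funB.
Qed.

Let int_egauss_shift (b t : R) : 0 < b ->
  mu.-integrable setT (EFin \o (fun x : measurableTypeR R => egauss b (x - t))).
Proof.
move=> b0; apply/integrableP; split.
  apply/measurable_EFinP; apply: measurableT_comp; first exact: measurable_egauss.
  exact: measurable_funB.
under eq_integral do rewrite /= ger0_norm ?egauss_ge0//.
by rewrite integral_egauss// ltry.
Qed.

Lemma integrable_gauss_kernel t :
  mu.-integrable setT (EFin \o (fun x : measurableTypeR R => gauss_kernel M (x - t))).
Proof. exact: (integrableZl measurableT (Num.sqrt (M / pi)) (int_egauss_shift t M0)). Qed.

Lemma integral_gauss_kernel t : \int[mu]_x gauss_kernel M (x - t) = 1.
Proof.
rewrite /gauss_kernel RintegralZl//; last exact: int_egauss_shift.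
rewrite /Rintegral integral_egauss//= -sqrtrM ?divr_ge0 ?pi_ge0 ?(ltW M0)//.
rewrite scale_pi// divff ?gt_eqF//.
exact: sqrtr1.
Qed.

Lemma integrable_mass a c t : mu.-integrable setT
  (EFin \o (fun x : measurableTypeR R => \1_(`]a, c]%classic) x * gauss_kernel M (x - t))).
Proof.
apply: le_integrable (integrable_gauss_kernel t) => //.
  apply/measurable_EFinP; apply: measurable_funM; last exact: mk.
  by apply: measurable_indic; exact: measurable_itv.
move=> x _; rewrite lee_fin /= normrM ler_piMl//.
by rewrite indicE; case: (_ \in _) => /=; rewrite ?normr0 ?normr1.
Qed.

Lemma kernel_mass_ge0 a c t : 0 <= kernel_mass M a c t.
Proof.
apply: Rintegral_ge0 => x _; apply: mulr_ge0; last exact: gauss_kernel_ge0.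
by rewrite indicE ler0n.
Qed.

Lemma kernel_mass_le1 a c t : kernel_mass M a c t <= 1.
Proof.
rewrite -(integral_gauss_kernel t); apply: le_Rintegral => //.
- exact: integrable_mass.
- exact: integrable_gauss_kernel.
by move=> x _; rewrite ler_piMl ?gauss_kernel_ge0.
Qed.

(** Away from the endpoints of the interval only the mass of the kernel at distance
at least r from its centre matters, and this mass is O(1 / M). *)
Lemma kernel_mass_approx a c t r : 0 < r -> r <= `|t - a| -> r <= `|t - c| ->
  `|kernel_mass M a c t - \1_(`]a, c]%classic) t| <= 4 / r ^+ 2 / M.
Proof.
move=> r0 ra rc; have p0 := pi_gt0 R.
have -> : kernel_mass M a c t - \1_(`]a, c]%classic) t =
    \int[mu]_x ((\1_(`]a, c]%classic) x - \1_(`]a, c]%classic) t) * gauss_kernel M (x - t)).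
  under eq_Rintegral do rewrite mulrBl.
  rewrite RintegralB//; last 2 first.
  - exact: integrable_mass.
  - exact: (integrableZl measurableT _ (integrable_gauss_kernel t)).
  rewrite RintegralZl//; last exact: integrable_gauss_kernel.
  by rewrite integral_gauss_kernel mulr1.
(* beyond the distance r, half of the exponent of the kernel gives the decay in M
   and the other half an integrable majorant *)
pose K := expR (- (M / 2 * r ^+ 2)) * Num.sqrt (M / pi).
have M20 : 0 < M / 2 by rewrite divr_gt0.
have IK : mu.-integrable setT (EFin \o (fun x : measurableTypeR R => K * egauss (M / 2) (x - t))).
  exact: (integrableZl measurableT _ (int_egauss_shift t M20)).
have dom (x : measurableTypeR R) :
    `|(\1_(`]a, c]%classic) x - \1_(`]a, c]%classic) t) * gauss_kernel M (x - t)| <=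
    K * egauss (M / 2) (x - t).
  rewrite normrM [X in _ * X]ger0_norm ?gauss_kernel_ge0//.
  have [rx|xr] := leP r `|x - t|.
    apply: (@le_trans _ _ (gauss_kernel M (x - t))).
      rewrite ler_piMl ?gauss_kernel_ge0// !indicE.
      by case: (_ \in _); case: (_ \in _); rewrite ?subrr ?subr0 ?sub0r ?normrN ?normr0 ?normr1.
    rewrite /gauss_kernel /K mulrAC mulrC ler_wpM2r ?sqrtr_ge0//.
    rewrite /egauss -expRD ler_expR -opprD lerN2 -mulrDr.
    rewrite [leRHS](_ : _ = M / 2 * ((x - t) ^+ 2 + (x - t) ^+ 2)); last by field.
    apply: ler_wpM2l; first exact: ltW.
    rewrite lerD2r -[leRHS]real_normK ?num_real// ler_pXn2r// nnegrE//; exact: ltW.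
  have -> : \1_(`]a, c]%classic) x = \1_(`]a, c]%classic) t :> R.
    rewrite !indicE; congr (_%:R); congr nat_of_bool; apply/idP/idP; rewrite !inE /= !in_itv/=.
      move: xr ra rc; rewrite ltr_norml => /andP[h1 h2].
      rewrite !ler_normr => /orP[]? /orP[]? /andP[? ?]; apply/andP; split; lra.
    move: xr ra rc; rewrite ltr_norml => /andP[h1 h2].
    rewrite !ler_normr => /orP[]? /orP[]? /andP[? ?]; apply/andP; split; lra.
  by rewrite subrr normr0 mul0r !mulr_ge0 ?expR_ge0 ?sqrtr_ge0 ?egauss_ge0.
have ID : mu.-integrable setT (EFin \o (fun x : measurableTypeR R =>
    (\1_(`]a, c]%classic) x - \1_(`]a, c]%classic) t) * gauss_kernel M (x - t))).
  apply: le_integrable IK => //.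
    apply/measurable_EFinP; apply: measurable_funM; last exact: mk.
    apply: measurable_funB; last exact: measurable_cst.
    by apply: measurable_indic; exact: measurable_itv.
  by move=> x _; rewrite lee_fin; apply: le_trans (dom x) (ler_norm _).
apply: le_trans (le_normr_Rintegral measurableT ID) _.
apply: le_trans (le_Rintegral _ _ IK _) _ => //; first exact: integrable_abse ID.
rewrite RintegralZl//; last exact: int_egauss_shift.
rewrite /Rintegral integral_egauss//= /K -mulrA -sqrtrM ?divr_ge0 ?pi_ge0 ?(ltW M0)//.
have -> : M / pi * (pi / (M / 2)) = 2 by rewrite scale_pi; field; rewrite gt_eqF.
apply: (@le_trans _ _ (expR (- (M / 2 * r ^+ 2)) * 2)).
  apply: ler_wpM2l; first exact: expR_ge0.
  by rewrite -[leRHS]ger0_norm// -sqrtr_sqr ler_sqrt; lra.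
(* exp (- x) <= 1 / x *)
have Mr : 0 < M / 2 * r ^+ 2 by rewrite mulr_gt0// exprn_gt0.
rewrite expRN mulrC ler_pdivrMr ?expR_gt0//.
have -> : 4 / r ^+ 2 / M = 2 / (M / 2 * r ^+ 2) by field; apply/andP; split; rewrite gt_eqF.
rewrite mulrAC ler_pdivlMr// ler_wpM2l//.
by apply: le_trans (expR_ge1Dx _); rewrite lerDr.
Qed.

End gaussian_kernel.

Section gaussian_kernel_limit.
Context {R : realType}.

Lemma kernel_mass_cvg (a c t : R) : t != a -> t != c ->
  (fun k : nat => kernel_mass k.+1%:R a c t) @ \oo --> (\1_(`]a, c]%classic) t : R).
Proof.
move=> ta tc; pose r := Num.min `|t - a| `|t - c|.
have r0 : 0 < r by rewrite lt_min !normr_gt0 !subr_eq0 ta tc.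
have M0 (k : nat) : 0 < k.+1%:R :> R by [].
apply/subr_cvg0/norm_cvg0P.
apply: (@squeeze_cvgr _ _ _ _ (fun=> 0) (fun k => 4 / r ^+ 2 * harmonic k)).
- apply: nearW => k; rewrite normr_ge0 /=.
  by apply: kernel_mass_approx => //; rewrite /r ge_min lexx ?orbT.
- exact: cvg_cst.
- by rewrite -(mulr0 (4 / r ^+ 2)); apply: cvgMr; exact: cvg_harmonic.
Qed.

End gaussian_kernel_limit.

(** * Fourier inversion and Parseval's formula *)

Section fourier_inversion.
Context {R : realType} (n : nat).
Local Notation mu := (@lebesgue_cV R n).
Local Notation leb1 := (@lebesgue_measure R : {sigma_finite_measure set (measurableTypeR R) -> \bar R}).
Implicit Types F G u : 'cV[R]_n -> R[i].

Definition fourier F (w : 'cV[R]_n) : R[i] :=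
  cintegral mu (fun t => F t * expi (- (2 * pi * dotcV t w))).

Definition inv_fourier G (x : 'cV[R]_n) : R[i] :=
  cintegral mu (fun w => G w * expi (2 * pi * dotcV x w)).

Lemma measurable_dotcV d (T : measurableType d) (f g : T -> 'cV[R]_n) :
  measurable_fun setT f -> measurable_fun setT g ->
  measurable_fun setT (fun t => dotcV (f t) (g t)).
Proof.
move=> mf mg; apply: measurable_sum => i; apply: measurable_funM.
  exact: (measurableT_comp (measurable_mxentry i ord0) mf).
exact: (measurableT_comp (measurable_mxentry i ord0) mg).
Qed.

Lemma cmeasurable_phase d (T : measurableType d) (c : R) (f g : T -> 'cV[R]_n) :
  measurable_fun setT f -> measurable_fun setT g ->
  cmeasurable (fun t => expi (c * dotcV (f t) (g t))).
Proof.
move=> mf mg; apply: cmeasurable_expi; apply: measurable_funM => //.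
exact: measurable_dotcV.
Qed.

Let phaseN (t w : 'cV[R]_n) : - (2 * pi * dotcV t w) = (- (2 * pi)) * dotcV t w.
Proof. by rewrite mulNr. Qed.

Lemma measurable_egaussN (b : R) : measurable_fun setT (@egaussN R n b).
Proof.
apply: measurableT_comp; first exact: measurable_expR.
apply: measurable_funN; apply: measurable_funM => //.
by apply: measurable_sum => i; apply: measurable_funX; exact: measurable_mxentry.
Qed.

Lemma egaussN_ge0 (b : R) (v : 'cV[R]_n) : 0 <= egaussN b v.
Proof. exact: expR_ge0. Qed.

Lemma egaussN_le1 (b : R) (v : 'cV[R]_n) : 0 <= b -> egaussN b v <= 1.
Proof.
move=> b0; rewrite /egaussN -expR0 ler_expR oppr_le0 mulr_ge0// sumr_ge0// => i _.
exact: sqr_ge0.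
Qed.

Lemma integrable_egaussN (b : R) : 0 < b -> mu.-integrable setT (EFin \o @egaussN R n b).
Proof.
move=> b0; have [/cintegrable_normc h _] := @cintegral_egaussN R n b 0 b0.
move: h; congr (mu.-integrable _ (EFin \o _)); apply/funext => v.
by rewrite normcM normc_expi mul1r normc_real ger0_norm ?egaussN_ge0.
Qed.

Definition gauss_kernelN (M : R) (y : 'cV[R]_n) : R := \prod_i gauss_kernel M (y i ord0).

Lemma gauss_kernelNE M y : gauss_kernelN M y = Num.sqrt (M / pi) ^+ n * egaussN M y.
Proof. by rewrite /gauss_kernelN big_split /= prodr_const card_ord -egaussNE. Qed.

Lemma measurable_gauss_kernelN M : measurable_fun setT (gauss_kernelN M).
Proof.
rewrite (_ : gauss_kernelN M = fun y => Num.sqrt (M / pi) ^+ n * egaussN M y).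
  by apply: measurable_funM => //; exact: measurable_egaussN.
by apply/funext => y; rewrite gauss_kernelNE.
Qed.

Section approximation.
Variables (a c : 'I_n -> R).

Definition box_ind (v : 'cV[R]_n) : R := \1_(box a c) v.

Lemma box_indE v : box_ind v = \prod_i \1_(`]a i, c i]%classic) (v i ord0).
Proof.
rewrite /box_ind indicE; have [vb|vb] := boolP (v \in box a c).
  rewrite big1// => i _; rewrite indicE mem_set//= in_itv/=.
  by move: vb; rewrite inE; exact.
have [i iv] : exists i, ~ (a i < v i ord0 <= c i).
  by apply/existsNP => h; move/negP: vb; apply; rewrite inE.
by rewrite (bigD1 i)//= indicE memNset ?mul0r//= in_itv/=.
Qed.

Lemma box_ind_ge0 v : 0 <= box_ind v. Proof. by rewrite /box_ind indicE ler0n. Qed.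

Lemma box_ind_le1 v : box_ind v <= 1.
Proof. by rewrite /box_ind indicE; case: (_ \in _). Qed.

Lemma measurable_box_ind : measurable_fun setT box_ind.
Proof. by apply: measurable_indic; exact: measurable_box. Qed.

Lemma integrable_box_ind : mu.-integrable setT (EFin \o box_ind).
Proof.
have [|I1 _] := @cintegral_prod R n (fun i t => (\1_(`]a i, c i]%classic) t)%:C).
  by move=> i; apply: cintegrable_real; exact: integrable_indic_itv.
move: I1 => [+ _]; congr (mu.-integrable _ (EFin \o _)); apply/funext => v /=.
by rewrite -(rmorph_prod (real_complex R)) /= box_indE.
Qed.

Definition mass (M : R) (t : 'cV[R]_n) : R :=
  \prod_i kernel_mass M (a i) (c i) (t i ord0).

Lemma mass_cvg : {ae mu, forall t : 'cV[R]_n,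
  (fun k : nat => mass k.+1%:R t) @ \oo --> box_ind t}.
Proof.
have h i : {ae mu, forall t : 'cV[R]_n, t i ord0 <> a i /\ t i ord0 <> c i}.
  apply: (@lebesgue_cV_coord_ae R n i (fun x => x <> a i /\ x <> c i)).
  exists ([set a i] `|` [set c i]); split.
  - by apply: measurableU; exact: measurable_set1.
  - by rewrite measureU0 //; exact: lebesgue_measure_set1.
  - move=> x /= /not_andP[|] /contrapT ->; [by left|by right].
have : {ae mu, forall t : 'cV[R]_n, forall i, t i ord0 <> a i /\ t i ord0 <> c i}.
  exact: filter_forall.
apply: filterS => t ht; rewrite box_indE /mass.
apply: cvg_big => [|i _]; first exact: mul_continuous.
by have [/eqP ta /eqP tc] := ht i; exact: kernel_mass_cvg.
Qed.

Lemma mass_ge0 M t : 0 <= mass M t.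
Proof. by apply: prodr_ge0 => i _; exact: kernel_mass_ge0. Qed.

Lemma mass_le1 M t : 0 < M -> mass M t <= 1.
Proof.
move=> M0; apply: prodr_ile1 => i _; apply/andP; split.
  exact: kernel_mass_ge0.
exact: kernel_mass_le1.
Qed.

Lemma cintegral_mass M t : 0 < M ->
  cintegral mu (fun x => (box_ind x)%:C * (gauss_kernelN M (x - t))%:C) = (mass M t)%:C.
Proof.
move=> M0.
have E : (fun x => (box_ind x)%:C * (gauss_kernelN M (x - t))%:C) =
  (fun x : 'cV[R]_n => \prod_i (\1_(`]a i, c i]%classic) (x i ord0) *
     gauss_kernel M (x i ord0 - t i ord0))%:C).
  apply/funext => x; rewrite -(rmorph_prod (real_complex R)) big_split /= -box_indE.
  rewrite rmorphM; congr (_ * _%:C); apply: eq_bigr => i _.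
  by rewrite !mxE.
rewrite E (@cintegral_prod R n (fun i x => (\1_(`]a i, c i]%classic) x *
     gauss_kernel M (x - t i ord0))%:C) _).2; last first.
  by move=> i; apply: cintegrable_real; exact: integrable_mass.
rewrite /mass (rmorph_prod (real_complex R)); apply: eq_bigr => i _.
exact: cintegral_real.
Qed.

Lemma cmeasurable_mass M : 0 < M -> cmeasurable (fun t => (mass M t)%:C).
Proof.
move=> M0; rewrite (_ : (fun t => _) = fun t =>
  cintegral mu (fun x => (box_ind x)%:C * (gauss_kernelN M (x - t))%:C)); last first.
  by apply/funext => t; rewrite cintegral_mass.
apply: (@cmeasurable_param _ _ _ _ _ _ (fun p : 'cV[R]_n * 'cV[R]_n =>
  (box_ind p.2)%:C * (gauss_kernelN M (p.2 - p.1))%:C)).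
apply: cmeasurableM.
  by split; [exact: (measurableT_comp measurable_box_ind measurable_snd)|exact: measurable_cst].
split; last exact: measurable_cst.
apply: (measurableT_comp (measurable_gauss_kernelN _)).
apply: measurable_fun_mxP => i j.
have -> : (fun t : 'cV[R]_n * 'cV[R]_n => (t.2 - t.1) i j) = (fun t => t.2 i j - t.1 i j).
  by apply/funext => t; rewrite !mxE.
apply: measurable_funB.
  exact: (measurableT_comp (measurable_mxentry i j) measurable_snd).
exact: (measurableT_comp (measurable_mxentry i j) measurable_fst).
Qed.

End approximation.

Section inversion.
Variable F : 'cV[R]_n -> R[i].
Hypotheses (IF : cintegrable mu F) (IFh : cintegrable mu (fourier F)).

Let Fh := fourier F.
Let mF := cintegrable_cmeasurable IF.
Let mFh := cintegrable_cmeasurable IFh.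

(* the Gaussian means of the inversion integral *)
Let S (M : R) (x : 'cV[R]_n) : R[i] :=
  cintegral mu (fun w => Fh w * expi (2 * pi * dotcV x w) * (egaussN (pi ^+ 2 / M) w)%:C).

(* Fubini: integrating first in the frequency w leaves the transform of a Gaussian,
   which is a Gaussian kernel. *)
Let SE M x : 0 < M -> S M x = cintegral mu (fun t => F t * (gauss_kernelN M (x - t))%:C).
Proof.
move=> M0; pose b := pi ^+ 2 / M.
have b0 : 0 < b by rewrite divr_gt0// exprn_gt0// pi_gt0.
pose f (p : 'cV[R]_n * 'cV[R]_n) : R[i] :=
  F p.2 * (expi (- (2 * pi) * dotcV p.2 p.1) * (expi (2 * pi * dotcV x p.1) * (egaussN b p.1)%:C)).
have mf : cmeasurable f.
  apply: cmeasurableM; first exact: (cmeasurable_transfer (@measurable_snd _ _ _ _) mF).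
  apply: cmeasurableM; first by apply: cmeasurable_phase.
  apply: cmeasurableM; first by apply: cmeasurable_phase.
  by split; [exact: (measurableT_comp (measurable_egaussN b) measurable_fst)|exact: measurable_cst].
have If : cintegrable (mu \x mu)%E f.
  apply: (cintegrable_prod_le mf (integrable_egaussN b0) (cintegrable_normc IF)).
  - by move=> w; exact: egaussN_ge0.
  - by move=> t; exact: normc_ge0.
  - move=> w t; rewrite !normcM !normc_expi !mul1r normc_real mulrC.
    by rewrite ger0_norm ?egaussN_ge0.
rewrite /S -/b; transitivity (cintegral mu (fun w => cintegral mu (fun t => f (w, t)))).
  apply: eq_cintegral => w; rewrite /Fh /fourier -mulrA mulrC.
  rewrite -cintegralZ; last first.
    apply: (cintegrableM_bounded (C := 1) IF _).
      by under eq_fun do rewrite phaseN; apply: cmeasurable_phase.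
    by move=> t; rewrite normc_expi.
  by apply: eq_cintegral => t; rewrite /f /= -phaseN mulrC mulrA.
rewrite (cfubini If); apply: eq_cintegral => t.
pose y := x - t; pose z : 'cV[R]_n := (2 * pi) *: y.
have [Iz Ez] := cintegral_egaussN z b0.
transitivity (cintegral mu (fun w => F t * (expi (dotcV z w) * (egaussN b w)%:C))).
  apply: eq_cintegral => w; rewrite /f /= [in RHS]/dotcV.
  rewrite (_ : \sum_i _ = - (2 * pi) * dotcV t w + 2 * pi * dotcV x w).
    by rewrite expiD; congr (F t * _); exact: mulrA.
  rewrite !mulr_sumr -big_split; apply: eq_bigr => i _ /=.
  by rewrite !mxE; ring.
rewrite cintegralZ// Ez; congr (_ * _%:C).
rewrite gauss_kernelNE -/y; congr (Num.sqrt _ ^+ n * expR (- _)).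
  by rewrite /b; have := pi_gt0 R; move: (pi : R) => P P0; field; rewrite !gt_eqF.
rewrite mulrC !mulr_sumr; apply: eq_bigr => i _; rewrite !mxE /b.
by have := pi_gt0 R; move: (pi : R) => P P0; field; rewrite !gt_eqF.
Qed.

Let mS M : cmeasurable (S M).
Proof.
apply: (@cmeasurable_param _ _ _ _ _ _ (fun p : 'cV[R]_n * 'cV[R]_n =>
  Fh p.2 * expi (2 * pi * dotcV p.1 p.2) * (egaussN (pi ^+ 2 / M) p.2)%:C)).
apply: cmeasurableM.
  apply: cmeasurableM; first exact: (cmeasurable_transfer (@measurable_snd _ _ _ _) mFh).
  by apply: cmeasurable_phase.
by split; [exact: (measurableT_comp (measurable_egaussN _) measurable_snd)|exact: measurable_cst].
Qed.

Lemma cmeasurable_inv_fourier : cmeasurable (inv_fourier Fh).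
Proof.
apply: (@cmeasurable_param _ _ _ _ _ _ (fun p : 'cV[R]_n * 'cV[R]_n =>
  Fh p.2 * expi (2 * pi * dotcV p.1 p.2))).
apply: cmeasurableM; first exact: (cmeasurable_transfer (@measurable_snd _ _ _ _) mFh).
by apply: cmeasurable_phase.
Qed.

Let Iinv x : cintegrable mu (fun w => Fh w * expi (2 * pi * dotcV x w)).
Proof.
apply: (cintegrableM_bounded (C := 1) IFh _); first by apply: cmeasurable_phase.
by move=> w; rewrite normc_expi.
Qed.

Let N1 := \int[mu]_w normc (Fh w).

Lemma normc_inv_fourier_le x : normc (inv_fourier Fh x) <= N1.
Proof.
apply: le_trans (normc_cintegral_le (Iinv x)) _.
by rewrite /N1; under eq_Rintegral do rewrite normcM normc_expi mulr1.
Qed.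

Let S_le M x : 0 < M -> normc (S M x) <= N1.
Proof.
move=> M0.
have b0 : 0 <= pi ^+ 2 / M by rewrite divr_ge0 ?sqr_ge0 ?ltW.
have IS : cintegrable mu (fun w => Fh w * expi (2 * pi * dotcV x w) * (egaussN (pi ^+ 2 / M) w)%:C).
  apply: (cintegrableM_bounded (C := 1) (Iinv x) _).
    by split; [exact: measurable_egaussN|exact: measurable_cst].
  by move=> w; rewrite normc_real ger0_norm ?egaussN_ge0// egaussN_le1.
apply: le_trans (normc_cintegral_le IS) _; apply: le_Rintegral => //.
- exact: cintegrable_normc.
- exact: cintegrable_normc.
- move=> w _; rewrite !normcM normc_expi mulr1 normc_real ger0_norm ?egaussN_ge0//.
  by rewrite ler_piMr ?normc_ge0// egaussN_le1.
Qed.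

Let S_cvg x : (fun k : nat => normc (S k.+1%:R x - inv_fourier Fh x)) @ \oo --> (0 : R).
Proof.
apply: (cdominated_convergence (h := fun w => normc (Fh w))).
- move=> k; apply: cmeasurableM; first exact: cintegrable_cmeasurable (Iinv x).
  by split; [exact: measurable_egaussN|exact: measurable_cst].
- exact: cintegrable_cmeasurable (Iinv x).
- apply: aeW => w.
  have e k : normc (Fh w * expi (2 * pi * dotcV x w) * (egaussN (pi ^+ 2 / k.+1%:R) w)%:C -
      Fh w * expi (2 * pi * dotcV x w)) = normc (Fh w) * `|egaussN (pi ^+ 2 / k.+1%:R) w - 1|.
    rewrite -[X in _ - X]mulr1 -mulrBr !normcM normc_expi mulr1; congr (_ * _).
    by rewrite -normc_real rmorphB.
  under eq_fun do rewrite e.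
  rewrite -(mulr0 (normc (Fh w))); apply: cvgMr; apply/norm_cvg0P/subr_cvg0.
  pose s := \sum_i w i ord0 ^+ 2.
  have h : (fun k : nat => - (pi ^+ 2 / k.+1%:R * s)) @ \oo --> (- (0 * s) : R).
    apply: cvgN; apply: cvgMl.
    by rewrite -(mulr0 (pi ^+ 2)); apply: cvgMr; exact: cvg_harmonic.
  have := continuous_cvg _ (@continuous_expR R _) h; rewrite mul0r oppr0 expR0.
  exact.
- exact: cintegrable_normc.
- move=> k w; have b0 : 0 <= pi ^+ 2 / k.+1%:R :> R by rewrite divr_ge0 ?sqr_ge0.
  rewrite !normcM normc_expi mulr1 normc_real ger0_norm ?egaussN_ge0//.
  by rewrite ler_piMr ?normc_ge0// egaussN_le1.
Qed.

Let box_inversion a c :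
  cintegral mu (fun x => (box_ind a c x)%:C * inv_fourier Fh x) =
  cintegral mu (fun t => F t * (box_ind a c t)%:C).
Proof.
have mB : cmeasurable (fun x : 'cV[R]_n => (box_ind a c x)%:C).
  by split; [exact: measurable_box_ind|exact: measurable_cst].
(* The integral of the Gaussian means over the box has both sides as limits: as it
   stands, and with the kernel moved onto the indicator of the box. *)
pose A k := cintegral mu (fun x => (box_ind a c x)%:C * S k.+1%:R x).
have AE k : A k = cintegral mu (fun t => F t * (mass a c k.+1%:R t)%:C).
  have M0 : 0 < k.+1%:R :> R by [].
  pose f (p : 'cV[R]_n * 'cV[R]_n) : R[i] :=
    (box_ind a c p.1)%:C * (F p.2 * (gauss_kernelN k.+1%:R (p.1 - p.2))%:C).
  have mf : cmeasurable f.
    apply: cmeasurableM; first exact: (cmeasurable_transfer (@measurable_fst _ _ _ _) mB).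
    apply: cmeasurableM; first exact: (cmeasurable_transfer (@measurable_snd _ _ _ _) mF).
    split; last exact: measurable_cst.
    apply: (measurableT_comp (measurable_gauss_kernelN _)).
    apply: measurable_fun_mxP => i j.
    have -> : (fun t : 'cV[R]_n * 'cV[R]_n => (t.1 - t.2) i j) = (fun t => t.1 i j - t.2 i j).
      by apply/funext => t; rewrite !mxE.
    apply: measurable_funB.
      exact: (measurableT_comp (measurable_mxentry i j) measurable_fst).
    exact: (measurableT_comp (measurable_mxentry i j) measurable_snd).
  pose C : R := Num.sqrt (k.+1%:R / pi) ^+ n.
  have C0 : 0 <= C by rewrite exprn_ge0// sqrtr_ge0.
  have If : cintegrable (mu \x mu)%E f.
    apply: (@cintegrable_prod_le _ _ _ _ _ _ _ _ (fun x => C * box_ind a c x) _ mf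
      _ (cintegrable_normc IF)).
    - exact: (integrableZl measurableT C (integrable_box_ind a c)).
    - by move=> w; rewrite mulr_ge0// box_ind_ge0.
    - by move=> t; exact: normc_ge0.
    - move=> w t; rewrite !normcM !normc_real !ger0_norm ?box_ind_ge0//; last first.
        by rewrite gauss_kernelNE mulr_ge0 ?egaussN_ge0.
      rewrite gauss_kernelNE -/C /=.
      have := egaussN_le1 (w - t) (ltW M0); have := egaussN_ge0 k.+1%:R (w - t).
      move: (egaussN _ _) => e e0 e1.
      have : C * e <= C by rewrite ler_piMr.
      have := box_ind_ge0 a c w; have := normc_ge0 (F t).
      move: (normc _) (box_ind _ _ _) => u v u0 v0 Ce.
      rewrite [leRHS](_ : _ = v * (u * C)); last by ring.
      by apply: ler_wpM2l => //; apply: ler_wpM2l.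
  transitivity (cintegral mu (fun x => cintegral mu (fun t => f (x, t)))).
    apply: eq_cintegral => x; rewrite SE// -cintegralZ//.
    apply: (cintegrableM_bounded (C := C) IF _).
      split; last exact: measurable_cst.
      apply: (measurableT_comp (measurable_gauss_kernelN _)).
      apply: measurable_fun_mxP => i j.
      have -> : (fun t : 'cV[R]_n => (x - t) i j) = (fun t => x i j - t i j).
        by apply/funext => t; rewrite !mxE.
      by apply: measurable_funB => //; exact: measurable_mxentry.
    move=> t; rewrite normc_real gauss_kernelNE ger0_norm ?mulr_ge0 ?egaussN_ge0//.
    by rewrite -/C ler_piMr// egaussN_le1// ltW.
  rewrite (cfubini If); apply: eq_cintegral => t.
  rewrite -(cintegral_mass a c t M0) -cintegralZ; last first.
    apply: (cintegrable_le _ (integrableZl measurableT C (integrable_box_ind a c))).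
      apply: cmeasurableM => //; split; last exact: measurable_cst.
      apply: (measurableT_comp (measurable_gauss_kernelN _)).
      exact: measurable_addcV.
    move=> x; rewrite normcM !normc_real gauss_kernelNE !ger0_norm ?mulr_ge0 ?egaussN_ge0 ?box_ind_ge0//.
    rewrite mulrC -/C ler_wpM2r ?box_ind_ge0// ler_piMr// egaussN_le1//.
  by apply: eq_cintegral => x; rewrite /f /= mulrCA.
have c1 : (fun k => normc (A k - cintegral mu (fun x => (box_ind a c x)%:C * inv_fourier Fh x))) @ \oo --> (0 : R).
  apply: (cdominated_convergence (h := fun x => N1 * box_ind a c x)).
  - by move=> k; apply: cmeasurableM => //; exact: mS.
  - by apply: cmeasurableM => //; exact: cmeasurable_inv_fourier.
  - apply: aeW => x.
    have e k : normc ((box_ind a c x)%:C * S k.+1%:R x - (box_ind a c x)%:C * inv_fourier Fh x) =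
       box_ind a c x * normc (S k.+1%:R x - inv_fourier Fh x).
      by rewrite -mulrBr normcM normc_real ger0_norm ?box_ind_ge0.
    under eq_fun do rewrite e.
    by rewrite -(mulr0 (box_ind a c x)); apply: cvgMr; exact: S_cvg.
  - exact: (integrableZl measurableT N1 (integrable_box_ind a c)).
  - move=> k x; rewrite normcM normc_real ger0_norm ?box_ind_ge0// mulrC.
    by apply: ler_wpM2r; [exact: box_ind_ge0|exact: S_le].
have c2 : (fun k => normc (A k - cintegral mu (fun t => F t * (box_ind a c t)%:C))) @ \oo --> (0 : R).
  under eq_fun do rewrite AE.
  apply: (cdominated_convergence (h := fun t => normc (F t))).
  - by move=> k; apply: cmeasurableM => //; exact: cmeasurable_mass.
  - exact: cmeasurableM.
  - have := mass_cvg a c; apply: filterS => t ht.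
    have e k : normc (F t * (mass a c k.+1%:R t)%:C - F t * (box_ind a c t)%:C) =
       normc (F t) * `|mass a c k.+1%:R t - box_ind a c t|.
      by rewrite -mulrBr normcM -normc_real rmorphB.
    under eq_fun do rewrite e.
    rewrite -(mulr0 (normc (F t))); apply: cvgMr.
    by apply/norm_cvg0P/subr_cvg0.
  - exact: cintegrable_normc.
  - move=> k t; rewrite normcM normc_real ger0_norm ?mass_ge0//.
    by rewrite ler_piMr ?normc_ge0// mass_le1.
set X := cintegral _ _ in c1 *; set Y := cintegral _ _ in c2 *.
have : (fun k => normc (A k - X) + normc (A k - Y)) @ \oo --> (0 + 0 : R) by apply: cvgD.
rewrite addr0 => c3; apply/eqP; rewrite -subr_eq0; apply/eqP/eq0_normc/eqP.
rewrite eq_le normc_ge0 andbT.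
rewrite -(cvg_lim _ c3)//; apply: limr_ge; first by apply/cvg_ex; exists 0.
apply: nearW => k; rewrite (normcBC (A k)).
by rewrite -(subrKA (A k) X (- Y)); exact: normcD_le.
Qed.

(** Fourier inversion for integrable functions with integrable transform: the
    Gaussian means of the inversion integral are convolutions of F with an
    approximate identity; both sides have the same integrals over boxes. *)
Theorem fourier_inversion_ae : {ae mu, forall t, F t = inv_fourier Fh t}.
Proof.
have mI := cmeasurable_inv_fourier.
pose D t := F t - inv_fourier Fh t.
have mD : cmeasurable D.
  rewrite (_ : D = F + (fun t => -1 * inv_fourier Fh t)); last first.
    by apply/funext => t; rewrite -[RHS]/(F t + -1 * inv_fourier Fh t) mulN1r.
  by apply: cmeasurableD => //; apply: cmeasurableM => //; exact: cmeasurable_cst.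
have mB a c : cmeasurable (fun x : 'cV[R]_n => (box_ind a c x)%:C).
  by split; [exact: measurable_box_ind|exact: measurable_cst].
have IB a c : cintegrable mu (fun t => F t * (box_ind a c t)%:C).
  apply: (cintegrableM_bounded (C := 1) IF (mB a c)) => t.
  by rewrite normc_real ger0_norm ?box_ind_ge0// box_ind_le1.
have IBi a c : cintegrable mu (fun x => (box_ind a c x)%:C * inv_fourier Fh x).
  apply: (cintegrable_le _ (integrableZl measurableT N1 (integrable_box_ind a c))).
    exact: cmeasurableM.
  move=> x; rewrite normcM normc_real ger0_norm ?box_ind_ge0// mulrC.
  by apply: ler_wpM2r; [exact: box_ind_ge0|exact: normc_inv_fourier_le].
have ID a c : cintegrable mu (fun t => D t * (box_ind a c t)%:C).
  have := cintegrableB (IB a c) (IBi a c); congr (cintegrable mu _).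
  by apply/funext => t; rewrite /D mulrBl; congr (_ - _); rewrite mulrC.
have D0 a c : cintegral mu (fun t => D t * (box_ind a c t)%:C) = 0.
  rewrite -(subrr (cintegral mu (fun t => F t * (box_ind a c t)%:C))) -[X in _ = _ - X]box_inversion.
  rewrite -cintegralB//; apply: eq_cintegral => t.
  by rewrite /D mulrBl; congr (_ - _); rewrite mulrC.
have part (p : R[i] -> R) : measurable_fun setT (fun t => p (D t)) ->
    (forall z (b : R), p (z * b%:C) = p z * b) ->
    (forall a c, mu.-integrable setT (EFin \o (fun t => p (D t * (box_ind a c t)%:C)))) ->
    (forall a c, \int[mu]_t p (D t * (box_ind a c t)%:C) = 0) ->
    {ae mu, forall t, p (D t) = 0}.
  move=> mp pM Ip p0.
  have E a c : (fun t => (p (D t * (box_ind a c t)%:C))%:E) =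
      (EFin \o (fun t => p (D t))) \_ (box a c).
    apply/funext => t; rewrite pM patchE /= /box_ind indicE.
    by case: (t \in _); rewrite ?mulr1 ?mulr0.
  apply: ae_eq0_boxes => // a c.
    apply/integrable_mkcond; first exact: measurable_box.
    by rewrite -E; exact: Ip.
  rewrite integral_mkcond -E -[LHS]fineK; last exact: integrable_fin_num (Ip a c).
  by congr (_%:E); exact: p0.
have ReMr z (b : R) : Re (z * b%:C) = Re z * b by rewrite mulrC Re_realM mulrC.
have ImMr z (b : R) : Im (z * b%:C) = Im z * b by rewrite mulrC Im_realM mulrC.
have r0 := part Re mD.1 ReMr (fun a c => (ID a c).1)
  (fun a c => congr1 (@complex.Re R) (D0 a c)).
have i0 := part Im mD.2 ImMr (fun a c => (ID a c).2)
  (fun a c => congr1 (@complex.Im R) (D0 a c)).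
apply: filterS2 r0 i0 => t hr hi; apply/eqP; rewrite -subr_eq0; apply/eqP.
by apply: complex_eqP; [exact: hr|exact: hi].
Qed.

(** Insert the inversion formula for [F] and exchange the integrals. *)
Lemma parseval (u : 'cV[R]_n -> R[i]) : cintegrable mu u ->
  cintegral mu (fun t => F t * u t) =
  cintegral mu (fun w => fourier F w * inv_fourier u w).
Proof.
move=> Iu; have mu_ := cintegrable_cmeasurable Iu.
pose f (p : 'cV[R]_n * 'cV[R]_n) : R[i] :=
  u p.1 * (Fh p.2 * expi (2 * pi * dotcV p.1 p.2)).
have mf : cmeasurable f.
  apply: cmeasurableM; first exact: (cmeasurable_transfer (@measurable_fst _ _ _ _) mu_).
  apply: cmeasurableM; first exact: (cmeasurable_transfer (@measurable_snd _ _ _ _) mFh).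
  by apply: cmeasurable_phase.
have If : cintegrable (mu \x mu)%E f.
  apply: (cintegrable_prod_le mf (cintegrable_normc Iu) (cintegrable_normc IFh)).
  - by move=> w; exact: normc_ge0.
  - by move=> t; exact: normc_ge0.
  - by move=> w t; rewrite !normcM normc_expi mulr1.
transitivity (cintegral mu (fun t => cintegral mu (fun w => f (t, w)))).
  apply: ae_eq_cintegral.
  - exact: cmeasurableM.
  - exact: cintegrable_cmeasurable (cintegrable_fubini1 If).
  - apply: filterS fourier_inversion_ae => t ->.
    by rewrite mulrC -cintegralZ.
rewrite (cfubini If); apply: eq_cintegral => w.
rewrite -cintegralZ; last first.
  apply: (cintegrableM_bounded (C := 1) Iu _); first by apply: cmeasurable_phase.
  by move=> t; rewrite normc_expi.
apply: eq_cintegral => t; rewrite /f /= mulrCA; congr (_ * (_ * expi (_ * _))).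
by apply: eq_bigr => i _; rewrite mulrC.
Qed.

End inversion.

End fourier_inversion.

(** * Time-frequency shifts and the ambiguity function of the Gaussian *)

Section time_frequency_theory.
Context {R : realType} (d : nat).
Local Notation leb := (@lebesgue_cV R d).
Local Notation L2Rd := (L2 leb).
Implicit Types (f g h : L2Rd) (z w : 'cV[R]_(d + d)).

Let usubmxN z : usubmx (- z) = - usubmx z.
Proof. by apply/matrixP => i j; rewrite !mxE. Qed.

Lemma dotcVDl (x y w : 'cV[R]_d) : dotcV (x + y) w = dotcV x w + dotcV y w.
Proof. by rewrite /dotcV -big_split; apply: eq_bigr => i _; rewrite mxE mulrDl. Qed.

Lemma dotcVDr (x y w : 'cV[R]_d) : dotcV w (x + y) = dotcV w x + dotcV w y.
Proof. by rewrite /dotcV -big_split; apply: eq_bigr => i _; rewrite mxE mulrDr. Qed.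

Lemma dotcVNl (x w : 'cV[R]_d) : dotcV (- x) w = - dotcV x w.
Proof. by rewrite /dotcV -sumrN; apply: eq_bigr => i _; rewrite mxE mulNr. Qed.

Lemma tfE z f : {ae leb, forall t, tf z f t = tf_shift z f t}.
Proof. exact: mkL2E. Qed.

Lemma cmeasurable_tf_shift z f : cmeasurable (tf_shift z f).
Proof. exact: (L2fun_tf_shift z (L2_funP f)).1. Qed.

Lemma cintegral_shift (x : 'cV[R]_d) (F : 'cV[R]_d -> R[i]) : cintegrable leb F ->
  cintegrable leb (fun t => F (t + x)) /\
  cintegral leb (fun t => F (t + x)) = cintegral leb F.
Proof.
move=> IF; have e (A : set 'cV[R]_d) : measurable A ->
    leb A = leb ((fun t => t + x) @^-1` A) by move=> mA; rewrite lebesgue_cV_shift.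
split; last by rewrite (cintegral_transfer (measurable_addcV x) e IF).
exact: (cintegrable_transfer (measurable_addcV x) e (cintegrable_cmeasurable IF)).1 IF.
Qed.

Lemma inner_ae f g (F G : 'cV[R]_d -> R[i]) : cmeasurable F -> cmeasurable G ->
  {ae leb, forall t, f t = F t} -> {ae leb, forall t, g t = G t} ->
  inner f g = cintegral leb (fun t => F t * (G t)^*).
Proof.
move=> mF mG fF gG; rewrite innerE; apply: ae_eq_cintegral.
- exact: cmeasurableM (L2_funP _).1 (cmeasurable_conjc (L2_funP _).1).
- exact: cmeasurableM mF (cmeasurable_conjc mG).
- by apply: filterS2 fF gG => t -> ->.
Qed.

Lemma inner_tf z f h : inner (tf z f) (tf z h) = inner f h.
Proof.
rewrite (inner_ae (cmeasurable_tf_shift z f) (cmeasurable_tf_shift z h) (tfE z f) (tfE z h)).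
rewrite innerE -(cintegral_shift (- usubmx z) (L2fun_mul (L2_funP f) (L2_funP h))).2.
apply: eq_cintegral => t; rewrite /tf_shift conjcM conjc_expi.
rewrite [LHS](_ : _ = expi (- (2 * pi * dotcV t (dsubmx z))) * expi (2 * pi * dotcV t (dsubmx z)) *
  (f (t - usubmx z) * (h (t - usubmx z))^*)); last by ring.
by rewrite expiN_mul mul1r.
Qed.

Lemma L2norm_tf z f : L2norm (tf z f) = L2norm f.
Proof.
apply/eqP; rewrite -(@eqrXn2 _ 2)// ?L2norm_ge0//.
by rewrite !sqr_L2norm_inner inner_tf.
Qed.

(** Time-frequency shifts form a projective representation: exchanging the
translation in [z] with the modulation in [w] costs a phase. *)
Lemma tfM z w f :
  tf z (tf w f) = expi (- (2 * pi * dotcV (usubmx z) (dsubmx w))) *: tf (z + w) f.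
Proof.
apply: L2_eqP.
have h0 : {ae leb, forall t, (0 : L2Rd) t = 0}.
  rewrite -(addNr (0 : L2Rd)) -scaleN1r.
  by apply: filterS (L2_funZD (-1) 0 0) => t ->; rewrite mulN1r addNr.
pose a := expi (- (2 * pi * dotcV (usubmx z) (dsubmx w))).
near=> t.
rewrite -[RHS]/((a *: tf (z + w) f : L2Rd) t) -[a *: _]addr0.
rewrite (near (L2_funZD a (tf (z + w) f) 0) t)// (near h0 t)// addr0.
rewrite (near (tfE z (tf w f)) t)// /tf_shift.
rewrite (near (lebesgue_subcV_ae (usubmx z) (tfE w f)) t)//.
rewrite (near (tfE (z + w) f) t)// /tf_shift !mulrA -!expiD.
rewrite !raddfD /= addrA; congr (expi _ * _).
by rewrite dotcVDr dotcVDl dotcVNl; ring.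
Unshelve. all: by end_near. Qed.

Lemma tf0 f : tf 0 f = f.
Proof.
apply: L2_eqP; apply: filterS (tfE 0 f) => t ->.
rewrite /tf_shift !raddf0 addr0 (_ : dotcV t 0 = 0) ?mulr0 ?expi0 ?mul1r//.
by rewrite /dotcV big1// => i _; rewrite mxE mulr0.
Qed.

Lemma tfD z f g : tf z (f + g) = tf z f + tf z g.
Proof. by have := tf_linear z 1 f g; rewrite !scale1r. Qed.

Lemma tf_0 z : tf z 0 = 0 :> L2Rd.
Proof. by apply: (@addrI _ (tf z 0)); rewrite -tfD !addr0. Qed.

Lemma tfZ z a f : tf z (a *: f) = a *: tf z f.
Proof. by have := tf_linear z a f 0; rewrite tf_0 !addr0. Qed.

Lemma tfB z f g : tf z (f - g) = tf z f - tf z g.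
Proof.
rewrite tfD; congr (_ + _); apply: (@addrI _ (tf z g)).
by rewrite -tfD !addrN tf_0.
Qed.

Lemma tf_sum z (I : Type) (s : seq I) (F : I -> L2Rd) :
  tf z (\sum_(i <- s) F i) = \sum_(i <- s) tf z (F i).
Proof. by elim/big_rec2: _ => [|i y x _ <-]; rewrite ?tf_0 ?tfD. Qed.

Lemma inner_tfl z f h :
  inner (tf z f) h = expi (2 * pi * dotcV (usubmx z) (dsubmx z)) * inner f (tf (- z) h).
Proof.
rewrite -(inner_tf (- z) (tf z f) h) tfM addNr tf0 innerZl usubmxN.
by rewrite dotcVNl mulrN opprK.
Qed.

Definition tf_phase z w : R :=
  2 * pi * dotcV (usubmx z) (dsubmx z) - 2 * pi * dotcV (usubmx z) (dsubmx w).

Lemma inner_tf_tf z w f h :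
  inner (tf z f) (tf w h) = expi (tf_phase z w) * inner f (tf (w - z) h).
Proof.
rewrite inner_tfl tfM innerZr mulrA addrC; congr (_ * _).
rewrite conjc_expi -expiD /tf_phase usubmxN dotcVNl; congr expi.
by ring.
Qed.

Lemma normc_inner_tf_tf z w f h :
  normc (inner (tf z f) (tf w h)) = normc (inner f (tf (w - z) h)).
Proof. by rewrite inner_tf_tf normcM normc_expi mul1r. Qed.

End time_frequency_theory.

Section gaussian_stft.
Context {R : realType} (d : nat).
Local Notation leb := (@lebesgue_cV R d).
Local Notation L2Rd := (L2 leb).
Implicit Types (f g h : L2Rd) (z w : 'cV[R]_(d + d)).
Local Notation phi := (gaussian d : L2Rd).

Lemma gaussianE : {ae leb, forall t, phi t = (egaussN pi t)%:C}.
Proof. exact: mkL2E. Qed.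

Lemma cmeasurable_egaussN n b : cmeasurable (fun t : 'cV[R]_n => (egaussN b t)%:C).
Proof. by split; [exact: measurable_egaussN|exact: measurable_cst]. Qed.

Lemma stft_gaussianE h z : stft phi h z =
  cintegral leb (fun t => h t * (egaussN pi (t - usubmx z))%:C *
    expi (- (2 * pi * dotcV t (dsubmx z)))).
Proof.
have mF : cmeasurable (fun t => expi (2 * pi * dotcV t (dsubmx z)) * (egaussN pi (t - usubmx z))%:C).
  apply: cmeasurableM; first exact: cmeasurable_modulation.
  exact: (cmeasurable_transfer (measurable_subcV _) (@cmeasurable_egaussN d pi)).
rewrite /stft (inner_ae (L2_funP h).1 mF (aeW _ (fun=> erefl)) _).
  apply: eq_cintegral => t; rewrite conjcM conjc_expi conjc_realC -!mulrA.
  by congr (_ * _); rewrite mulrC.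
apply: filterS2 (tfE z phi) (lebesgue_subcV_ae (usubmx z) gaussianE) => t -> E.
by rewrite /tf_shift E.
Qed.

Lemma cmeasurable_stft h : cmeasurable (stft phi h).
Proof.
rewrite (_ : stft phi h = fun z => cintegral leb (fun t => h t * (egaussN pi (t - usubmx z))%:C *
    expi (- (2 * pi * dotcV t (dsubmx z))))); last first.
  by apply/funext => z; exact: stft_gaussianE.
apply: (@cmeasurable_param _ _ _ _ _ _ (fun p : 'cV[R]_(d + d) * 'cV[R]_d =>
  h p.2 * (egaussN pi (p.2 - usubmx p.1))%:C * expi (- (2 * pi * dotcV p.2 (dsubmx p.1))))).
have m1 : measurable_fun setT (fun p : 'cV[R]_(d + d) * 'cV[R]_d => usubmx p.1).
  apply: measurable_fun_mxP => i j; under eq_fun do rewrite mxE.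
  exact: (measurableT_comp (measurable_mxentry _ j) measurable_fst).
have m2 : measurable_fun setT (fun p : 'cV[R]_(d + d) * 'cV[R]_d => dsubmx p.1).
  apply: measurable_fun_mxP => i j; under eq_fun do rewrite mxE.
  exact: (measurableT_comp (measurable_mxentry _ j) measurable_fst).
apply: cmeasurableM.
  apply: cmeasurableM; first exact: (cmeasurable_transfer measurable_snd (L2_funP h).1).
  apply: (cmeasurable_transfer _ (@cmeasurable_egaussN d pi)).
  apply: measurable_fun_mxP => i j.
  have -> : (fun p : 'cV[R]_(d + d) * 'cV[R]_d => (p.2 - usubmx p.1) i j) =
      (fun p => p.2 i j - (usubmx p.1) i j) by apply/funext => p; rewrite !mxE.
  apply: measurable_funB; first exact: (measurableT_comp (measurable_mxentry i j) measurable_snd).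
  exact: (measurableT_comp (measurable_mxentry i j) m1).
have -> : (fun p : 'cV[R]_(d + d) * 'cV[R]_d => expi (- (2 * pi * dotcV p.2 (dsubmx p.1)))) =
   (fun p => expi ((- (2 * pi)) * dotcV p.2 (dsubmx p.1))).
  by apply/funext => p; rewrite mulNr.
exact: cmeasurable_phase.
Qed.

Lemma normc_stft_le h z : normc (stft phi h z) <= L2norm h * L2norm phi.
Proof. by rewrite -(L2norm_tf z phi); exact: cauchy_schwarz. Qed.

(** The squared L^2 norm 2^(-d/2) of the Gaussian. *)
Definition ambig_const : R := Num.sqrt (pi / (2 * pi)) ^+ d.

Lemma ambig_const_gt0 : 0 < ambig_const.
Proof. by rewrite exprn_gt0// sqrtr_gt0 divr_gt0 ?mulr_gt0// pi_gt0. Qed.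

(** The ambiguity function of the Gaussian, by completing the square. *)
Lemma stft_gaussian_gaussian z : stft phi phi z =
  expi (- (pi * dotcV (usubmx z) (dsubmx z))) *
  (ambig_const * expR (- (pi / 2 * \sum_i z i ord0 ^+ 2)))%:C.
Proof.
set x := usubmx z; set w := dsubmx z.
have p0 := pi_gt0 R; have p20 : 0 < 2 * pi :> R by rewrite mulr_gt0.
have [I1 E1] := cintegral_egaussN ((- (2 * pi)) *: w) p20.
pose K : R := expR (- (pi / 2 * \sum_i x i ord0 ^+ 2)).
pose F (t : 'cV[R]_d) : R[i] := expi (- (pi * dotcV x w)) * K%:C *
   (expi (dotcV ((- (2 * pi)) *: w) t) * (egaussN (2 * pi) t)%:C).
have IF : cintegrable leb F by exact: cintegrableZ.
rewrite stft_gaussianE; transitivity (cintegral leb (fun t => F (t + (- (2^-1 *: x))))).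
  apply: ae_eq_cintegral.
  - apply: cmeasurableM; last first.
      under eq_fun do rewrite -mulNr.
      exact: (@cmeasurable_phase _ _ _ _ (- (2 * pi)) id (fun=> w)).
    apply: cmeasurableM; first exact: (L2_funP phi).1.
    exact: (cmeasurable_transfer (measurable_subcV x) (@cmeasurable_egaussN d pi)).
  - exact: cintegrable_cmeasurable (cintegral_shift _ IF).1.
  - apply: filterS gaussianE => t ->; rewrite /F -rmorphM /=.
    have -> : egaussN pi t * egaussN pi (t - x) = K * egaussN (2 * pi) (t - 2^-1 *: x).
      rewrite /K /egaussN -!expRD; congr expR; rewrite !mulr_sumr -!sumrN -!big_split /=.
      apply: eq_bigr => i _; rewrite !mxE; move: (pi : R) (t i ord0) (x i ord0) => P a b.
      by field.
    have -> : expi (- (2 * pi * dotcV t w)) = expi (- (pi * dotcV x w)) *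
        expi (dotcV ((- (2 * pi)) *: w) (t - 2^-1 *: x)).
      rewrite -expiD; congr expi; rewrite /dotcV !mulr_sumr -!sumrN -!big_split /=.
      apply: eq_bigr => i _; rewrite !mxE; move: (pi : R) (t i ord0) (x i ord0) (w i ord0) => P a b e.
      by field.
    by rewrite rmorphM /=; ring.
rewrite (cintegral_shift _ IF).2 /F cintegralZ// E1 -!mulrA -rmorphM; congr (_ * _%:C).
rewrite mulrCA; congr (_ * _); rewrite /K -expRD; congr expR.
have -> : \sum_i z i ord0 ^+ 2 = \sum_i x i ord0 ^+ 2 + \sum_i w i ord0 ^+ 2.
  by rewrite big_split_ord; congr (_ + _); apply: eq_bigr => i _; rewrite mxE.
have E (P a b : R) : - (P * (2^-1 * (a + b))) = - (P / 2 * a) + - (P / 2 * b) by field.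
rewrite E; congr (_ + _).
congr (- _); rewrite !mulr_suml mulr_sumr; apply: eq_bigr => i _; rewrite /w !mxE.
by have := pi_gt0 R; move: (pi : R) => P P0; field; rewrite gt_eqF.
Qed.

End gaussian_stft.

(** * Moyal's formula *)

Section moyal.
Context {R : realType} (d : nat).
Local Notation leb := (@lebesgue_cV R d).
Local Notation leb2 := (@lebesgue_cV R (d + d)).
Local Notation L2Rd := (L2 leb).
Implicit Types (f g h : L2Rd) (z w : 'cV[R]_(d + d)).
Local Notation phi := (gaussian d : L2Rd).

Lemma weight_ge1 z : 1 <= weight z.
Proof. by rewrite /weight lerDl sumr_ge0. Qed.

Lemma weight_ge0 z : 0 <= weight z.
Proof. exact: le_trans ler01 (weight_ge1 z). Qed.

Lemma weightM z w : weight (z + w) <= weight z * weight w.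
Proof.
rewrite /weight; set a := \sum_i `|z i ord0|; set b := \sum_i `|w i ord0|.
have a0 : 0 <= a by exact: sumr_ge0.
have b0 : 0 <= b by exact: sumr_ge0.
have : \sum_i `|(z + w) i ord0| <= a + b.
  by rewrite -big_split; apply: ler_sum => i _; rewrite mxE ler_normD.
have : 0 <= a * b by exact: mulr_ge0.
lra.
Qed.

Lemma weightN z : weight (- z) = weight z.
Proof. by congr (1 + _); apply: eq_bigr => i _; rewrite mxE normrN. Qed.

Lemma M1_cintegrable g : M1 g -> cintegrable leb2 (stft phi g).
Proof.
move=> /cintegrable_normc Ig; apply: (cintegrable_le (cmeasurable_stft g) Ig) => z.
rewrite normcM normc_real ger0_norm ?weight_ge0//.
by rewrite ler_peMr ?normc_ge0// weight_ge1.
Qed.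

(** The norm of M^1 for the Gaussian window. *)
Definition M1_mass g : R := \int[leb2]_z (weight z * normc (stft phi g z)).

Lemma M1_integrable g : M1 g ->
  leb2.-integrable setT (EFin \o (fun z => weight z * normc (stft phi g z))).
Proof.
move=> /cintegrable_normc; congr (leb2.-integrable _ (EFin \o _)).
by apply/funext => z; rewrite normcM normc_real ger0_norm ?weight_ge0// mulrC.
Qed.

Lemma M1_mass_ge0 g : 0 <= M1_mass g.
Proof.
by apply: Rintegral_ge0 => z _; rewrite mulr_ge0 ?weight_ge0 ?normc_ge0.
Qed.

Let Igauss (x : 'cV[R]_d) : cintegrable leb (fun t => (egaussN pi (t - x))%:C).
Proof.
exact: (cintegral_shift (- x) (cintegrable_real (integrable_egaussN d (pi_gt0 R)))).1.
Qed.

Let L2gauss (x : 'cV[R]_d) : L2fun leb (fun t => (egaussN pi (t - x))%:C).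
Proof.
have p0 := pi_ge0 R.
apply: (L2fun_le (cintegrable_cmeasurable (Igauss x)) (cintegrable_normc (Igauss x))) => t.
rewrite normc_real ger0_norm ?egaussN_ge0// expr2 ler_piMr ?egaussN_ge0//.
exact: egaussN_le1.
Qed.

Let slice g (x t : 'cV[R]_d) : R[i] := g t * (egaussN pi (t - x))%:C.

Let Islice g x : cintegrable leb (slice g x).
Proof.
have : cintegrable leb (fun t => g t * ((egaussN pi (t - x))%:C)^*).
  exact: L2fun_mul (L2_funP g) (L2gauss x).
congr (cintegrable leb _).
by apply/funext => t; rewrite conjc_realC.
Qed.

Let fourier_slice g x (w : 'cV[R]_d) : fourier (slice g x) w = stft phi g (col_mx x w).
Proof. by rewrite stft_gaussianE col_mxKu col_mxKd. Qed.

Let slicec h (x t : 'cV[R]_d) : R[i] := (h t)^* * (egaussN pi (t - x))%:C.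

Let slicecE h x t : slicec h x t = (slice h x t)^*.
Proof. by rewrite /slicec /slice conjcM conjc_realC. Qed.

Let Islicec h x : cintegrable leb (slicec h x).
Proof.
have := cintegrable_conjc (Islice h x); congr (cintegrable leb _).
by apply/funext => t; rewrite slicecE.
Qed.

Let inv_fourier_slicec h x (w : 'cV[R]_d) : inv_fourier (slicec h x) w = (stft phi h (col_mx x w))^*.
Proof.
rewrite -fourier_slice /fourier -cintegral_conjc.
  apply: eq_cintegral => t; rewrite slicecE [in RHS]conjcM conjc_expi opprK.
  by congr (_ * expi (_ * _)); apply: eq_bigr => i _; rewrite mulrC.
apply: (cintegrableM_bounded (C := 1) (Islice h x)); last by move=> t; rewrite normc_expi.
under eq_fun do rewrite -mulNr.
exact: (@cmeasurable_phase _ _ _ _ (- (2 * pi)) id (fun=> w)).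
Qed.

Let colp_leb (A : set 'cV[R]_(d + d)) : measurable A ->
  leb2 A = (leb \x leb)%E (@colp R d d @^-1` A).
Proof. exact: lebesgue_cVD. Qed.

(** At a fixed time x the transform is the Fourier transform of g phi(. - x), so that
Parseval's formula applies to almost every such slice; what remains is the integral in x
of the squared window. *)
Lemma moyal g h : M1 g ->
  cintegral leb2 (fun z => stft phi g z * (stft phi h z)^*) =
  (ambig_const d)%:C * inner g h.
Proof.
move=> Mg; have IG := M1_cintegrable Mg.
have mG := cmeasurable_stft g; have mH := cmeasurable_stft h.
have IGH : cintegrable leb2 (fun z => stft phi g z * (stft phi h z)^*).
  apply: (cintegrableM_bounded (C := L2norm h * L2norm phi) IG (cmeasurable_conjc mH)).
  by move=> z; rewrite normc_conjc; exact: normc_stft_le.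
rewrite (cintegral_transfer (@measurable_colp R d d) colp_leb IGH).
have IG' := (cintegrable_transfer (@measurable_colp R d d) colp_leb mG).1 IG.
have IGH' := (cintegrable_transfer (@measurable_colp R d d) colp_leb
  (cintegrable_cmeasurable IGH)).1 IGH.
rewrite -(cfubini1 IGH').
(* The integrand in (x, t) after Parseval's formula in the frequency: the product of
   the two windows is a Gaussian in x - t, with the same integral in x for all t. *)
pose f (p : 'cV[R]_d * 'cV[R]_d) : R[i] :=
  (g p.2 * (h p.2)^*) * (egaussN (2 * pi) (p.1 - p.2))%:C.
have mgh : cmeasurable (fun t => g t * (h t)^*).
  exact: cmeasurableM (L2_funP g).1 (cmeasurable_conjc (L2_funP h).1).
have mf : cmeasurable f.
  apply: cmeasurableM; first exact: (cmeasurable_transfer measurable_snd mgh).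
  apply: (cmeasurable_transfer _ (@cmeasurable_egaussN R d (2 * pi))).
  apply: measurable_fun_mxP => i j.
  have -> : (fun p : 'cV[R]_d * 'cV[R]_d => (p.1 - p.2) i j) =
      (fun p => p.1 i j - p.2 i j) by apply/funext => p; rewrite !mxE.
  apply: measurable_funB; first exact: (measurableT_comp (measurable_mxentry i j) measurable_fst).
  exact: (measurableT_comp (measurable_mxentry i j) measurable_snd).
have p20 : 0 < 2 * pi :> R by rewrite mulr_gt0 ?pi_gt0.
have Ishift (t : 'cV[R]_d) : cintegrable leb (fun x => (egaussN (2 * pi) (x - t))%:C) /\
    cintegral leb (fun x => (egaussN (2 * pi) (x - t))%:C) = (ambig_const d)%:C.
  have Ie := cintegrable_real (@integrable_egaussN R d _ p20).
  have [I1 E1] := cintegral_shift (- t) Ie; split => //; rewrite E1.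
  have [_ E2] := @cintegral_egaussN R d _ 0 p20.
  have z0 v : dotcV (0 : 'cV[R]_d) v = 0 by rewrite /dotcV big1// => i _; rewrite mxE mul0r.
  transitivity (cintegral leb (fun v => expi (dotcV (0 : 'cV[R]_d) v) * (egaussN (2 * pi) v)%:C)).
    by apply: eq_cintegral => v; rewrite z0 expi0 mul1r.
  rewrite E2 big1 ?mul0r ?oppr0 ?expR0 ?mulr1// => i _.
  by rewrite mxE expr0n.
have If : cintegrable (leb \x leb)%E f.
  apply: cintegrable_prodP' => //.
  have Igh := L2fun_mul (L2_funP g) (L2_funP h).
  rewrite (eq_integral (fun t => (ambig_const d)%:E * (normc (g t * (h t)^*))%:E)%E); last first.
    move=> t _; have [I1 /(congr1 (@complex.Re R)) /= E1] := Ishift t.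
    rewrite (eq_integral (fun x : 'cV[R]_d => (normc (g t * (h t)^*))%:E *
        (egaussN (2 * pi) (x - t))%:E)%E); last first.
      by move=> x _; rewrite /f normcM normc_real ger0_norm ?egaussN_ge0// EFinM.
    rewrite ge0_integralZl_EFin ?normc_ge0//; last 2 first.
    - by move=> x _; rewrite lee_fin egaussN_ge0.
    - exact: measurable_int I1.1.
    rewrite muleC; congr (_ * _)%E; rewrite -E1 /Rintegral fineK//.
    exact: integrable_fin_num I1.1.
  have c0 : 0 <= ambig_const d :> R by rewrite ltW// ambig_const_gt0.
  rewrite ge0_integralZl_EFin//; last 2 first.
  - by move=> t _; rewrite lee_fin normc_ge0.
  - by apply/measurable_EFinP; exact: measurable_normc.
  apply: lte_mul_pinfty => //.
  exact: (integrable_lty measurableT (cintegrable_normc Igh)).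
transitivity (cintegral leb (fun x => cintegral leb (fun t => f (x, t)))).
  apply: ae_eq_cintegral.
  - exact: cintegrable_cmeasurable (cintegrable_fubini1 IGH').
  - exact: cintegrable_cmeasurable (cintegrable_fubini1 If).
  - apply: filterS (ae_cintegrable1 IG') => x Ix.
    have Iw : cintegrable leb (fourier (slice g x)).
      by move: Ix; congr (cintegrable leb _); apply/funext => v; rewrite fourier_slice.
    transitivity (cintegral leb (fun v => fourier (slice g x) v * inv_fourier (slicec h x) v)).
      by apply: eq_cintegral => v; rewrite fourier_slice inv_fourier_slicec.
    rewrite -(parseval (Islice g x) Iw (Islicec h x)); apply: eq_cintegral => t.
    rewrite /slice /slicec /f /=.
    have -> : egaussN (2 * pi) (x - t) = egaussN pi (t - x) * egaussN pi (t - x) :> R.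
      rewrite /egaussN -expRD; congr expR; rewrite !mulr_sumr -!sumrN -big_split /=.
      by apply: eq_bigr => i _; rewrite !mxE; ring.
    by rewrite rmorphM /=; ring.
rewrite (cfubini If) innerE -cintegralZ; last exact: L2fun_mul (L2_funP g) (L2_funP h).
apply: eq_cintegral => t; have [I1 E1] := Ishift t.
by rewrite -E1 mulrC -cintegralZ.
Qed.

(** Transfers estimates from the shifts of the Gaussian to [g]. *)
Lemma moyal_le g h : M1 g ->
  ambig_const d * normc (inner g h) <=
  \int[leb2]_z (normc (stft phi g z) * normc (stft phi h z)).
Proof.
move=> Mg; have := congr1 (@normc R) (moyal h Mg).
rewrite normcM normc_real gtr0_norm ?ambig_const_gt0// => <-.
have IGH : cintegrable leb2 (fun z => stft phi g z * (stft phi h z)^*).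
  apply: (cintegrableM_bounded (C := L2norm h * L2norm phi) (M1_cintegrable Mg)).
    exact: cmeasurable_conjc (cmeasurable_stft h).
  by move=> z; rewrite normc_conjc; exact: normc_stft_le.
apply: le_trans (normc_cintegral_le IGH) _.
by under eq_Rintegral do rewrite normcM normc_conjc.
Qed.

End moyal.

(** * Exponential sums over lattices *)

Section lattice_sums.
Context {R : realType}.

Definition norm1 n (v : 'cV[R]_n) : R := \sum_i `|v i ord0|.

Lemma norm1_ge0 n (v : 'cV[R]_n) : 0 <= norm1 v.
Proof. exact: sumr_ge0. Qed.

Lemma norm1D n (v w : 'cV[R]_n) : norm1 (v + w) <= norm1 v + norm1 w.
Proof.
by rewrite /norm1 -big_split; apply: ler_sum => i _; rewrite mxE ler_normD.
Qed.

Lemma entry_le_norm1 n (v : 'cV[R]_n) i : `|v i ord0| <= norm1 v.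
Proof. by rewrite /norm1 (bigD1 i)//= lerDl sumr_ge0. Qed.

Lemma norm1_mulmx n (A : 'M[R]_n) (v : 'cV[R]_n) :
  norm1 (A *m v) <= (\sum_i \sum_j `|A i j|) * norm1 v.
Proof.
rewrite /norm1 mulr_suml; apply: ler_sum => i _.
rewrite mxE; apply: le_trans (ler_norm_sum _ _ _) _; rewrite mulr_suml.
apply: ler_sum => j _; rewrite normrM; apply: ler_wpM2l => //.
exact: entry_le_norm1.
Qed.

(** Write L0 v = L v + (L0 - L) v and bound v by L0 v through the inverse of L0: when
L is close enough to L0, half of v is absorbed. *)
Lemma coercive_near n (L0 : 'M[R]_n) : L0 \in unitmx ->
  exists r kappa : R, [/\ 0 < r, 0 < kappa &
    forall L : 'M[R]_n, (forall i j, `|L i j - L0 i j| <= r) ->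
    forall v, norm1 v <= kappa * norm1 (L *m v)].
Proof.
move=> uL; pose k0 : R := 1 + \sum_i \sum_j `|(invmx L0) i j|.
have s0 : 0 <= \sum_i \sum_j `|(invmx L0) i j|.
  by apply: sumr_ge0 => i _; exact: sumr_ge0.
have k00 : 0 < k0 by rewrite /k0; lra.
pose N : R := n%:R * n%:R + 1.
have N0 : 0 < N by rewrite /N ltr_wpDl// mulr_ge0.
exists ((2 * k0 * N)^-1), (2 * k0); split.
- by rewrite invr_gt0 !mulr_gt0.
- by rewrite mulr_gt0.
move=> L Lr v.
have h1 : norm1 v <= k0 * norm1 (L0 *m v).
  rewrite -{1}[v]mul1mx -(mulVmx uL) -mulmxA.
  apply: le_trans (norm1_mulmx _ _) _; apply: ler_wpM2r; first exact: norm1_ge0.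
  by rewrite /k0 lerDr.
have h2 : norm1 ((L0 - L) *m v) <= (2 * k0)^-1 * norm1 v.
  apply: le_trans (norm1_mulmx _ _) _; apply: ler_wpM2r; first exact: norm1_ge0.
  apply: (@le_trans _ _ (\sum_(i < n) \sum_(j < n) (2 * k0 * N)^-1)).
    by apply: ler_sum => i _; apply: ler_sum => j _; rewrite !mxE distrC.
  have sc (c : R) : \sum_(i < n) \sum_(j < n) c = n%:R * n%:R * c.
    by rewrite !sumr_const !card_ord -[in LHS]mulr_natl -[X in _ * X]mulr_natl mulrA.
  rewrite sc [(2 * k0 * N)^-1]invfM mulrCA ler_piMr ?invr_ge0 ?mulr_ge0 ?(ltW k00)//.
  by rewrite ler_pdivrMr// mul1r /N lerDl.
have h3 : norm1 (L0 *m v) <= norm1 (L *m v) + (2 * k0)^-1 * norm1 v.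
  have -> : L0 *m v = L *m v + (L0 - L) *m v by rewrite mulmxBl addrC subrK.
  by apply: le_trans (norm1D _ _) _; rewrite lerD2l.
have := le_trans h1 (ler_wpM2l (ltW k00) h3).
rewrite mulrDr; have -> : k0 * ((2 * k0)^-1 * norm1 v) = norm1 v / 2.
  by field; rewrite gt_eqF.
lra.
Qed.

Lemma geometric_sum_le (q : R) B : 0 <= q -> q < 1 -> \sum_(j < B) q ^+ j <= (1 - q)^-1.
Proof.
move=> q0 q1; have h : 0 < 1 - q by lra.
rewrite -[leRHS]mul1r ler_pdivlMr//.
suff : (\sum_(j < B) q ^+ j) * (1 - q) = 1 - q ^+ B.
  by move=> ->; rewrite gerBl exprn_ge0.
elim: B => [|B IHB]; first by rewrite big_ord0 mul0r expr0 subrr.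
rewrite big_ord_recr /= mulrDl IHB exprS; ring.
Qed.

(** An upper bound of the two-sided geometric series, twice the one-sided one. *)
Definition geo2 (q : R) : R := 2 / (1 - q).

Lemma geometric_sum2_le (q : R) B : 0 <= q -> q < 1 ->
  \sum_(j < (B + B).+1) q ^+ (`|j%:Z - B%:Z|)%N <= geo2 q.
Proof.
move=> q0 q1; rewrite -addnS big_split_ord /geo2 mulr2n mulrDl !mul1r /=.
apply: lerD; last first.
  rewrite (eq_bigr (fun j : 'I_B.+1 => q ^+ j)); first exact: geometric_sum_le.
  by move=> j _; rewrite PoszD addrAC subrr add0r.
apply: le_trans (geometric_sum_le B q0 q1).
rewrite (reindex_inj rev_ord_inj) /=; apply: ler_sum => j _.
have -> : `|(B - j.+1)%N%:Z - B%:Z|%N = j.+1.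
  by rewrite -subzn// addrAC subrr add0r abszN.
by rewrite exprS ler_piMl ?exprn_ge0// ltW.
Qed.

(** The finite set lies in a cube, over which the sum is a product of sums in one
variable. *)
Lemma lattice_geometric_sum n (q : R) (p : 'cV[int]_n) (K : seq 'cV[int]_n) :
  0 <= q -> q < 1 -> uniq K ->
  \sum_(m <- K) \prod_i q ^+ (`|m i ord0 - p i ord0|)%N <= geo2 q ^+ n.
Proof.
move=> q0 q1 uK.
pose B := \max_(m <- K) \max_i `|m i ord0 - p i ord0|%N.
have KB m i : m \in K -> (`|m i ord0 - p i ord0| <= B)%N.
  move=> mK; apply: leq_trans (leq_bigmax_seq _ mK _) => //.
  exact: (leq_bigmax i).
pose T := {ffun 'I_n -> 'I_(B + B).+1}.
pose dec (m : 'cV[int]_n) : T := [ffun i => inord (absz (m i ord0 - p i ord0 + B%:Z))].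
have decE m i : m \in K -> (dec m i : nat)%:Z = m i ord0 - p i ord0 + B%:Z.
  move=> /(KB _ i); rewrite ffunE; move: (_ - _) => x xB.
  rewrite inordK; lia.
pose F (f : T) := \prod_i q ^+ (`|(f i : nat)%:Z - B%:Z|)%N.
have F0 f : 0 <= F f by apply: prodr_ge0 => i _; exact: exprn_ge0.
rewrite (eq_big_seq (F \o dec)); last first.
  move=> m mK; apply: eq_bigr => i _; rewrite decE//.
  by rewrite addrK.
rewrite -(big_map dec predT F) big_uniq; last first.
  rewrite map_inj_in_uniq// => m m' mK m'K E; apply/colP => i.
  have := congr1 (fun f : T => (f i : nat)%:Z) E; rewrite !decE//.
  by move=> /addIr/addIr.
apply: (@le_trans _ _ (\sum_(f : T) F f)).
  rewrite [leRHS](bigID (mem (map dec K))) /= lerDl; exact: sumr_ge0.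
rewrite -(bigA_distr_bigA (fun _ (j : 'I_(B + B).+1) => q ^+ (`|j%:Z - B%:Z|)%N)).
rewrite -[in leRHS](card_ord n) -prodr_const; apply: ler_prod => i _.
by rewrite sumr_ge0 ?geometric_sum2_le// => j _; exact: exprn_ge0.
Qed.

Definition lattice_const n (b : R) : R := (expR b * geo2 (expR (- b))) ^+ n.

(** Rounding [x] to an integer point costs a factor [expR b] for each coordinate; the
bound is therefore uniform in [x]. *)
Lemma integer_exp_sum n (b : R) (x : 'cV[R]_n) (K : seq 'cV[int]_n) : 0 < b -> uniq K ->
  \sum_(m <- K) expR (- (b * norm1 (x - map_mx intr m))) <= lattice_const n b.
Proof.
move=> b0 uK; pose q := expR (- b).
have q0 : 0 <= q by exact: expR_ge0.
have q1 : q < 1 by rewrite /q -[ltRHS]expR0 ltr_expR oppr_lt0.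
pose p : 'cV[int]_n := \col_i Num.floor (x i ord0).
rewrite /lattice_const exprMn.
apply: le_trans (ler_wpM2l _ (lattice_geometric_sum p q0 q1 uK)); last first.
  by rewrite exprn_ge0 ?expR_ge0.
rewrite mulr_sumr; apply: ler_sum => m _.
have -> : expR b ^+ n = \prod_(i < n) expR b by rewrite prodr_const card_ord.
rewrite /norm1 mulr_sumr -sumrN expR_sum -big_split /=.
apply: ler_prod => i _; rewrite expR_ge0 /=.
rewrite /q -expRM_natl -expRD ler_expR !mxE.
set xi := x i ord0; set mi := m i ord0.
have h : (`|mi - Num.floor xi|%N)%:R <= `|xi - mi%:~R| + 1 :> R.
  rewrite natr_absz intr_norm rmorphB /=.
  have /andP[f1 f2] := real_floor_itv (num_real xi); rewrite rmorphD /= in f2.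
  rewrite -(subrKA xi); apply: le_trans (ler_normD _ _) _; rewrite distrC lerD2l.
  by rewrite ger0_norm ?subr_ge0//; lra.
have := ler_wpM2l (ltW b0) h; rewrite mulrDr mulr1 mulrN; lra.
Qed.

Lemma lattice_exp_sum n (kappa : R) (L : 'M[R]_n) (y : 'cV[R]_n) (K : seq 'cV[int]_n) :
  0 < kappa -> L \in unitmx -> (forall v, norm1 v <= kappa * norm1 (L *m v)) -> uniq K ->
  \sum_(m <- K) expR (- norm1 (y - L *m map_mx intr m)) <= lattice_const n kappa^-1.
Proof.
move=> k0 uL cL uK.
have := @integer_exp_sum n kappa^-1 (invmx L *m y) K; rewrite invr_gt0 => /(_ k0 uK).
apply: le_trans; apply: ler_sum => m _; rewrite ler_expR lerN2.
rewrite mulrC ler_pdivrMr// mulrC; apply: le_trans (cL _) _.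
by rewrite mulmxBr mulmxA mulmxV// mul1mx.
Qed.

End lattice_sums.

(** * Decay and regularity of functions in M^1 *)

Section M1_estimates.
Context {R : realType} (d : nat).
Local Notation leb := (@lebesgue_cV R d).
Local Notation leb2 := (@lebesgue_cV R (d + d)).
Local Notation L2Rd := (L2 leb).
Implicit Types (f g h : L2Rd) (z w : 'cV[R]_(d + d)).
Local Notation phi := (gaussian d : L2Rd).
Local Notation c0 := (@ambig_const R d).

Let c0_gt0 : 0 < c0. Proof. exact: ambig_const_gt0. Qed.

Lemma weightE z : weight z = 1 + norm1 z. Proof. by []. Qed.

Definition decay_const : R := c0 * expR (d + d)%:R.

(** The weight is below the exponential of [norm1 z], and the Gaussian decays faster
than any exponential. *)
Lemma weight_ambiguity_le z :
  weight z * normc (stft phi phi z) <= decay_const * expR (- norm1 z).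
Proof.
rewrite stft_gaussian_gaussian normcM normc_expi mul1r normc_real.
rewrite ger0_norm ?mulr_ge0 ?expR_ge0 ?(ltW c0_gt0)// /decay_const.
rewrite mulrCA -!mulrA; apply: ler_wpM2l; first exact: ltW.
rewrite weightE; apply: le_trans (ler_wpM2r (expR_ge0 _) (expR_ge1Dx _)) _.
rewrite -!expRD ler_expR.
suff : 2 * norm1 z <= (d + d)%:R + pi / 2 * \sum_i z i ord0 ^+ 2 by lra.
have -> : (d + d)%:R = \sum_(i < d + d) 1 :> R by rewrite sumr_const card_ord.
rewrite /norm1 !mulr_sumr -big_split /=.
apply: ler_sum => i _; rewrite -[z i ord0 ^+ 2]real_normK ?num_real//.
have := pi_ge2 R; move: (pi : R) `|z i ord0| (normr_ge0 (z i ord0)) => P x x0 P2.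
have := sqr_ge0 (1 - x); nra.
Qed.

Lemma sum_Rintegral_le (I : eqType) (K : seq I) (F : I -> 'cV[R]_(d + d) -> R)
    (H : 'cV[R]_(d + d) -> R) :
  (forall m, leb2.-integrable setT (EFin \o F m)) ->
  leb2.-integrable setT (EFin \o H) ->
  (forall z, \sum_(m <- K) F m z <= H z) ->
  \sum_(m <- K) \int[leb2]_z F m z <= \int[leb2]_z H z.
Proof.
move=> IF IH FH.
have [IS ES] : leb2.-integrable setT (EFin \o (fun z => \sum_(m <- K) F m z)) /\
    \int[leb2]_z (\sum_(m <- K) F m z) = \sum_(m <- K) \int[leb2]_z F m z.
  elim: K {FH} => [|m K [IHi IHe]].
    split; last by rewrite big_nil /Rintegral integral0_eq// => z _; rewrite big_nil.
    rewrite (_ : _ \o _ = cst 0%E); first exact: integrable0.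
    by apply/funext => z /=; rewrite big_nil.
  have E : (fun z => \sum_(k <- m :: K) F k z) = (fun z => F m z + \sum_(k <- K) F k z).
    by apply/funext => z; rewrite big_cons.
  rewrite E big_cons -IHe -RintegralD//; split => //.
  exact: (integrableD measurableT (IF m) IHi).
by rewrite -ES; apply: le_Rintegral.
Qed.

Section decay.
Variable g : L2Rd.
Hypothesis Mg : M1 g.
Local Notation G := (stft phi g).
Local Notation A := (M1_mass g).

Let A0 : 0 <= A. Proof. exact: M1_mass_ge0. Qed.

Let IA := M1_integrable Mg.

Let stft_tf h z w : normc (stft phi (tf w h) z) = normc (stft phi h (z - w)).
Proof. by rewrite /stft normc_inner_tf_tf. Qed.

Let IG (h : L2Rd) : leb2.-integrable setT (EFin \o (fun z => normc (G z) * normc (stft phi h z))).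
Proof.
have I := cintegrableM_bounded (M1_cintegrable Mg) (cmeasurable_stft h)
  (fun z => normc_stft_le h z).
have := cintegrable_normc I; congr (leb2.-integrable _ (EFin \o _)).
by apply/funext => z; rewrite normcM.
Qed.

Section lattice.
Variables (kappa : R) (L : 'M[R]_(d + d)).
Hypotheses (k0 : 0 < kappa) (uL : L \in unitmx).
Hypothesis cL : forall v, norm1 v <= kappa * norm1 (L *m v).
Let C : R := decay_const * lattice_const (d + d) kappa^-1.
Let pt (m : 'cV[int]_(d + d)) := lattice_pt L m.

(** By Moyal's formula |V_phi g| is dominated by its convolution with the ambiguity
function of the Gaussian. The samples of the latter along the lattice are summable,
uniformly in their position, and the weight is submultiplicative. *)
Lemma sampled_stft_le z (K : seq 'cV[int]_(d + d)) : uniq K ->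
  \sum_(m <- K) weight (z - pt m) * normc (G (z - pt m)) <= C * A / c0.
Proof.
move=> uK; rewrite ler_pdivlMr// mulrC mulr_sumr.
pose F (m : 'cV[int]_(d + d)) y := weight (z - pt m) * (normc (G y) * normc (stft phi (tf (z - pt m) phi) y)).
have IF m : leb2.-integrable setT (EFin \o F m).
  exact: (integrableZl measurableT (weight (z - pt m)) (IG _)).
apply: (@le_trans _ _ (\sum_(m <- K) \int[leb2]_y F m y)).
  apply: ler_sum => m _; rewrite /F (RintegralZl _ measurableT (IG _)).
  rewrite mulrCA; apply: ler_wpM2l; first exact: weight_ge0.
  exact: moyal_le.
rewrite /M1_mass -RintegralZl//; apply: sum_Rintegral_le => //.
  exact: (integrableZl measurableT C IA).
move=> y; pose e m := expR (- norm1 ((y - z) - (- pt m))).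
apply: (@le_trans _ _ (\sum_(m <- K) weight y * normc (G y) * (decay_const * e m))).
  apply: ler_sum => m _; rewrite /F stft_tf.
  set v := z - pt m; have yv : y - z - - pt m = y - v by rewrite /v opprB opprK addrAC addrA.
  have := weight_ambiguity_le (y - v); rewrite /e yv => h.
  have w1 : weight v <= weight y * weight (y - v).
    rewrite -[weight (y - v)]weightN opprB -{1}(subrK y v) addrC.
    exact: weightM.
  apply: le_trans (ler_wpM2l (mulr_ge0 (weight_ge0 y) (normc_ge0 (G y))) h).
  rewrite [leRHS](_ : _ = weight y * weight (y - v) * (normc (G y) * normc (stft phi phi (y - v)))); last by ring.
  by apply: ler_wpM2r => //; rewrite mulr_ge0 ?normc_ge0.
rewrite -!mulr_sumr mulrCA /C -mulrA; apply: ler_wpM2l.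
  by rewrite mulr_ge0 ?expR_ge0// ltW.
rewrite mulrC; apply: ler_wpM2r; first by rewrite mulr_ge0 ?weight_ge0 ?normc_ge0.
pose K' := map (fun m : 'cV[int]_(d + d) => - m) K.
have uK' : uniq K' by rewrite map_inj_uniq//; exact: oppr_inj.
have := lattice_exp_sum (y - z) k0 uL cL uK'; rewrite big_map.
congr (_ <= _); apply: eq_bigr => m _; rewrite /e /pt /lattice_pt.
congr (expR (- norm1 (_ - _))).
by rewrite -mulmxN; congr (_ *m _); apply/matrixP => i j; rewrite !mxE rmorphN.
Qed.

(** Moyal's formula also dominates the autocorrelation of [g] by the correlation of
|V_phi g| with itself, to which the previous bound applies. *)
Lemma sampled_autocorrelation_le (K : seq 'cV[int]_(d + d)) : uniq K ->
  \sum_(m <- K) weight (pt m) * normc (inner g (tf (pt m) g)) <= C * A / c0 * A / c0.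
Proof.
move=> uK; rewrite ler_pdivlMr// mulrC mulr_sumr.
pose F (m : 'cV[int]_(d + d)) z := weight (pt m) * (normc (G z) * normc (stft phi (tf (pt m) g) z)).
have IF m : leb2.-integrable setT (EFin \o F m).
  exact: (integrableZl measurableT (weight (pt m)) (IG _)).
apply: (@le_trans _ _ (\sum_(m <- K) \int[leb2]_z F m z)).
  apply: ler_sum => m _; rewrite /F (RintegralZl _ measurableT (IG _)).
  rewrite mulrCA; apply: ler_wpM2l; first exact: weight_ge0.
  exact: moyal_le.
rewrite /M1_mass -RintegralZl//; apply: sum_Rintegral_le => //.
  exact: (integrableZl measurableT (C * A / c0) IA).
move=> z.
apply: (@le_trans _ _ (\sum_(m <- K) weight z * normc (G z) * (weight (z - pt m) * normc (G (z - pt m))))).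
  apply: ler_sum => m _; rewrite /F stft_tf.
  set v := pt m.
  have w1 : weight v <= weight z * weight (z - v).
    rewrite -[weight (z - v)]weightN opprB -{1}(subrK z v) addrC.
    exact: weightM.
  rewrite [leRHS](_ : _ = weight z * weight (z - v) * (normc (G z) * normc (G (z - v)))); last by ring.
  by apply: ler_wpM2r => //; rewrite mulr_ge0 ?normc_ge0.
rewrite -mulr_sumr mulrC; apply: ler_wpM2r; first by rewrite mulr_ge0 ?weight_ge0 ?normc_ge0.
exact: sampled_stft_le.
Qed.

End lattice.

(** All constants depend on the lattice through [kappa] only, which is locally uniform;
coercivity also replaces the weight at [L m] by the weight at [m]. *)
Lemma autocorrelation_summable (L0 : 'M[R]_(d + d)) : L0 \in unitmx ->
  exists r C : R, [/\ 0 < r, 0 <= C &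
    forall L : 'M[R]_(d + d), L \in unitmx -> (forall i j, `|L i j - L0 i j| <= r) ->
    forall K : seq 'cV[int]_(d + d), uniq K ->
    \sum_(m <- K) (1 + norm1 (map_mx intr m : 'cV[R]_(d + d))) *
       normc (inner g (tf (lattice_pt L m) g)) <= C].
Proof.
move=> uL0; have [r [kappa [r0 k0 cL]]] := coercive_near uL0.
pose C := (1 + kappa) * (decay_const * lattice_const (d + d) kappa^-1 * A / c0 * A / c0).
exists r, C; split => //.
  have l0 : 0 <= lattice_const (d + d) kappa^-1.
    apply: exprn_ge0; apply: mulr_ge0; first exact: expR_ge0.
    apply: divr_ge0 => //; rewrite subr_ge0 -expR0 ler_expR.
    by rewrite oppr_le0 invr_ge0 ltW.
  have dc0 : 0 <= decay_const by apply: mulr_ge0; [exact: ltW|exact: expR_ge0].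
  apply: mulr_ge0; first by rewrite addr_ge0// ltW.
  by do 2 (apply: divr_ge0; last exact: ltW; apply: mulr_ge0 => //); exact: mulr_ge0.
move=> L uL Lr K uK; have cL' := cL L Lr.
apply: le_trans (ler_wpM2l _ (sampled_autocorrelation_le k0 uL cL' uK)); last first.
  by rewrite addr_ge0// ltW.
rewrite mulr_sumr; apply: ler_sum => m _; rewrite mulrA.
apply: ler_wpM2r; first exact: normc_ge0.
rewrite weightE; have := cL' (map_mx intr m); rewrite -/(lattice_pt L m).
have := norm1_ge0 (lattice_pt L m); move: (norm1 _) (norm1 _) => a b b0.
by move: k0 => /ltW; nra.
Qed.

End decay.

Section regularity.
Variable g : L2Rd.
Hypothesis Mg : M1 g.
Local Notation A := (M1_mass g).

Lemma dotcV_le (x y : 'cV[R]_d) (r : R) : 0 <= r -> (forall i, `|y i ord0| <= r) ->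
  `|dotcV x y| <= r * norm1 x.
Proof.
move=> r0 yr; apply: le_trans (ler_norm_sum _ _ _) _; rewrite /norm1 mulr_sumr.
apply: ler_sum => i _; rewrite normrM mulrC; exact: ler_wpM2r.
Qed.

Let dotcVC (x y : 'cV[R]_d) : dotcV x y = dotcV y x.
Proof. by apply: eq_bigr => i _; rewrite mulrC. Qed.

Let norm1_uds z : norm1 (usubmx z) + norm1 (dsubmx z) = norm1 z.
Proof.
rewrite [RHS]/norm1 big_split_ord; congr (_ + _); apply: eq_bigr => i _; by rewrite mxE.
Qed.

Let sqr_L2norm_phi : L2norm phi ^+ 2 = c0.
Proof.
have := stft_gaussian_gaussian (0 : 'cV[R]_(d + d)).
rewrite (_ : usubmx 0 = 0); last by apply/matrixP => i j; rewrite !mxE.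
rewrite (_ : dotcV 0 _ = 0); last by rewrite /dotcV big1// => i _; rewrite mxE mul0r.
rewrite [\sum_i _]big1; last by move=> i _; rewrite mxE expr0n.
rewrite !mulr0 oppr0 expi0 expR0 mulr1 mul1r /stft tf0 inner_self => E.
exact: (congr1 (@complex.Re R) E).
Qed.

Let n1 : R := (d + d)%:R.

(* by the explicit ambiguity function: |pi(del) phi - phi|^2 = 2 (|phi|^2 - Re V_phi phi(del)) *)
Let gauss_shift (del : 'cV[R]_(d + d)) r : 0 <= r -> (forall i, `|del i ord0| <= r) ->
  L2norm (tf del phi - phi) ^+ 2 <= 4 * c0 * pi * n1 * r ^+ 2.
Proof.
move=> r0 dr; have p0 := pi_gt0 R.
have -> : L2norm (tf del phi - phi) ^+ 2 = 2 * (c0 - Re (stft phi phi del)).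
  rewrite sqr_L2normD L2normN L2norm_tf sqr_L2norm_phi -scaleN1r innerZr.
  rewrite (inner_conj (tf del phi) phi) -/(stft phi phi del).
  rewrite ReM Re_conjc Im_conjc /= oppr0 !oppr0 mulN1r mul0r subr0; ring.
rewrite stft_gaussian_gaussian [X in Re X]mulrC Re_realM /=.
set a := - (pi * _); set b := pi / 2 * _.
have b0 : 0 <= b.
  rewrite /b mulr_ge0 ?divr_ge0 ?(ltW p0)// sumr_ge0// => i _; exact: sqr_ge0.
have br : b <= pi * n1 * r ^+ 2 / 2.
  have S_le : \sum_i del i ord0 ^+ 2 <= n1 * r ^+ 2.
    have -> : n1 * r ^+ 2 = \sum_(i < d + d) r ^+ 2.
      by rewrite sumr_const card_ord mulr_natl.
    by apply: ler_sum => i _; rewrite -[leLHS]real_normK ?num_real// ler_pXn2r ?nnegrE.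
  have p2 : 0 <= pi / 2 :> R by rewrite divr_ge0// ltW.
  have := ler_wpM2l p2 S_le; rewrite -/b; move: (pi : R) => P; lra.
have ar : `|a| <= pi * n1 * r ^+ 2.
  rewrite /a normrN normrM gtr0_norm// -mulrA ler_wpM2l ?(ltW p0)//.
  apply: le_trans (dotcV_le _ r0 _) _.
    by move=> i; rewrite mxE; exact: dr.
  rewrite expr2 mulrA mulrC; apply: ler_wpM2r => //.
  apply: (@le_trans _ _ (norm1 del)); first by rewrite -norm1_uds lerDl norm1_ge0.
  have -> : n1 * r = \sum_(i < d + d) r by rewrite sumr_const card_ord mulr_natl.
  by apply: ler_sum => i _.
have key : 1 - `|a| - b <= cos a * expR (- b).
  have c1 : 1 - `|a| <= cos a.
    have := le_trans (Re_le_normc _) (normc_expiB1 a).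
    rewrite ReD /= ler_norml => /andP[+ _]; lra.
  have e1 : 1 - b <= expR (- b) by apply: le_trans (expR_ge1Dx _).
  have e2 : expR (- b) <= 1 by rewrite -[leRHS]expR0 ler_expR oppr_le0.
  have e3 := expR_ge0 (- b); have c2 := cos_le1 a.
  have [cp|cn] := leP 0 (cos a); nra.
have : c0 * (1 - `|a| - b) <= c0 * (cos a * expR (- b)) by apply: ler_wpM2l => //; exact: ltW.
have : c0 * (`|a| + b) <= c0 * (2 * (pi * n1 * r ^+ 2)).
  apply: ler_wpM2l; first exact: ltW.
  have : 0 <= pi * n1 * r ^+ 2 by rewrite !mulr_ge0 ?sqr_ge0 ?(ltW p0)// /n1.
  lra.
move: (expR _) (cos _) `|a| => E cc aa; lra.
Qed.

(** The Gaussian has this Lipschitz property, and so have its shifts by z, with a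
constant that grows like the weight of z because of the phases that arise when shifts
are commuted. Moyal's formula carries the property over to the functions of M^1. *)
Lemma tf_lipschitz : exists2 C : R, 0 <= C &
  forall (del : 'cV[R]_(d + d)) r, 0 <= r -> (forall i, `|del i ord0| <= r) ->
  L2norm (tf del g - g) <= C * r.
Proof.
pose D := 2 * pi * L2norm phi + Num.sqrt (4 * c0 * pi * n1).
have p0 := pi_gt0 R.
have D0 : 0 <= D by rewrite addr_ge0 ?sqrtr_ge0// mulr_ge0 ?L2norm_ge0// mulr_ge0// ltW.
exists (D * A / c0); first by rewrite divr_ge0 ?mulr_ge0 ?M1_mass_ge0// ltW.
move=> del r r0 dr.
have phi_r : L2norm (tf del phi - phi) <= Num.sqrt (4 * c0 * pi * n1) * r.
  rewrite -(@ler_pXn2r _ 2)// ?nnegrE ?mulr_ge0 ?sqrtr_ge0 ?L2norm_ge0//.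
  have q0 : 0 <= 4 * c0 * pi * n1 by rewrite !mulr_ge0 ?(ltW p0) ?(ltW c0_gt0)// /n1.
  by rewrite exprMn (sqr_sqrtr q0); exact: gauss_shift.
have shift z : L2norm (tf del (tf z phi) - tf z phi) <= D * r * weight z.
  pose th := 2 * pi * dotcV (usubmx z) (dsubmx del) - 2 * pi * dotcV (usubmx del) (dsubmx z).
  have -> : tf del (tf z phi) = expi th *: tf z (tf del phi).
    rewrite !tfM scalerA -expiD [del + z]addrC; congr (expi _ *: _).
    by rewrite /th; ring.
  have -> : expi th *: tf z (tf del phi) - tf z phi =
      tf z ((expi th - 1) *: tf del phi + (tf del phi - phi)).
    by rewrite tfD tfZ tfB scalerBl scale1r addrA subrK.
  rewrite L2norm_tf; apply: le_trans (L2normD_le _ _) _.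
  rewrite L2normZ L2norm_tf.
  have th_r : normc (expi th - 1) <= 2 * pi * r * weight z.
    apply: le_trans (normc_expiB1 _) _; rewrite /th -mulrBr normrM gtr0_norm ?mulr_gt0//.
    rewrite -mulrA; apply: ler_wpM2l; first by rewrite mulr_ge0// ltW.
    apply: le_trans (ler_normB _ _) _.
    have h1 : `|dotcV (usubmx z) (dsubmx del)| <= r * norm1 (usubmx z).
      by apply: dotcV_le => // i; rewrite mxE.
    have h2 : `|dotcV (usubmx del) (dsubmx z)| <= r * norm1 (dsubmx z).
      by rewrite dotcVC; apply: dotcV_le => // i; rewrite mxE.
    apply: le_trans (lerD h1 h2) _; rewrite -mulrDr norm1_uds weightE.
    by apply: ler_wpM2l => //; rewrite lerDr.
  have w1 := weight_ge1 z; have n0 := L2norm_ge0 phi.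
  apply: le_trans (lerD (ler_wpM2r n0 th_r) phi_r) _.
  have s0 : 0 <= Num.sqrt (4 * c0 * pi * n1) * r by rewrite mulr_ge0 ?sqrtr_ge0.
  have := ler_wpM2l s0 w1; rewrite mulr1 /D; move: (Num.sqrt _) s0 => S s0; lra.
(* The squared norm of k is <g, h> with h the adjoint of (pi(del) - 1) applied to k,
   and V_phi h is controlled by the action of pi(del) - 1 on shifted Gaussians. *)
set k := tf del g - g.
pose u := expi (2 * pi * dotcV (usubmx del) (dsubmx del)).
pose h : L2Rd := u^* *: tf (- del) k - k.
have adj f : inner (tf del f - f) k = inner f h.
  by rewrite [RHS]innerBr [X in _ = X - _]innerZr conjcK innerBl inner_tfl.
have hz z : normc (stft phi h z) <= L2norm k * (D * r * weight z).
  rewrite /stft inner_conj normc_conjc -adj.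
  apply: le_trans (cauchy_schwarz _ _) _; rewrite mulrC.
  by apply: ler_wpM2l; [exact: L2norm_ge0|exact: shift].
have := moyal_le h Mg; rewrite -adj -/k inner_self normc_real ger0_norm ?sqr_ge0// => mk.
have {}mk : c0 * L2norm k ^+ 2 <= L2norm k * (D * r) * A.
  apply: le_trans mk _; rewrite /M1_mass -RintegralZl//; last exact: M1_integrable.
  apply: le_Rintegral => //.
  - have I := cintegrableM_bounded (M1_cintegrable Mg) (cmeasurable_stft h)
      (fun z => normc_stft_le h z).
    have := cintegrable_normc I; congr (leb2.-integrable _ (EFin \o _)).
    by apply/funext => z; rewrite normcM.
  - exact: (integrableZl measurableT _ (M1_integrable Mg)).
  - move=> z _; apply: le_trans (ler_wpM2l (normc_ge0 (stft phi g z)) (hz z)) _.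
    by rewrite le_eqVlt; apply/orP; left; apply/eqP; ring.
have [k00|kn] := eqVneq (L2norm k) 0.
  by rewrite k00 mulr_ge0// divr_ge0 ?mulr_ge0 ?M1_mass_ge0// ltW.
have kp : 0 < L2norm k by rewrite lt_def kn L2norm_ge0.
have -> : D * A / c0 * r = L2norm k * (D * r) * A / (c0 * L2norm k).
  by field; rewrite kn gt_eqF.
rewrite ler_pdivlMr ?mulr_gt0//; apply: le_trans mk.
by rewrite expr2 mulrCA mulrA le_eqVlt eqxx.
Qed.

End regularity.

End M1_estimates.

(** * The Schur test and boxes of integer points *)

Section finite_sums.
Context {R : realType}.

Lemma esum_le_seqP (T : choiceType) (a : T -> R) (M : R) : (forall t, 0 <= a t) ->
  (\esum_(t in [set: T]) (a t)%:E <= M%:E)%E <->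
  forall K : seq T, uniq K -> \sum_(t <- K) a t <= M.
Proof.
move=> a0; split=> [h K uK|h].
  rewrite -lee_fin; apply: le_trans h; apply: esum_ge; exists [set` K].
    by split => //; exact: finite_seq.
  by rewrite -fsbig_seq// sumEFin.
apply: ub_ereal_sup => _ [X [fX _] <-].
by rewrite fsbig_finite// sumEFin lee_fin; apply: h; exact: finmap.fset_uniq.
Qed.

Lemma count_lt (N a : nat) : (\sum_(x < N) (x < a)%N <= a)%N.
Proof.
suff -> : (\sum_(x < N) (x < a)%N = minn N a)%N by exact: geq_minr.
elim: N => [|N IHN]; first by rewrite big_ord0 min0n.
by rewrite big_ord_recr /= IHN; lia.
Qed.

Definition in_window (N : nat) (x : int) : bool := (0 <= x) && (x < N%:Z).

(** The points that leave the window are among its last, or first, |m| points. *)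
Lemma count_out_window (N : nat) (m : int) :
  (\sum_(x < N) ~~ in_window N (x%:Z + m)%R <= `|m|)%N.
Proof.
case: m => a.
  rewrite (reindex_inj rev_ord_inj) /=; apply: leq_trans (count_lt N a).
  apply: leq_sum => x _; have := ltn_ord x; rewrite /in_window.
  by case: (ltnP x a) => xa; [rewrite leq_b1|rewrite leqn0 eqb0 negbK; lia].
apply: leq_trans (count_lt N a.+1); apply: leq_sum => x _; have := ltn_ord x.
rewrite /in_window.
by case: (ltnP x a.+1) => xa; [rewrite leq_b1|rewrite leqn0 eqb0 negbK; lia].
Qed.




(** Schur test, from a k a l <= (a k ^2 + a l ^2) / 2. *)
Lemma schur_test (T : eqType) (K : seq T) (a : T -> R) (A : T -> T -> R) (C : R) :
  (forall k, 0 <= a k) -> (forall k l, 0 <= A k l) ->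
  (forall k, \sum_(l <- K) A k l <= C) -> (forall l, \sum_(k <- K) A k l <= C) ->
  \sum_(k <- K) \sum_(l <- K) a k * a l * A k l <= C * \sum_(k <- K) a k ^+ 2.
Proof.
move=> a0 A0 A1 A2.
apply: (@le_trans _ _ (\sum_(k <- K) \sum_(l <- K)
    (2^-1 * a k ^+ 2 * A k l + 2^-1 * a l ^+ 2 * A k l))).
  apply: ler_sum => k _; apply: ler_sum => l _; rewrite -mulrDl; apply: ler_wpM2r => //.
  by have := sqr_ge0 (a k - a l); rewrite sqrrB; lra.
under eq_bigr do rewrite big_split /=.
rewrite big_split /= [X in _ + X]exchange_big /= -big_split /= mulr_sumr.
apply: ler_sum => k _; rewrite -!mulr_sumr.
have p : 0 <= 2^-1 * a k ^+ 2 by rewrite mulr_ge0 ?sqr_ge0 ?invr_ge0.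
by have := ler_wpM2l p (A1 k); have := ler_wpM2l p (A2 k); lra.
Qed.

End finite_sums.

Section windows.
Context {R : realType} (n N : nat).
Local Notation T := {ffun 'I_n -> 'I_N}.
Local Notation Z := 'cV[int]_n.

Definition corner (p : T) : Z := \col_i (p i : nat)%:Z.

Lemma corner_inj : injective corner.
Proof.
move=> p q pq; apply/ffunP => i; apply/val_inj.
by have := congr1 (fun v : Z => v i ord0) pq; rewrite !mxE => -[].
Qed.

Definition in_box (j k : Z) : bool := [forall i, in_window N ((k - j) i ord0)].

Lemma in_boxP j k : reflect (exists p, k = j + corner p) (in_box j k).
Proof.
apply: (iffP idP) => [/forallP h|[p ->]]; last first.
  apply/forallP => i; rewrite !mxE addrAC subrr add0r /in_window.
  by rewrite ltz_nat ltn_ord le0z_nat.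
have lt i : (`|(k - j)%R i ord0| < N)%N.
  by have := h i; rewrite /in_window; lia.
exists [ffun i => Ordinal (lt i)]; apply/colP => i.
rewrite !mxE ffunE /= gez0_abs; first by rewrite !mxE subrKC.
  by have := h i; rewrite /in_window !mxE => /andP[].
Qed.

(** The number of translates of the box that contain both [k] and [l], see
[count_box]: a box that contains [k] starts at [k - corner p] for one [p]. *)
Definition overlap (k l : Z) : nat := \sum_(p : T) in_box (k - corner p) l.

Lemma count_box (J : seq Z) (k l : Z) : uniq J -> (forall p, k - corner p \in J) ->
  (\sum_(j <- J) (in_box j k && in_box j l) = overlap k l)%N.
Proof.
move=> uJ kJ.
rewrite (eq_bigr (fun j => if in_box j k then in_box j l : nat else 0%N)); last first.
  by move=> j _; case: (in_box j k).
rewrite -big_mkcond -big_filter.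
rewrite /overlap -(big_map (fun p : T => k - corner p) xpredT (fun j => in_box j l : nat)).
apply: perm_big; apply: uniq_perm.
- by rewrite filter_uniq.
- by rewrite map_inj_uniq ?index_enum_uniq// => p q /addrI/oppr_inj; exact: corner_inj.
move=> j; rewrite mem_filter; apply/andP/mapP => [[/in_boxP[p ->] _]|[p _ ->]].
  by exists p; rewrite ?mem_index_enum// addrK.
by split; [apply/in_boxP; exists p; rewrite subrK|exact: kJ].
Qed.

(** A box that contains [k] misses [l] only if one of the coordinates of [l] leaves its
window; the bound sums over the coordinates. *)
Lemma overlap_ge (k l : Z) :
  (N ^ n - overlap k l)%:R * N%:R <= (N ^ n)%:R * norm1 (map_mx intr (l - k)) :> R.
Proof.
have -> : (N ^ n - overlap k l = \sum_(p : T) ~~ in_box (k - corner p) l)%N.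
  apply/eqP; rewrite -(eqn_add2r (overlap k l)) subnK.
    rewrite /overlap -big_split /= (eq_bigr (fun=> 1%N)); last by move=> p _; case: in_box.
    by rewrite sum1_card card_ffun !card_ord.
  apply: (@leq_trans (\sum_(p : T) 1)); last by rewrite sum1_card card_ffun !card_ord.
  by apply: leq_sum => p _; case: in_box.
have le1 : (\sum_(p : T) ~~ in_box (k - corner p) l <=
    \sum_i \sum_(p : T) ~~ in_window N ((p i : nat)%:Z + (l - k) i ord0))%N.
  rewrite exchange_big /=; apply: leq_sum => p _.
  case: (boolP (in_box _ _)) => //= /forallPn[i hi].
  rewrite (bigD1 i) //= (leq_trans _ (leq_addr _ _))//.
  move: hi; rewrite !mxE opprB addrCA; by case: in_window.
have le2 i : (N * \sum_(p : T) ~~ in_window N ((p i : nat)%:Z + (l - k) i ord0) <=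
    N ^ n * `|(l - k)%R i ord0|)%N.
  pose F (j : 'I_n) (x : 'I_N) : nat :=
    if j == i then nat_of_bool (~~ in_window N ((x : nat)%:Z + (l - k) i ord0)) else 1%N.
  rewrite (eq_bigr (fun p : T => \prod_j F j (p j))%N); last first.
    move=> p _; rewrite (bigD1 i) //= /F eqxx big1 ?muln1//.
    by move=> j /negPf ->.
  rewrite -bigA_distr_bigA (bigD1 i) //= mulnA [X in (X <= _)%N]mulnC.
  have -> : (N ^ n = (\prod_(j < n | j != i) \sum_(x < N) F j x) * N)%N.
    rewrite mulnC (eq_bigr (fun=> N)); last first.
      by move=> j /negPf ji; rewrite /F ji sum1_card card_ord.
    have -> : (N ^ n = \prod_(j < n) N)%N by rewrite prod_nat_const card_ord.
    by rewrite (bigD1 i).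
  rewrite -mulnA leq_mul2l leq_mul2l; apply/orP; right; apply/orP; right.
  by rewrite {1}/F eqxx; exact: count_out_window.
rewrite -natrM mulnC; apply: (@le_trans _ _ (\sum_i (N ^ n * `|(l - k)%R i ord0|))%N%:R).
  rewrite ler_nat (leq_trans (leq_mul (leqnn N) le1))// big_distrr /=.
  exact: leq_sum.
rewrite -big_distrr natrM /norm1 natr_sum ler_wpM2l//; apply: ler_sum => i _.
by rewrite natr_absz intr_norm [map_mx _ _ _ _]mxE.
Qed.

End windows.

(** * Norms of synthesis operators *)

Section synthesis.
Context {R : realType} {dd : measure_display} {T : measurableType dd}.
Variable mu : {sigma_finite_measure set T -> \bar R}.
Context {I : choiceType}.
Implicit Types (e : I -> L2 mu) (K : seq I) (c : I -> R[i]).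

Definition syn e K c : L2 mu := \sum_(k <- K) c k *: e k.

Definition energy K c : R := \sum_(k <- K) normc (c k) ^+ 2.

(** An upper bound of the norm of the synthesis operator from l^2 to L^2, tested on
finite sequences. *)
Definition syn_bound e (b : R) : Prop := forall K c, uniq K ->
  L2norm (syn e K c) <= b * Num.sqrt (energy K c).

Lemma energy_ge0 K c : 0 <= energy K c.
Proof. by apply: sumr_ge0 => k _; exact: sqr_ge0. Qed.

Lemma syn_boundP e b : 0 <= b -> syn_bound e b <->
  forall K c, uniq K -> L2norm (syn e K c) ^+ 2 <= b ^+ 2 * energy K c.
Proof.
move=> b0; split=> h K c uK.
  rewrite -(sqr_sqrtr (energy_ge0 K c)) -exprMn ler_pXn2r// ?nnegrE ?L2norm_ge0//.
    exact: h.
  by rewrite mulr_ge0 ?sqrtr_ge0.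
rewrite -(@ler_pXn2r _ 2)// ?nnegrE ?L2norm_ge0 ?mulr_ge0 ?sqrtr_ge0//.
by rewrite exprMn (sqr_sqrtr (energy_ge0 K c)); exact: h.
Qed.

Lemma sqr_L2norm_syn e K c : L2norm (syn e K c) ^+ 2 =
  \sum_(k <- K) \sum_(l <- K) Re (c k * (c l)^* * inner (e k) (e l)).
Proof.
rewrite sqr_L2norm_inner /syn inner_suml Re_sum; apply: eq_bigr => k _.
rewrite inner_sumr Re_sum; apply: eq_bigr => l _.
by rewrite innerZl innerZr mulrA.
Qed.

(** Duality between the analysis operator f |-> (<f, e_k>)_k and its adjoint,
the synthesis operator: they have the same norm. *)
Lemma bessel_synthesis e b : 0 < b ->
  (forall f, \esum_(k in [set: I]) (normc (inner f (e k)) ^+ 2)%:E <=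
     (b ^+ 2 * L2norm f ^+ 2)%:E)%E <-> syn_bound e b.
Proof.
move=> b0; have b2 : 0 < b ^+ 2 by rewrite exprn_gt0.
split=> [h|/(syn_boundP _ (ltW b0)) h f].
  apply/syn_boundP => [|K c uK]; first exact: ltW.
  set f := syn e K c; set X := L2norm f ^+ 2.
  have hf : \sum_(k <- K) normc (inner f (e k)) ^+ 2 <= b ^+ 2 * X.
    have h0 k : 0 <= normc (inner f (e k)) ^+ 2 by exact: sqr_ge0.
    exact: ((esum_le_seqP _ h0).1 (h f) K uK).
  (* expand <f, f> in its first argument and use x y <= (b^2 x^2 + y^2 / b^2) / 2; the
     second term is at most X / 2 by the Bessel inequality *)
  have : X <= 2^-1 * b ^+ 2 * energy K c +
      2^-1 * (b ^+ 2)^-1 * \sum_(k <- K) normc (inner f (e k)) ^+ 2.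
    rewrite /X sqr_L2norm_inner {1}/f /syn inner_suml Re_sum /energy !mulr_sumr -big_split.
    apply: ler_sum => k _; rewrite innerZl.
    apply: le_trans (ler_norm _) (le_trans (Re_le_normc _) _).
    rewrite normcM (inner_conj (e k)) normc_conjc.
    set x := normc (c k); set y := normc (inner _ _).
    have := sqr_ge0 (b * x - b^-1 * y).
    rewrite sqrrB !exprMn exprVn.
    have -> : b * x * (b^-1 * y) = x * y by rewrite mulrACA divff ?mul1r// gt_eqF.
    rewrite -[_ *+ 2]mulr_natl; move: (b ^+ 2) (b ^- 2) (x * y) => p q xy s0.
    by rewrite -[leRHS]/(2^-1 * p * x ^+ 2 + 2^-1 * q * y ^+ 2); lra.
  have -> : 2^-1 * (b ^+ 2)^-1 * \sum_(k <- K) normc (inner f (e k)) ^+ 2 =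
     2^-1 * ((b ^+ 2)^-1 * \sum_(k <- K) normc (inner f (e k)) ^+ 2) by rewrite mulrA.
  have : (b ^+ 2)^-1 * \sum_(k <- K) normc (inner f (e k)) ^+ 2 <= X.
    by rewrite ler_pdivrMl.
  by lra.
apply/esum_le_seqP => [k|K uK]; first exact: sqr_ge0.
pose c k := inner f (e k); rewrite -[leLHS]/(energy K c).
(* with the coefficients <f, e_k>, pairing f with the synthesis gives the energy *)
have eX : inner f (syn e K c) = (energy K c)%:C.
  rewrite /syn inner_sumr rmorph_sum; apply: eq_bigr => k _.
  by rewrite innerZr mulrC mulr_conjc.
have := cauchy_schwarz f (syn e K c); rewrite eX normc_real ger0_norm ?energy_ge0// => cs.
have hs := h K c uK.
have [->|X0] := eqVneq (energy K c) 0; first by rewrite mulr_ge0 ?sqr_ge0.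
have Xp : 0 < energy K c by rewrite lt_neqAle eq_sym X0 energy_ge0.
rewrite -(ler_pM2r Xp) -expr2.
apply: (@le_trans _ _ ((L2norm f * L2norm (syn e K c)) ^+ 2)).
  by rewrite ler_pXn2r// ?nnegrE ?mulr_ge0 ?L2norm_ge0// ltW.
rewrite exprMn; have := ler_wpM2l (sqr_ge0 (L2norm f)) hs; lra.
Qed.

Lemma synD e1 e2 K c : syn (fun k => e1 k + e2 k) K c = syn e1 K c + syn e2 K c.
Proof. by rewrite /syn -big_split; apply: eq_bigr => k _; rewrite scalerDr. Qed.

Lemma synB e1 e2 K c : syn (fun k => e1 k - e2 k) K c = syn e1 K c - syn e2 K c.
Proof.
by rewrite /syn -sumrB; apply: eq_bigr => k _; rewrite scalerBr.
Qed.

Lemma L2norm_sum (J : Type) (s : seq J) (f : J -> L2 mu) :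
  L2norm (\sum_(j <- s) f j) <= \sum_(j <- s) L2norm (f j).
Proof.
elim/big_ind2: _ => [|x a y b xa yb|//]; first by rewrite L2norm_0.
exact: le_trans (L2normD_le _ _) (lerD _ _).
Qed.

Lemma normc_le_energy K c k : k \in K -> normc (c k) <= Num.sqrt (energy K c).
Proof.
move=> kK; rewrite -(@ler_pXn2r _ 2)// ?nnegrE ?normc_ge0 ?sqrtr_ge0//.
rewrite (sqr_sqrtr (energy_ge0 K c)) /energy (big_rem k)//= lerDl.
by apply: sumr_ge0 => l _; exact: sqr_ge0.
Qed.

Lemma syn_near e1 e2 K c eta : (forall k, k \in K -> L2norm (e1 k - e2 k) <= eta) ->
  L2norm (syn e1 K c) <= L2norm (syn e2 K c) + (size K)%:R * eta * Num.sqrt (energy K c).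
Proof.
move=> h; rewrite -[syn e1 K c](subrK (syn e2 K c)) addrC.
apply: le_trans (L2normD_le _ _) _; rewrite lerD2l -synB /syn.
apply: le_trans (L2norm_sum _ _) _.
rewrite -mulrA -sum1_size natr_sum mulr_suml big_seq [leRHS]big_seq; apply: ler_sum => k kK.
rewrite L2normZ mulrC mul1r; apply: ler_pM; rewrite ?L2norm_ge0 ?normc_ge0//.
  exact: h.
exact: normc_le_energy.
Qed.

End synthesis.

(** * Synthesis along a lattice *)

Section heisenberg_norm.
Context {R : realType} {d : nat}.
Local Notation leb := (@lebesgue_cV R d).
Local Notation L2Rd := (L2 leb).
Local Notation n := (d + d)%N.
Local Notation Z := 'cV[int]_n.
Implicit Types (g f : L2Rd) (L : 'M[R]_n) (k l j : Z) (K : seq Z) (c : Z -> R[i]).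

Definition atom g L k : L2Rd := tf (lattice_pt L k) g.

Lemma bessel_boundP g L b : 0 < b -> bessel_bound g L (b ^+ 2) <-> syn_bound (atom g L) b.
Proof.
move=> b0; apply: iff_trans (bessel_synthesis (atom g L) b0).
by split=> [[_ h]//|h]; split; rewrite ?exprn_gt0.
Qed.

Lemma syn_bound_le (I : choiceType) (e : I -> L2Rd) (a b : R) : a <= b ->
  syn_bound e a -> syn_bound e b.
Proof.
by move=> ab h K c uK; apply: le_trans (h K c uK) _; rewrite ler_wpM2r ?sqrtr_ge0.
Qed.

(** By duality the norm of the module is the norm of the synthesis operator. Synthesis
bounds, unlike Bessel bounds, may be 0, so that their infimum is one of them. *)
Lemma heis_norm_leP L g (b : R) : 0 <= b ->
  (heis_norm L g <= b%:E)%E <-> syn_bound (atom g L) b.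
Proof.
move=> b0; split=> [h K c uK|h]; last first.
  apply/lee_addgt0Pr => e e0; have be : 0 < b + e by lra.
  have /heis_norm_le : bessel_bound g L ((b + e) ^+ 2).
    by apply/bessel_boundP => //; apply: syn_bound_le h; lra.
  by rewrite sqrtr_sqr gtr0_norm.
have s0 : 0 <= Num.sqrt (energy K c) by exact: sqrtr_ge0.
apply/ler_addgt0Pr => e e0.
pose s := Num.sqrt (energy K c); rewrite -/s in s0 *.
have e1 : 0 < e / (s + 1) by rewrite divr_gt0//; lra.
have [] := @heis_norm_lt _ _ L g (b + e / (s + 1)).
  by apply: le_lt_trans h _; rewrite lte_fin; lra.
move=> B hB sB; have B0 := hB.1.
have sB0 : 0 < Num.sqrt B by rewrite sqrtr_gt0.
have /(bessel_boundP _ _ sB0) hs : bessel_bound g L (Num.sqrt B ^+ 2).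
  by rewrite sqr_sqrtr ?(ltW B0).
apply: le_trans (hs K c uK) _; rewrite -/s.
apply: le_trans (ler_wpM2r s0 (ltW sB)) _; rewrite mulrDl lerD2l.
rewrite -mulrA ger_pMr// mulrC ler_pdivrMr; lra.
Qed.

Lemma heis_norm_ge0 L g : (0 <= heis_norm L g)%E.
Proof. by apply: le_ereal_inf_tmp => _ [B _ <-]; rewrite lee_fin sqrtr_ge0. Qed.

(** One coefficient, at the origin of the lattice. *)
Lemma L2norm_le_heis L g b : syn_bound (atom g L) b -> L2norm g <= b.
Proof.
move=> /(_ [:: 0] (fun=> 1) isT).
rewrite /syn /energy !big_seq1 scale1r normc1 expr1n sqrtr1 mulr1.
by rewrite /atom L2norm_tf.
Qed.

(** The modulus of the autocorrelation at a lattice point. As shifts commute up to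
phases, it is the modulus of the entries of the Gram matrix on a diagonal. *)
Definition lag g L (m : Z) : R := normc (inner g (tf (lattice_pt L m) g)).

Lemma lattice_ptD L k l : lattice_pt L (k + l) = lattice_pt L k + lattice_pt L l.
Proof. by rewrite /lattice_pt map_mxD mulmxDr. Qed.

Lemma lattice_ptB L k l : lattice_pt L (k - l) = lattice_pt L k - lattice_pt L l.
Proof. by rewrite /lattice_pt map_mxB mulmxBr. Qed.

Lemma normc_inner_atom g L k l : normc (inner (atom g L k) (atom g L l)) = lag g L (l - k).
Proof. by rewrite normc_inner_tf_tf -lattice_ptB. Qed.

Lemma gram_entry_le g L c k l :
  `|Re (c k * (c l)^* * inner (atom g L k) (atom g L l))| <=
  normc (c k) * normc (c l) * lag g L (l - k).
Proof.
by rewrite -normc_inner_atom -(normc_conjc (c l)) -!normcM Re_le_normc.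
Qed.

(** Translating a finite family of atoms by a lattice point amounts to applying a
unitary operator and multiplying the coefficients by unimodular factors. *)
Lemma syn_translate g L j K c : exists2 c', (forall k, normc (c' k) = normc (c (j + k))) &
  L2norm (syn (atom g L) [seq j + k | k <- K] c) = L2norm (syn (atom g L) K c').
Proof.
pose u k := expi (2 * pi * dotcV (usubmx (lattice_pt L j)) (dsubmx (lattice_pt L k))).
exists (fun k => c (j + k) * u k) => [k|]; first by rewrite normcM normc_expi mulr1.
rewrite -[RHS](L2norm_tf (lattice_pt L j)) /syn tf_sum big_map.
congr L2norm; apply: eq_bigr => k _.
rewrite tfZ /atom tfM scalerA /u -[_ * _ * expi _]mulrA -expiD subrr expi0 mulr1.
by rewrite lattice_ptD.
Qed.

Lemma overlap_le (N : nat) k l : (overlap N k l <= N ^ n)%N.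
Proof.
apply: (@leq_trans (\sum_(p : {ffun 'I_n -> 'I_N}) 1)).
  by apply: leq_sum => p _; case: in_box.
by rewrite sum1_card card_ffun !card_ord.
Qed.

(** Cut the coefficients by all translates of the box. Each of them satisfies the bound
of the box at the origin, and in the sum over the translates the entry (k, l) of the
Gram matrix is counted [overlap N k l] times instead of N^n times. The Schur test and
the decay of the Gram matrix show that the missing entries amount to an error of order
1/N. *)
Lemma window_estimate g L (N : nat) (b C : R) : (0 < N)%N -> 0 <= b ->
  (forall K c, uniq K -> (forall k, k \in K -> in_box N 0 k) ->
     L2norm (syn (atom g L) K c) <= b * Num.sqrt (energy K c)) ->
  (forall K, uniq K -> \sum_(m <- K) norm1 (map_mx intr m) * lag g L m <= C) ->
  forall K c, uniq K -> L2norm (syn (atom g L) K c) ^+ 2 <= (b ^+ 2 + C / N%:R) * energy K c.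
Proof.
move=> N0 b0 hwin hC K c uK.
pose G k l := Re (c k * (c l)^* * inner (atom g L k) (atom g L l)).
pose E := energy K c; have E0 : 0 <= E := energy_ge0 K c.
(* the corners of all the boxes that meet K *)
pose J := undup [seq k - corner p | k <- K, p <- enum {ffun 'I_n -> 'I_N}].
have uJ : uniq J by exact: undup_uniq.
have kJ k : k \in K -> forall p : {ffun 'I_n -> 'I_N}, k - corner p \in J.
  by move=> kK p; rewrite mem_undup; apply: allpairs_f => //; rewrite mem_enum.
have box j : \sum_(k <- K) \sum_(l <- K) G k l * (in_box N j k && in_box N j l)%:R <=
    b ^+ 2 * \sum_(k <- K) normc (c k) ^+ 2 * (in_box N j k)%:R.
  pose K0 := [seq k - j | k <- K & in_box N j k].
  have [c' hc' hs] := syn_translate g L j K0 c.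
  have eK0 : [seq j + k | k <- K0] = [seq k <- K | in_box N j k].
    by rewrite -map_comp map_id_in// => k _ /=; rewrite subrKC.
  have uK0 : uniq K0 by rewrite map_inj_uniq ?filter_uniq//; exact: addIr.
  pose E' := \sum_(k <- K) normc (c k) ^+ 2 * (in_box N j k)%:R.
  have := hwin K0 c' uK0; rewrite -/E'.
  have -> : energy K0 c' = E'.
    rewrite /energy big_map big_filter big_mkcond; apply: eq_bigr => k _.
    by rewrite hc' subrKC; case: in_box; rewrite ?mulr1 ?mulr0.
  move=> hw.
  have E'0 : 0 <= E' by apply: sumr_ge0 => k _; apply: mulr_ge0 (sqr_ge0 _) (ler0n _ _).
  have -> : \sum_(k <- K) \sum_(l <- K) G k l * (in_box N j k && in_box N j l)%:R =
      L2norm (syn (atom g L) K0 c') ^+ 2.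
    rewrite -hs eK0 sqr_L2norm_syn big_filter [RHS]big_mkcond; apply: eq_bigr => k _.
    case: (in_box N j k); last by rewrite big1// => l _; rewrite mulr0.
    rewrite big_filter [RHS]big_mkcond; apply: eq_bigr => l _.
    by case: (in_box N j l); rewrite ?mulr1 ?mulr0.
  rewrite -(sqr_sqrtr E'0) -exprMn ler_pXn2r ?nnegrE ?L2norm_ge0 ?(mulr_ge0 b0) ?sqrtr_ge0//.
  apply: hw => k /mapP[l lK ->]; move: lK; rewrite mem_filter => /andP[/in_boxP[p ->] _].
  by apply/in_boxP; exists p; rewrite add0r addrAC subrr add0r.
pose D := (N ^ n)%:R : R; have D0 : 0 < D by rewrite ltr0n expn_gt0 N0.
have Nr0 : 0 < N%:R :> R by rewrite ltr0n.
have cut : \sum_(k <- K) \sum_(l <- K) G k l * (overlap N k l)%:R <= b ^+ 2 * (E * D).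
  apply: (@le_trans _ _ (\sum_(j <- J) b ^+ 2 *
      \sum_(k <- K) normc (c k) ^+ 2 * (in_box N j k)%:R)).
    apply: le_trans (ler_sum _ (fun j _ => box j)); rewrite [leRHS]exchange_big big_seq [leRHS]big_seq.
    apply: ler_sum => k kK; rewrite [leRHS]exchange_big; apply: ler_sum => l _.
    by rewrite -(count_box l uJ (kJ k kK)) natr_sum mulr_sumr.
  rewrite -mulr_sumr [X in _ * X]exchange_big ler_wpM2l ?sqr_ge0// /E /energy mulr_suml.
  rewrite big_seq [leRHS]big_seq; apply: ler_sum => k kK.
  rewrite -mulr_sumr ler_wpM2l ?sqr_ge0// -natr_sum ler_nat.
  apply: leq_trans (overlap_le N k k); rewrite -(count_box k uJ (kJ k kK)).
  by apply: leq_sum => j _; rewrite andbb.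
pose A k l := norm1 (map_mx intr (l - k) : 'cV[R]_n) * lag g L (l - k).
have A0 k l : 0 <= A k l by rewrite mulr_ge0 ?norm1_ge0 ?normc_ge0.
(* what the boxes miss, by the Schur test *)
have miss : (\sum_(k <- K) \sum_(l <- K) G k l * (N ^ n - overlap N k l)%:R) * N%:R <=
    D * (C * E).
  apply: (@le_trans _ _ (D * \sum_(k <- K) \sum_(l <- K) normc (c k) * normc (c l) * A k l)).
    rewrite mulr_suml mulr_sumr; apply: ler_sum => k _.
    rewrite mulr_suml mulr_sumr; apply: ler_sum => l _.
    rewrite -mulrA; apply: le_trans (ler_wpM2r _ (ler_norm _)) _.
      by rewrite mulr_ge0.
    apply: le_trans (ler_pM _ _ (gram_entry_le g L c k l) (@overlap_ge R n N k l)) _ => //.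
    by rewrite /A /D; rewrite le_eqVlt; apply/orP; left; apply/eqP; ring.
  rewrite ler_wpM2l ?(ltW D0)//; apply: schur_test => // [k|k|l].
  - exact: normc_ge0.
  - rewrite -(big_map (fun l => l - k) xpredT
      (fun m => norm1 (map_mx intr m : 'cV[R]_n) * lag g L m)).
    by apply: hC; rewrite map_inj_uniq//; exact: addIr.
  - rewrite -(big_map (fun k => l - k) xpredT
      (fun m => norm1 (map_mx intr m : 'cV[R]_n) * lag g L m)).
    by apply: hC; rewrite map_inj_uniq// => x y /addrI/oppr_inj.
have tot : D * L2norm (syn (atom g L) K c) ^+ 2 =
    \sum_(k <- K) \sum_(l <- K) G k l * (N ^ n - overlap N k l)%:R +
    \sum_(k <- K) \sum_(l <- K) G k l * (overlap N k l)%:R.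
  rewrite sqr_L2norm_syn mulr_sumr -big_split; apply: eq_bigr => k _.
  rewrite mulr_sumr -big_split; apply: eq_bigr => l _.
  by rewrite -[RHS]mulrDr -natrD subnK ?overlap_le// mulrC.
move: tot cut miss; set x := \sum_(k <- K) _; set y := \sum_(k <- K) _.
set w := L2norm _ ^+ 2 => tot cut miss.
rewrite -(ler_pM2l D0) tot -(ler_pM2r Nr0) -/E.
have -> : D * ((b ^+ 2 + C / N%:R) * E) * N%:R = D * (C * E) + b ^+ 2 * (E * D) * N%:R.
  by field; rewrite gt_eqF.
by rewrite mulrDl lerD// ler_wpM2r// ltW.
Qed.

(** The Schur test makes the Gram matrix of the atoms bounded. *)
Lemma schur_syn_bound g L (C : R) : 0 <= C ->
  (forall K, uniq K -> \sum_(m <- K) lag g L m <= C) -> syn_bound (atom g L) (Num.sqrt C).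
Proof.
move=> C0 hC; apply/syn_boundP => [|K c uK]; first exact: sqrtr_ge0.
rewrite (sqr_sqrtr C0) sqr_L2norm_syn.
apply: le_trans (@schur_test _ _ K (fun k => normc (c k)) (fun k l => lag g L (l - k)) C _ _ _ _).
- apply: ler_sum => k _; apply: ler_sum => l _.
  exact: le_trans (ler_norm _) (gram_entry_le g L c k l).
- by move=> k; exact: normc_ge0.
- by move=> k l; exact: normc_ge0.
- move=> k; rewrite -(big_map (fun l => l - k) xpredT (lag g L)).
  by apply: hC; rewrite map_inj_uniq//; exact: addIr.
- move=> l; rewrite -(big_map (fun k => l - k) xpredT (lag g L)).
  by apply: hC; rewrite map_inj_uniq// => x y /addrI/oppr_inj.
Qed.

End heisenberg_norm.

(** * Dependence of the synthesis norm on the lattice *)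

Section heisenberg_norm_continuity.
Context {R : realType} {d : nat}.
Local Notation leb := (@lebesgue_cV R d).
Local Notation L2Rd := (L2 leb).
Local Notation n := (d + d)%N.
Local Notation Z := 'cV[int]_n.
Implicit Types (L : 'M[R]_n) (k l : Z) (K : seq Z) (c : Z -> R[i]).
Variable g : L2Rd.
Hypothesis Mg : M1 g.

Definition entries_within (L0 : 'M[R]_n) (r : R) L : Prop :=
  forall i j, `|L i j - L0 i j| <= r.

Lemma entries_within_le L0 r s L : r <= s -> entries_within L0 r L -> entries_within L0 s L.
Proof. by move=> rs h i j; apply: le_trans rs. Qed.

(** The constant grows with [k]: so do the displacement [L k - L0 k] and the phase that
arises when it is split off. *)
Lemma atom_lipschitz L0 k : exists2 A : R, 0 <= A &
  forall L r, 0 <= r -> entries_within L0 r L ->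
  L2norm (atom g L k - atom g L0 k) <= A * r.
Proof.
have [C C0 hC] := tf_lipschitz Mg; have p0 := pi_ge0 R.
pose v : 'cV[R]_n := map_mx intr k; have v0 : 0 <= norm1 v by exact: norm1_ge0.
pose z := lattice_pt L0 k.
exists (2 * pi * (norm1 v * norm1 (usubmx z)) * L2norm g + C * norm1 v).
  by rewrite addr_ge0 ?mulr_ge0 ?L2norm_ge0 ?norm1_ge0.
move=> L r r0 hL; pose del := lattice_pt L k - z.
have rv0 : 0 <= r * norm1 v by rewrite mulr_ge0.
have hdel i : `|del i ord0| <= r * norm1 v.
  rewrite /del /z /lattice_pt -mulmxBl mxE; apply: le_trans (ler_norm_sum _ _ _) _.
  rewrite /norm1 mulr_sumr; apply: ler_sum => j _; rewrite normrM; apply: ler_wpM2r => //.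
  by rewrite mxE; move: (hL i j); rewrite !mxE.
pose th := 2 * pi * dotcV (usubmx z) (dsubmx del).
have -> : atom g L k = expi th *: tf z (tf del g).
  by rewrite tfM scalerA -expiD addrN expi0 scale1r /del addrC subrK.
have -> : expi th *: tf z (tf del g) - atom g L0 k =
    tf z ((expi th - 1) *: tf del g + (tf del g - g)).
  by rewrite tfD tfZ tfB scalerBl scale1r addrA subrK.
rewrite L2norm_tf; apply: le_trans (L2normD_le _ _) _.
rewrite L2normZ L2norm_tf.
have h1 := hC del _ rv0 hdel.
have h2 : normc (expi th - 1) <= 2 * pi * (r * norm1 v * norm1 (usubmx z)).
  apply: le_trans (normc_expiB1 _) _; rewrite /th normrM ger0_norm ?mulr_ge0//.
  apply: ler_wpM2l; first by rewrite mulr_ge0.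
  by apply: dotcV_le => // i; rewrite mxE.
have := ler_wpM2r (L2norm_ge0 g) h2.
move: (pi : R) h1 => P h1; nra.
Qed.

Lemma atoms_near L0 K (eta : R) : 0 < eta -> exists2 r : R, 0 < r &
  forall L, entries_within L0 r L -> forall k, k \in K ->
  L2norm (atom g L k - atom g L0 k) <= eta.
Proof.
move=> eta0; elim: K => [|k K [r r0 h]]; first by exists 1.
have [A A0 hA] := atom_lipschitz L0 k.
pose s := Num.min r (eta / (A + 1)).
have s1 : 0 < eta / (A + 1) by rewrite divr_gt0//; lra.
have s0 : 0 < s by rewrite lt_min r0.
exists s => // L hL l; rewrite inE => /predU1P[->|lK]; last first.
  by apply: h => //; apply: entries_within_le hL; rewrite ge_min lexx.
apply: le_trans (hA L s (ltW s0) hL) _.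
have : s <= eta / (A + 1) by rewrite ge_min lexx orbT.
rewrite ler_pdivlMr; last by lra.
by nra.
Qed.

Lemma syn_bound_finite L : L \in unitmx -> exists2 b : R, 0 <= b & syn_bound (atom g L) b.
Proof.
move=> uL; have [r [C [r0 C0 hC]]] := autocorrelation_summable Mg uL.
exists (Num.sqrt C); first exact: sqrtr_ge0.
apply: schur_syn_bound => // K uK; apply: le_trans (hC L uL _ K uK).
  apply: ler_sum => m _; apply: ler_peMl; first exact: normc_ge0.
  by rewrite lerDl norm1_ge0.
by move=> i j; rewrite subrr normr0 (ltW r0).
Qed.

(** Only finitely many atoms have indices in the box at the origin, so that a bound on
this box survives small changes of the lattice; the window estimate extends it to all
indices, with an error that a large box makes small. *)
Lemma syn_bound_upper L0 (b e : R) : L0 \in unitmx -> 0 <= b -> 0 < e ->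
  syn_bound (atom g L0) b -> exists2 r : R, 0 < r &
  forall L, L \in unitmx -> entries_within L0 r L -> syn_bound (atom g L) (b + e).
Proof.
move=> uL0 b0 e0 hb; have [r1 [C [r10 C0 hC]]] := autocorrelation_summable Mg uL0.
have e2 : 0 < (e / 2) ^+ 2 by rewrite exprn_gt0// divr_gt0.
(* C / N <= (e / 2) ^ 2, and the atoms of the box move the bound by at most e / 2 *)
pose N := (Num.truncn (C / (e / 2) ^+ 2)).+1.
have CN : C / N%:R <= (e / 2) ^+ 2.
  rewrite ler_pdivrMr ?ltr0n// mulrC -ler_pdivrMr// ltW//.
  exact: truncnS_gt.
pose Q : seq Z := [seq corner p | p <- enum {ffun 'I_n -> 'I_N}].
pose eta := e / 2 / ((size Q)%:R + 1).
have sQ0 : 0 <= (size Q)%:R :> R by rewrite ler0n.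
have eta0 : 0 < eta by rewrite !divr_gt0//; lra.
have [r2 r20 h2] := atoms_near L0 Q eta0.
exists (Num.min r1 r2) => [|L uL hL]; first by rewrite lt_min r10.
have L1 : entries_within L0 r1 L by apply: entries_within_le hL; rewrite ge_min lexx.
have L2 : entries_within L0 r2 L by apply: entries_within_le hL; rewrite ge_min lexx orbT.
apply/syn_boundP => [|K c uK]; first by lra.
apply: le_trans (@window_estimate _ _ g L N (b + e / 2) C _ _ _ _ K c uK) _ => //.
- by lra.
- move=> K0 c0 uK0 boxK0.
  have K0Q : {subset K0 <= Q}.
    by move=> k /boxK0/in_boxP[p ->]; rewrite add0r map_f// mem_enum.
  apply: le_trans (@syn_near _ _ _ leb _ (atom g L) (atom g L0) K0 c0 eta _) _.
    by move=> k /K0Q; exact: h2.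
  rewrite mulrDl lerD ?hb// ler_wpM2r ?sqrtr_ge0//.
  have : (size K0)%:R <= (size Q)%:R :> R by rewrite ler_nat uniq_leq_size.
  have : eta * ((size Q)%:R + 1) = e / 2 by rewrite /eta divfK// gt_eqF//; lra.
  by nra.
- move=> K0 uK0; apply: le_trans (hC L uL L1 K0 uK0).
  apply: ler_sum => m _; rewrite ler_wpM2r ?normc_ge0//; lra.
rewrite ler_wpM2r ?energy_ge0//.
have : 0 <= b * e by rewrite mulr_ge0// ltW.
by have := sqr_ge0 e; move: CN; move: (C / _) => q; lra.
Qed.

(** A violation of the bound involves finitely many atoms and persists nearby. *)
Lemma syn_bound_lower L0 (b : R) : ~ syn_bound (atom g L0) b -> exists2 r : R, 0 < r &
  forall L, entries_within L0 r L -> ~ syn_bound (atom g L) b.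
Proof.
move=> /existsNP[K] /existsNP[c] /not_implyP[uK] /negP; rewrite -ltNge.
set X := L2norm _; set s := Num.sqrt _ => gap.
have s0 : 0 <= s by exact: sqrtr_ge0.
have sK0 : 0 <= (size K)%:R :> R by rewrite ler0n.
have m0 : 0 <= (size K)%:R * s by rewrite mulr_ge0.
pose eta := (X - b * s) / ((size K)%:R * s + 1).
have eta0 : 0 < eta by rewrite divr_gt0//; lra.
have [r r0 h] := atoms_near L0 K eta0; exists r => // L hL hb.
have : X <= L2norm (syn (atom g L) K c) + (size K)%:R * eta * s.
  by apply: syn_near => k kK; rewrite L2normBC; exact: h.
have := hb K c uK; rewrite -/s.
have : eta * ((size K)%:R * s + 1) = X - b * s by rewrite /eta divfK// gt_eqF//; lra.
by move: (L2norm (syn (atom g L) K c)) => Y; lra.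
Qed.

End heisenberg_norm_continuity.

(** * Heisenberg modules as Banach spaces *)

Section synthesis_bound_calculus.
Context {R : realType} {d : nat}.
Local Notation leb := (@lebesgue_cV R d).
Local Notation L2Rd := (L2 leb).
Local Notation n := (d + d)%N.
Implicit Types (L : 'M[R]_n) (f g : L2Rd).

Lemma syn_boundD L f g (a b : R) : syn_bound (atom f L) a -> syn_bound (atom g L) b ->
  syn_bound (atom (f + g) L) (a + b).
Proof.
move=> ha hb K c uK.
have -> : syn (atom (f + g) L) K c = syn (atom f L) K c + syn (atom g L) K c.
  by rewrite -synD /syn; apply: eq_bigr => k _; rewrite /atom tfD.
rewrite [leRHS]mulrDl; apply: le_trans (L2normD_le _ _) _.
exact: lerD (ha K c uK) (hb K c uK).
Qed.

Lemma syn_boundZ L f a (b : R) : syn_bound (atom f L) b ->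
  syn_bound (atom (a *: f) L) (normc a * b).
Proof.
move=> hb K c uK.
have -> : syn (atom (a *: f) L) K c = a *: syn (atom f L) K c.
  by rewrite /syn scaler_sumr; apply: eq_bigr => k _; rewrite /atom tfZ !scalerA mulrC.
rewrite L2normZ -mulrA; exact: ler_wpM2l (normc_ge0 a) _ _ (hb K c uK).
Qed.

Lemma syn_boundN L f (b : R) : syn_bound (atom f L) b -> syn_bound (atom (- f) L) b.
Proof.
by move=> /(@syn_boundZ L f (-1)); rewrite scaleN1r normcN normc1 mul1r.
Qed.

(** Each inequality in the definition of the bound involves finitely many atoms and
passes to the limit in L^2. *)
Lemma syn_bound_lim L (u : nat -> L2Rd) f (b : R) :
  (\forall m \near \oo, syn_bound (atom (u m) L) b) ->
  L2norm (u m - f) @[m --> \oo] --> (0 : R) -> syn_bound (atom f L) b.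
Proof.
move=> hu uf K c uK; apply/ler_addgt0Pr => e e0.
have s0 : 0 <= Num.sqrt (energy K c) by exact: sqrtr_ge0.
have m0 : 0 <= (size K)%:R * Num.sqrt (energy K c) by rewrite mulr_ge0.
pose eta := e / ((size K)%:R * Num.sqrt (energy K c) + 1).
have eta0 : 0 < eta by rewrite divr_gt0//; lra.
have hf : \forall m \near \oo, L2norm (u m - f) < eta.
  move/cvgr0_norm_lt: uf => /(_ _ eta0); apply: filterS => m.
  exact: le_lt_trans (ler_norm _).
have [m [hm1 hm2]] := filter_ex (filterI hu hf).
apply: le_trans (@syn_near _ _ _ leb _ (atom f L) (atom (u m) L) K c eta _) _.
  by move=> k _; rewrite -tfB L2norm_tf L2normBC ltW.
apply: lerD; first exact: hm1.
have : eta * ((size K)%:R * Num.sqrt (energy K c) + 1) = e by rewrite /eta divfK// gt_eqF//; lra.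
by move: (Num.sqrt _) (_%:R) => s q; lra.
Qed.


Lemma syn_bound_eq0 L f : syn_bound (atom f L) 0 -> f = 0.
Proof.
move=> /L2norm_le_heis f0; apply: L2norm_eq0.
by apply/eqP; rewrite eq_le f0 L2norm_ge0.
Qed.

End synthesis_bound_calculus.

Section heisenberg_module_norm.
Context {R : realType} {d : nat}.
Local Notation leb := (@lebesgue_cV R d).
Local Notation L2Rd := (L2 leb).
Variable L : 'M[R]_(d + d).
Hypothesis uL : L \in unitmx.
Local Notation E := (heis_module L).
Local Notation N := (@heis_fiber_norm R d L).
Implicit Types s t : E.

Lemma heis_norm_fineP f (b : R) : (heis_norm L f \is a fin_num) -> 0 <= b ->
  fine (heis_norm L f) <= b <-> syn_bound (atom f L) b.
Proof.
move=> ff b0; apply: iff_trans (heis_norm_leP L f b0).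
by rewrite -[X in (X <= _)%E](fineK ff) lee_fin.
Qed.

Lemma heis_fin_num f b : 0 <= b -> syn_bound (atom f L) b -> heis_norm L f \is a fin_num.
Proof.
move=> b0 /(heis_norm_leP _ _ b0) h.
by rewrite ge0_fin_numE ?heis_norm_ge0//; apply: le_lt_trans h _; rewrite ltry.
Qed.

(** The Cauchy condition in the definition of [heis] passes to the L^2 limit by lower
semicontinuity. *)
Lemma heis_approx f (e : R) : heis L f -> 0 < e ->
  exists2 u : L2Rd, M1 u & syn_bound (atom (f - u) L) e.
Proof.
move=> [u [Mu Cu uf]] e0; have [n0 hn0] := Cu e e0.
exists (u n0) => //; apply: (@syn_bound_lim _ _ L (fun m => u m - u n0)).
  exists n0 => // m /= mn; apply/heis_norm_leP; first exact: ltW.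
  by apply: ltW; apply: hn0.
apply: cvg_trans uf; apply: near_eq_cvg; near=> m.
by rewrite opprB addrA subrK.
Unshelve. all: by end_near. Qed.

Lemma heis_finite f : heis L f -> heis_norm L f \is a fin_num.
Proof.
move=> /heis_approx/(_ ltr01)[u Mu hu].
have [b b0 hb] := syn_bound_finite Mu uL.
apply: (@heis_fin_num _ (1 + b)); first by lra.
by rewrite -[f](subrK u); exact: syn_boundD.
Qed.

Lemma heis_valP s : heis L (heis_val s).
Proof. by apply/asboolP; exact: (valP s). Qed.

Lemma fiber_norm_leP s (b : R) : 0 <= b -> N s <= b <-> syn_bound (atom (heis_val s) L) b.
Proof. by move=> b0; apply: heis_norm_fineP => //; exact/heis_finite/heis_valP. Qed.

Lemma fiber_norm_ge0 s : 0 <= N s.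
Proof. by apply: fine_ge0; exact: heis_norm_ge0. Qed.

Lemma fiber_norm_bound s : syn_bound (atom (heis_val s) L) (N s).
Proof. by apply/fiber_norm_leP; first exact: fiber_norm_ge0. Qed.

Lemma L2norm_le_fiber_norm s : L2norm (heis_val s) <= N s.
Proof. exact: L2norm_le_heis (fiber_norm_bound s). Qed.

Lemma heis_valB s t : heis_val (s - t) = heis_val s - heis_val t.
Proof. exact: (raddfB (val : E -> L2Rd)). Qed.

Lemma heis_valZ a s : heis_val (a *: s) = a *: heis_val s.
Proof. first [exact: GRing.valZ | exact: linearZ | by []]. Qed.

Lemma heis_valD s t : heis_val (s + t) = heis_val s + heis_val t.
Proof. exact: (raddfD (val : E -> L2Rd)). Qed.

Lemma M1_dense s (e : R) : 0 < e -> exists f : M1space R d, N (s - M1_to_heis L f) < e.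
Proof.
move=> e0; have e2 : 0 < e / 2 by rewrite divr_gt0.
have [u Mu hu] := heis_approx (heis_valP s) e2.
exists (M1Space Mu); apply: (@le_lt_trans _ _ (e / 2)); last by lra.
by apply/fiber_norm_leP; rewrite ?heis_valB// ltW.
Qed.

(** Completeness: a Cauchy sequence converges in L^2; so does a sequence of nearby
elements of M^1, which shows that the limit lies in the module, and lower
semicontinuity turns the Cauchy condition into convergence in norm. *)
Lemma heis_banach_norm : banach_norm N.
Proof.
split.
- exact: fiber_norm_ge0.
- move=> s s0; apply: val_inj; apply: (@syn_bound_eq0 _ _ L).
  by have := fiber_norm_bound s; rewrite s0.
- have leZ a s : N (a *: s) <= normc a * N s.
    apply/fiber_norm_leP; first by rewrite mulr_ge0 ?normc_ge0 ?fiber_norm_ge0.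
    by rewrite heis_valZ; exact/syn_boundZ/fiber_norm_bound.
  move=> a s; apply/eqP; rewrite eq_le leZ /=.
  have [->|a0] := eqVneq a 0; first by rewrite normc0 mul0r fiber_norm_ge0.
  have na : 0 < normc a.
    by rewrite lt_neqAle normc_ge0 andbT eq_sym; apply: contra a0 => /eqP/eq0_normc ->.
  rewrite -ler_pdivlMl// -[s in leLHS](scalerK a0); apply: le_trans (leZ _ _) _.
  by rewrite normcV.
- move=> s t; apply/fiber_norm_leP; first by rewrite addr_ge0 ?fiber_norm_ge0.
  by rewrite heis_valD; apply: syn_boundD; exact: fiber_norm_bound.
move=> u uC.
have [f uf] : exists f, L2norm (heis_val (u m) - f) @[m --> \oo] --> (0 : R).
  apply: L2_complete => e e0; have [n0 h] := uC e e0; exists n0 => m n hm hn.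
  by rewrite -heis_valB; apply: le_lt_trans (L2norm_le_fiber_norm _) (h _ _ hm hn).
have /choice[v hv] : forall m, exists f : M1space R d, N (u m - M1_to_heis L f) < m.+1%:R^-1.
  by move=> m; apply: M1_dense.
have small (e : R) : 0 < e -> exists n0, forall m, (n0 <= m)%N -> m.+1%:R^-1 < e.
  move=> e0; exists (Num.truncn e^-1) => m hm.
  rewrite invf_plt ?posrE ?ltr0n//; apply: lt_le_trans (truncnS_gt _) _.
  by rewrite ler_nat.
have tele (a b x y : L2Rd) : x - y = (a - b) - (a - x) + (b - y).
  by rewrite opprB [a - b + _]addrC !addrA !subrK.
have hf : heis L f.
  exists (fun m => v m : L2Rd); split.
  - by move=> m; exact: M1P.
  - move=> e e0; have e3 : 0 < e / 4 by rewrite divr_gt0.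
    have [n1 h1] := small _ e3; have [n2 h2] := uC _ e3.
    exists (maxn n1 n2) => m n; rewrite !geq_max => /andP[m1 m2] /andP[k1 k2].
    apply: (@le_lt_trans _ _ (3 * (e / 4))%:E); last by rewrite lte_fin; lra.
    apply/heis_norm_leP; first by lra.
    have -> : (v m : L2Rd) - (v n : L2Rd) = (heis_val (u m - u n) - heis_val (u m - M1_to_heis L (v m)))
        + heis_val (u n - M1_to_heis L (v n)).
      by rewrite !heis_valB; exact: tele.
    have -> : 3 * (e / 4) = e / 4 + e / 4 + e / 4 by lra.
    apply: syn_boundD; [apply: syn_boundD; [|apply: syn_boundN]|].
    + by apply/fiber_norm_leP; rewrite ?(ltW e3)// ltW// h2.
    + by apply/fiber_norm_leP; rewrite ?(ltW e3)// ltW// (lt_trans (hv m)) ?h1.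
    + by apply/fiber_norm_leP; rewrite ?(ltW e3)// ltW// (lt_trans (hv n)) ?h1.
  - apply: (@squeeze_cvgr _ _ _ _ (fun=> 0)
      (fun m => m.+1%:R^-1 + L2norm (heis_val (u m) - f))).
    + near=> m; rewrite L2norm_ge0/=.
      have -> : (v m : L2Rd) - f = - heis_val (u m - M1_to_heis L (v m)) + (heis_val (u m) - f).
        by rewrite heis_valB opprB addrA subrK.
      apply: le_trans (L2normD_le _ _) _; rewrite L2normN lerD2r.
      exact: le_trans (L2norm_le_fiber_norm _) (ltW (hv m)).
    + exact: cvg_cst.
    + rewrite -[X in _ --> X]addr0; apply: cvgD => //; exact: cvg_harmonic.
have sf : f \in heis_pred L by exact/asboolP.
exists (HeisModule sf); apply/cvgr0Pnorm_le => // e e0; have [n0 h] := uC _ e0.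
exists n0 => // m /= nm; rewrite ger0_norm ?fiber_norm_ge0//.
apply/fiber_norm_leP; first exact: ltW.
rewrite heis_valB /=.
apply: (@syn_bound_lim _ _ L (fun j => heis_val (u m) - heis_val (u j))).
  exists n0 => // j /= nj; rewrite -heis_valB; apply/fiber_norm_leP; first exact: ltW.
  by apply: ltW; apply: h.
apply: cvg_trans uf; apply: near_eq_cvg; near=> j.
by rewrite L2normBC opprB [_ + (f - _)]addrC addrA subrK.
Unshelve. all: by end_near. Qed.

End heisenberg_module_norm.

(** * The bundle topology defined by a family of sections *)

Lemma continuousPdist_le {R : realType} (X : topologicalType) (f : X -> R) :
  (forall x (e : R), 0 < e -> \forall y \near x, `|f x - f y| <= e) -> continuous f.
Proof. by move=> h x; apply/cvgrPdist_le => e; exact: h. Qed.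

Section banach_norm_theory.
Context {R : realType} {V : lmodType R[i]} {N : V -> R}.
Hypothesis hN : banach_norm N.
Implicit Types u v w : V.

Lemma banach_norm0 : N 0 = 0.
Proof. by rewrite -(scale0r 0) (banach_normZ hN) normc0 mul0r. Qed.

Lemma banach_normN v : N (- v) = N v.
Proof. by rewrite -scaleN1r (banach_normZ hN) normcN normc1 mul1r. Qed.

Lemma banach_normBC v w : N (v - w) = N (w - v).
Proof. by rewrite -banach_normN opprB. Qed.

Lemma banach_norm_tri u v w : N (u - w) <= N (u - v) + N (v - w).
Proof. by apply: le_trans (banach_normD hN _ _); rewrite addrA subrK. Qed.

Lemma banach_norm_lip v w : `|N v - N w| <= N (v - w).
Proof.
have lip a b : N a - N b <= N (a - b).
  by rewrite lerBlDr; apply: le_trans (banach_normD hN _ _); rewrite subrK.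
by rewrite ler_norml lip lerNl opprB banach_normBC lip.
Qed.

End banach_norm_theory.

Lemma nbhs_openP (X : topologicalType) (x : X) (P : set X) : nbhs x P ->
  exists U, [/\ open U, U x & U `<=` P].
Proof. by rewrite nbhsE => -[U [oU Ux] sU]; exists U. Qed.

Section section_topology.
Context {R : realType} {X : topologicalType} (F : X -> lmodType R[i]).
Variable N : forall x, F x -> R.
Hypothesis hN : forall x, banach_norm (@N x).
Context {G : Type} (sec : G -> forall x, F x).
Hypothesis sec_lin : forall (a : R[i]) f g, exists h, forall x, sec h x = a *: sec f x + sec g x.
Hypothesis sec_cont : forall f, continuous (fun x => N (sec f x)).
Hypothesis sec_dense : forall x (v : F x) (e : R), 0 < e -> exists f, N (v - sec f x) < e.
Local Notation total := {x : X & F x}.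

Definition tube (f : G) (U : set X) (e : R) : set total :=
  [set s | U (projT1 s) /\ N (projT2 s - sec f (projT1 s)) < e].

Definition tube_open (A : set total) : Prop := forall s, A s ->
  exists f U e, [/\ open U, 0 < e, tube f U e s & tube f U e `<=` A].

Lemma norm_sec_sub_continuous f g : continuous (fun x => N (sec f x - sec g x)).
Proof.
have [h hh] := sec_lin (-1) g f.
rewrite (_ : (fun x => _) = (fun x => N (sec h x))); first exact: sec_cont.
by apply/funext => x; rewrite hh scaleN1r addrC.
Qed.

Lemma norm_sec_sub_near f g x (r : R) : N (sec f x - sec g x) < r ->
  \forall y \near x, N (sec f y - sec g y) < r.
Proof. exact: cvgr_lt (@norm_sec_sub_continuous f g x) _. Qed.

(** The tubes around a section passing close enough to a point can replace any
tube containing this point; the continuity of the norms of the sections is what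
makes this work over a whole neighbourhood. *)
Lemma tube_refine f U e x (v : F x) : open U -> tube f U e (existT F x v) ->
  exists2 r : R, 0 < r & forall g del, del <= r -> N (v - sec g x) < del ->
    \forall y \near x, forall w : F y, N (w - sec g y) < del -> tube f U e (existT F y w).
Proof.
move=> oU [/= Ux ve]; exists ((e - N (v - sec f x)) / 2); first by rewrite divr_gt0// subr_gt0.
move=> g del dr vg.
have gf : N (sec g x - sec f x) < e - del.
  apply: le_lt_trans (banach_norm_tri (hN x) _ v _) _; rewrite (banach_normBC (hN x)).
  by lra.
have hU : \forall y \near x, U y by exact: open_nbhs_nbhs.
apply: filterS (filterI hU (norm_sec_sub_near gf)) => y [Uy hy] w wg; split=> //=.
by apply: le_lt_trans (banach_norm_tri (hN y) _ (sec g y) _) _; lra.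
Qed.

Lemma tube_openT : tube_open setT.
Proof.
move=> [x v] _; have [f vf] := sec_dense v ltr01.
by exists f, setT, 1; split=> //; exact: openT.
Qed.

(** The radius [r] does not depend on the section [g], so that one section serves two
neighbourhoods at once. *)
Lemma tube_open_nbhs A x (v : F x) : tube_open A -> A (existT F x v) ->
  exists2 r : R, 0 < r & forall g del, del <= r -> N (v - sec g x) < del ->
    \forall y \near x, forall w : F y, N (w - sec g y) < del -> A (existT F y w).
Proof.
move=> oA /oA[f [U [e [oU e0 /(tube_refine oU)[r r0 hr] sA]]]]; exists r => // g del dr vg.
by apply: filterS (hr g del dr vg) => y hy w wg; exact/sA/hy.
Qed.

Lemma tube_openI : setI_closed tube_open.
Proof.
move=> A B oA oB [x v] [As Bs].
have [r r0 hr] := tube_open_nbhs oA As; have [t t0 ht] := tube_open_nbhs oB Bs.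
pose del := Num.min r t; have del0 : 0 < del by rewrite lt_min r0.
have dr : del <= r by rewrite ge_min lexx.
have dt : del <= t by rewrite ge_min lexx orbT.
have [g vg] := sec_dense v del0.
have [U [oU Ux sU]] := nbhs_openP (filterI (hr g _ dr vg) (ht g _ dt vg)).
exists g, U, del; split=> // -[y w] [/= Uy wg].
by have [h1 h2] := sU y Uy; split; [exact: h1|exact: h2].
Qed.

Lemma tube_open_bigcup (I : Type) (A : I -> set total) :
  (forall i, tube_open (A i)) -> tube_open (\bigcup_i A i).
Proof.
move=> oA s [i _ /oA[f [U [e [oU e0 fs sA]]]]]; exists f, U, e; split=> //.
by move=> t /sA At; exists i.
Qed.

Definition section_topology : topology_on total :=
  TopologyOn tube_openT tube_openI tube_open_bigcup.

Local Notation T := (topologized section_topology).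

Lemma tube_is_open f U e : open U -> 0 < e -> tube_open (tube f U e).
Proof. by move=> oU e0 s fs; exists f, U, e; split. Qed.

Lemma section_topology_basis :
  @basis T [set A | exists f U e, [/\ open U, 0 < e & A = tube f U e]].
Proof.
split=> [_ [f [U [e [oU e0 ->]]]]|s A [B [oB Bs sBA]]]; first exact: tube_is_open.
have [f [U [e [oU e0 fs sB]]]] := oB s Bs.
exists (tube f U e); first by split=> //; exists f, U, e.
by apply: subset_trans sBA.
Qed.

Lemma nbhs_tube (s : T) A : nbhs s A -> exists2 r : R, 0 < r &
  forall g del, del <= r -> N (projT2 (s : total) - sec g (projT1 (s : total))) < del ->
    \forall y \near projT1 (s : total), forall w : F y, N (w - sec g y) < del -> A (existT F y w).
Proof.
case: s => x v [B [oB Bs sBA]]; have [r r0 hr] := tube_open_nbhs oB Bs; exists r => //.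
by move=> g del dr vg; apply: filterS (hr g del dr vg) => y h w wg; exact/sBA/h.
Qed.

Lemma tube_nbhs (s : T) g (P : set X) (del : R) : (\forall y \near projT1 (s : total), P y) ->
  N (projT2 (s : total) - sec g (projT1 (s : total))) < del -> nbhs s (tube g P del : set T).
Proof.
move=> /nbhs_openP[U [oU Us sUP]] sg.
exists (tube g U del); split.
- by apply: tube_is_open => //; apply: le_lt_trans sg; exact: banach_norm_ge0 (hN _) _.
- by split.
- by move=> t [/sUP Pt tg]; split.
Qed.


Lemma fiber_addE x (v w : F x) :
  fiber_add (existT F x v) (existT F x w) = existT F x (v + w).
Proof.
rewrite /fiber_add; case: pselect => [e|ne] /=; last by case: ne.
by rewrite (Prop_irrelevance e (erefl x)).
Qed.

Lemma section_proj_continuous : continuous (fun s : T => projT1 (s : total)).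
Proof.
move=> s U hU; have [f sf] := sec_dense (projT2 (s : total)) ltr01.
apply: filterS (tube_nbhs (s := s) (g := f) hU sf) => t; by case.
Qed.

Lemma section_proj_open (A : set T) : open A -> open [set projT1 (s : total) | s in A].
Proof.
move=> oA; rewrite openE => _ [[x v] As <-] /=.
have [f [U [e [oU e0 [Ux _] sA]]]] := oA _ As.
apply: filterS (open_nbhs_nbhs (conj oU Ux)) => y Uy.
exists (existT F y (sec f y)) => //; apply: sA; split=> //=.
by rewrite subrr (banach_norm0 (hN y)).
Qed.

Lemma section_norm_continuous : continuous (fun s : T => N (projT2 (s : total))).
Proof.
apply: continuousPdist_le => -[x v] e e0; have e3 : 0 < e / 3 by rewrite divr_gt0.
have [g vg] := sec_dense v e3.
have hV : \forall y \near x, `|N (sec g x) - N (sec g y)| <= e / 3.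
  by have /cvgrPdist_le := @sec_cont g x; exact.
apply: filterS (tube_nbhs (s := existT F x v) hV vg) => -[y w] [/= hy wg].
have h1 := banach_norm_lip (hN x) v (sec g x).
have h2 := banach_norm_lip (hN y) w (sec g y).
move: hy h1 h2; rewrite !ler_norml; lra.
Qed.

Lemma section_total_hausdorff : hausdorff_space X -> hausdorff_space T.
Proof.
move=> hX p q pq.
have exy : projT1 (p : total) = projT1 (q : total).
  apply: hX => A B hA hB.
  by have [s [As Bs]] := pq _ _ (section_proj_continuous hA) (section_proj_continuous hB);
     exists (projT1 (s : total)).
case: p q exy pq => x v [y w] /= exy; subst y => pq.
congr existT; apply/eqP; rewrite -subr_eq0; apply/eqP; apply: (banach_norm_eq0 (hN x)).
apply/eqP; rewrite eq_le (banach_norm_ge0 (hN x)) andbT leNgt; apply/negP => r0.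
have r4 : 0 < N (v - w) / 4 by rewrite divr_gt0.
have [g vg] := sec_dense v r4; have [h wh] := sec_dense w r4.
(* the tubes of radius N (v - w) / 4 around g and h are disjoint where g and h stay
   this far apart *)
have far : N (v - w) / 2 < N (sec g x - sec h x).
  have := banach_norm_tri (hN x) v (sec g x) w.
  have := banach_norm_tri (hN x) (sec g x) (sec h x) w.
  by rewrite (banach_normBC (hN x) (sec h x)); lra.
have hV : \forall y \near x, N (v - w) / 2 < N (sec g y - sec h y).
  exact: cvgr_gt (@norm_sec_sub_continuous g h x) _ far.
have [[y u] [[/= hy ug] [_ uh]]] := pq _ _ (tube_nbhs (s := existT F x v) hV vg)
  (tube_nbhs (s := existT F x w) hV wh).
have := banach_norm_tri (hN y) (sec g y) u (sec h y).
by rewrite (banach_normBC (hN y) (sec g y) u); move: hy ug uh => /=; lra.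
Qed.

Lemma section_add_continuous :
  {within [set p : T * T | projT1 (p.1 : total) = projT1 (p.2 : total)],
    continuous (fun p => fiber_add p.1 p.2 : T)}.
Proof.
apply/subspace_continuousP => -[[x v] [x' w]] /= exy; subst x' => A.
rewrite /from_subspace /= fiber_addE => hA.
have [r r0 hr] := nbhs_tube hA; have r2 : 0 < r / 2 by rewrite divr_gt0.
have [g vg] := sec_dense v r2; have [h wh] := sec_dense w r2.
have [k hk] := sec_lin 1 g h.
have kE y : sec k y = sec g y + sec h y by rewrite hk scale1r.
have near_k y (v' w' : F y) : N (v' - sec g y) < r / 2 -> N (w' - sec h y) < r / 2 ->
    N (v' + w' - sec k y) < r.
  move=> h1 h2; rewrite kE opprD addrACA.
  by apply: le_lt_trans (banach_normD (hN y) _ _) _; lra.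
have /= hV := hr k r (lexx r) (near_k x v w vg wh).
exists (tube g [set y | forall w : F y, N (w - sec k y) < r -> A (existT F y w)] (r / 2),
        tube h setT (r / 2)) => /=.
  split; first exact: (tube_nbhs (s := existT F x v) hV vg).
  by apply: (tube_nbhs (s := existT F x w) _ wh); exact: filterT.
move=> [[y v'] [y' w']] [/= [hy vg'] [_ wh']] /= e; subst y'.
by rewrite fiber_addE; apply: hy; exact: near_k.
Qed.

Lemma section_scale_continuous (a : R[i]) : continuous (fun s : T => fiber_scale a s : T).
Proof.
move=> [x v] A hA; have [r r0 hr] := nbhs_tube hA.
have a0 : 0 < normc a + 1 by have := normc_ge0 a; lra.
have t0 : 0 < r / (normc a + 1) by rewrite divr_gt0.
have [g vg] := sec_dense v t0; have [z hz] := sec_lin (-1) g g; have [k hk] := sec_lin a g z.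
have kE y : sec k y = a *: sec g y by rewrite hk hz scaleN1r addNr addr0.
have near_k y (w : F y) : N (w - sec g y) < r / (normc a + 1) -> N (a *: w - sec k y) < r.
  rewrite kE -scalerBr (banach_normZ (hN y)) ltr_pdivlMr// => h; apply: le_lt_trans _ h.
  rewrite mulrC; apply: ler_wpM2l; first exact: banach_norm_ge0 (hN y) _.
  by rewrite lerDl.
have hV := hr k r (lexx r) (near_k x v vg).
apply: filterS (tube_nbhs (s := existT F x v) hV vg) => -[y w] [/= hy wg].
exact/hy/near_k.
Qed.

Lemma net_tails_filter (I : Type) (le : I -> I -> Prop) :
  directed le -> Filter (net_tails le).
Proof.
move=> [[i _] refl trans ub]; apply: filter_from_filter; first by exists i.
move=> i1 i2 _ _; have [k k1 k2] := ub i1 i2; exists k => // j kj.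
by split; [exact: trans k1 kj|exact: trans k2 kj].
Qed.

Lemma section_net0 (I : Type) (le : I -> I -> Prop) (s : I -> T) (x : X) : directed le ->
  projT1 (s i : total) @[i --> net_tails le] --> x ->
  N (projT2 (s i : total)) @[i --> net_tails le] --> (0 : R) ->
  s i @[i --> net_tails le] --> (existT F x 0 : T).
Proof.
move=> dir sx s0 A hA; have FF := net_tails_filter dir.
have [r r0 hr] := nbhs_tube hA.
have [f _] := sec_dense (0 : F x) ltr01; have [z hz] := sec_lin (-1) f f.
have zE y : sec z y = 0 by rewrite hz scaleN1r addNr.
have := hr z r (lexx r); rewrite /= zE subrr (banach_norm0 (hN x)) => /(_ r0) hV.
have near_r : \forall i \near net_tails le, N (projT2 (s i : total)) < r.
  exact: cvgr_lt s0 _ r0.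
have near_V : \forall i \near net_tails le,
    forall w, N (w - sec z (projT1 (s i : total))) < r -> A (existT F _ w) := sx _ hV.
have : net_tails le [set i | A (s i)].
  apply: (@filterS _ _ FF _ _ _ (@filterI _ _ FF _ _ near_V near_r)) => i [/=].
  by case: (s i) => y w /= h wr; apply: h; rewrite zE subr0.
by [].
Qed.

Lemma section_topology_bundle : hausdorff_space X -> banach_bundle N section_topology.
Proof.
move=> hX; split=> //.
- exact: section_total_hausdorff.
- exact: section_proj_continuous.
- exact: section_proj_open.
- by move=> x; exists (existT F x 0).
- exact: section_norm_continuous.
- exact: section_add_continuous.
- exact: section_scale_continuous.
- exact: section_net0.
Qed.

Lemma section_topology_continuous (f : G) : continuous (section_of section_topology (sec f)).
Proof.
move=> x A hA; have [r r0 hr] := nbhs_tube hA.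
have := hr f r (lexx r); rewrite /= subrr (banach_norm0 (hN x)) => /(_ r0).
by apply: filterS => y h; apply: h; rewrite subrr (banach_norm0 (hN y)).
Qed.

Lemma section_continuousP (Y : forall x, F x) :
  continuous (section_of section_topology Y) <->
  forall (e : R) x0, 0 < e -> exists f U,
    [/\ open U, U x0 & forall x, U x -> N (Y x - sec f x) < e].
Proof.
split=> [cY e x0 e0|h x A hA].
  have [f hf] := sec_dense (Y x0) e0.
  have hT : \forall y \near x0, True by exact: filterT.
  have /cY/nbhs_openP[U [oU Ux sU]] :=
    tube_nbhs (s := section_of section_topology Y x0) hT hf.
  by exists f, U; split=> // x /sU[].
have [r r0 hr] := nbhs_tube hA; have [f [U [oU Ux hf]]] := h r x r0.
apply: filterS (filterI (open_nbhs_nbhs (conj oU Ux)) (hr f r (lexx r) (hf x Ux))).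
by move=> y [Uy hy]; exact/hy/hf.
Qed.

End section_topology.

(** * Uniqueness of the bundle topology *)

Section uniqueness.
Context {R : realType} {X : topologicalType} (F : X -> lmodType R[i]).
Variable N : forall x, F x -> R.
Context {G : Type} (sec : G -> forall x, F x).
Hypothesis sec_dense : forall x (v : F x) (e : R), 0 < e -> exists f, N (v - sec f x) < e.
Local Notation total := {x : X & F x}.
Variable tau : topology_on total.
Hypothesis B : banach_bundle N tau.
Hypothesis sec_continuous : forall f, continuous (section_of tau (sec f)).
Local Notation T := (topologized tau).

Let hN := bundle_fiber_banach B.

Lemma bundle_add_near x (v w : F x) (A : set T) : nbhs (existT F x (v + w) : T) A ->
  exists2 PQ : set T * set T, nbhs (existT F x v : T) PQ.1 /\ nbhs (existT F x w : T) PQ.2 &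
    forall y (v' w' : F y), PQ.1 (existT F y v') -> PQ.2 (existT F y w') ->
      A (existT F y (v' + w')).
Proof.
move=> hA; have /subspace_continuousP/(_ (existT F x v, existT F x w) erefl A) := bundle_add_continuous B.
rewrite /from_subspace /= fiber_addE => /(_ hA)[PQ hPQ sPQ]; exists PQ => //.
move=> y v' w' hv hw.
have : A (fiber_add (existT F y v') (existT F y w')) :=
  sPQ (existT F y v', existT F y w') (conj hv hw) erefl.
by rewrite fiber_addE.
Qed.

(** If no tube around the zero section were contained in [A], the points that escape
from the tubes, indexed by the base neighbourhoods and the radii, would form a net that
converges to the zero of the fiber and avoids [A]. *)
Lemma bundle_zero_tube x (A : set T) : nbhs (existT F x 0 : T) A ->
  exists P (e : R), [/\ nbhs x P, 0 < e & forall y (w : F y), P y -> N w < e -> A (existT F y w)].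
Proof.
move=> hA; apply: contrapT => hno.
pose I := {i : set X * R | nbhs x i.1 /\ 0 < i.2}.
pose le (i j : I) := (sval j).1 `<=` (sval i).1 /\ (sval j).2 <= (sval i).2.
have /choice[s hs] : forall i : I, exists s : T, [/\ (sval i).1 (projT1 (s : total)),
    N (projT2 (s : total)) < (sval i).2 & ~ A s].
  move=> [[P e] [/= hP e0]]; apply: contrapT => hi; apply: hno; exists P, e; split=> //.
  move=> y w Py we; apply: contrapT => nA; apply: hi; exists (existT F y w); split=> //.
have dir : directed le.
  split.
  - by exists (exist _ (setT, 1) (conj filterT ltr01)).
  - by move=> i; split.
  - by move=> i j k [h1 h2] [h3 h4]; split; [exact: subset_trans h1|exact: le_trans h2].
  move=> [[P e] [/= hP e0]] [[Q t] [/= hQ t0]].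
  have h : nbhs x (P `&` Q) /\ 0 < Num.min e t by split; [exact: filterI|rewrite lt_min e0].
  exists (exist _ (P `&` Q, Num.min e t) h); split=> /=.
  - exact: subIsetl.
  - by rewrite ge_min lexx.
  - exact: subIsetr.
  - by rewrite ge_min lexx orbT.
have FF := net_tails_filter dir.
have sx : projT1 (s i : total) @[i --> net_tails le] --> x.
  move=> P hP; exists (exist _ (P, 1) (conj hP ltr01)) => // j [/= hj _].
  by apply: hj; have [] := hs j.
have s0 : N (projT2 (s i : total)) @[i --> net_tails le] --> (0 : R).
  apply/cvgr0Pnorm_lt => e e0.
  exists (exist _ (setT, e) (conj filterT e0)) => // j [/= _ hj].
  rewrite ger0_norm; last exact: banach_norm_ge0 (hN _) _.
  by apply: lt_le_trans hj; have [] := hs j.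
have [i _ hi] := bundle_net0 B dir sx s0 hA.
have [_ _] := hs i; apply; apply: hi; exact: directed_refl dir i.
Qed.

(** The distance from a point to a continuous section is continuous. *)
Lemma bundle_tube_nbhs f U (e : R) x (v : F x) : nbhs x U -> N (v - sec f x) < e ->
  nbhs (existT F x v : T) (tube N sec f U e : set T).
Proof.
move=> hU ve.
pose A : set T := [set s | N (projT2 (s : total)) < e].
have hA : nbhs (existT F x (v + - sec f x) : T) A.
  by apply: (cvgr_lt _ (@bundle_norm_continuous _ _ _ _ _ B (existT F x (v - sec f x)))).
have [[P Q] [/= hP hQ] hPQ] := bundle_add_near hA.
have hQ' : nbhs (existT F x (sec f x) : T) [set s | Q (fiber_scale (-1) s)].
  apply: (@bundle_scale_continuous _ _ _ _ _ B (-1) (existT F x (sec f x))).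
  by rewrite /fiber_scale /= scaleN1r.
have hf := @sec_continuous f x _ hQ'.
have hUf : nbhs x (U `&` [set y | Q (fiber_scale (-1) (existT F y (sec f y)))]).
  exact: filterI hU hf.
have hproj : nbhs (existT F x v : T) [set s | U (projT1 (s : total)) /\
    Q (fiber_scale (-1) (existT F _ (sec f (projT1 (s : total)))))].
  exact: (@bundle_proj_continuous _ _ _ _ _ B (existT F x v) _ hUf).
apply: filterS (filterI hP hproj) => -[y w] [Pw /= [Uy Qy]]; split=> //=.
apply: (hPQ y w _ Pw); move: Qy; rewrite /fiber_scale /section_of /= scaleN1r; exact.
Qed.

(** The sum of a point near [v] and of a point in a thin tube around the zero
section stays near [v]; used twice, this puts a tube around a section passing
close to [v] into any neighbourhood of [v]. *)
Lemma bundle_nbhs_tube x (v : F x) (A : set T) : nbhs (existT F x v : T) A ->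
  exists f U e, [/\ open U, 0 < e, tube N sec f U e (existT F x v) & tube N sec f U e `<=` A].
Proof.
have add0 C : nbhs (existT F x v : T) C -> exists P Q (e : R),
    [/\ nbhs (existT F x v : T) P, nbhs x Q, 0 < e &
     forall y (u w : F y), P (existT F y u) -> Q y -> N w < e -> C (existT F y (u + w))].
  move=> hC; have : nbhs (existT F x (v + 0) : T) C by rewrite addr0.
  move=> /bundle_add_near[[P Z] /= [hP hZ] hPZ].
  have [Q [e [hQ e0 hQe]]] := bundle_zero_tube hZ; exists P, Q, e; split=> //.
  by move=> y u w Pu Qy we; apply: hPZ => //; exact: hQe.
move=> /add0[P [Q [e [hP hQ e0 hA]]]]; have [P' [Q' [e' [hP' hQ' e'0 hP'P]]]] := add0 _ (nbhs_interior hP).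
pose del := Num.min e e'; have del0 : 0 < del by rewrite lt_min e0.
have [f vf] := sec_dense v del0.
have fP : (interior P) (existT F x (sec f x)).
  rewrite -[sec f x](subrK v) addrC; apply: hP'P.
  - exact: nbhs_singleton hP'.
  - exact: nbhs_singleton hQ'.
  - by rewrite (banach_normBC (hN x)); apply: lt_le_trans vf _; rewrite ge_min lexx orbT.
have [U [oU Ux sU]] := nbhs_openP (filterI hQ (@sec_continuous f x P fP)).
exists f, U, del; split=> // -[y w] [/= /sU[Qy Py] wf].
rewrite -[w](subrK (sec f y)) addrC; apply: hA => //.
by apply: lt_le_trans wf _; rewrite ge_min lexx.
Qed.

Lemma bundle_topology_unique : opens tau = tube_open N sec.
Proof.
apply/funext => A; apply/propext; split=> [oA [x v] As|oA].
  by apply: bundle_nbhs_tube; exists A; split.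
suff : open (A : set T) by [].
rewrite openE => -[x v] /oA[f [U [e [oU e0 [/= Ux ve] sA]]]].
apply: (@filterS _ (nbhs (existT F x v : T)) _ _ _ sA).
by apply: bundle_tube_nbhs => //; exact: open_nbhs_nbhs.
Qed.

End uniqueness.

(** * Constant sections over the general linear group *)

Section general_linear_group.
Context {R : realType} {n : nat}.
Implicit Types L : GL R n.

Lemma GL_unitmx L : (set_val L : 'M[R]_n) \in unitmx.
Proof. exact: set_valP L. Qed.

Lemma GL_entries_near L0 (r : R) : 0 < r ->
  \forall L \near L0, forall i j, `|(set_val L : 'M[R]_n) i j - (set_val L0 : 'M[R]_n) i j| <= r.
Proof.
move=> r0.
have entry i j : \forall L \near L0,
    `|(set_val L : 'M[R]_n) i j - (set_val L0 : 'M[R]_n) i j| <= r.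
  have /cvgrPdist_le/(_ _ r0) : (set_val L : 'M[R]_n) i j @[L --> L0] --> (set_val L0 : 'M[R]_n) i j.
    apply: (@continuous_comp _ _ _ (set_val : GL R n -> 'M[R]_n) (fun M : 'M[R]_n => M i j)).
      exact: initial_continuous.
    exact: coord_continuous.
  by apply: filterS => L; rewrite distrC.
by near=> L => i j; move: i j; near: L; do 2! [apply: filter_forall => ?]; exact: entry.
Unshelve. all: by end_near. Qed.

Lemma GL_hausdorff : hausdorff_space (GL R n).
Proof.
move=> p q pq; apply/val_inj/matrixP => i j; apply/eqP; rewrite -subr_eq0 -normr_le0.
apply/ler_addgt0Pr => e e0; rewrite add0r.
have e2 : 0 < e / 2 by rewrite divr_gt0.
have [L [Lp Lq]] := pq _ _ (GL_entries_near p e2) (GL_entries_near q e2).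
apply: le_trans (ler_distD ((set_val L : 'M[R]_n) i j) _ _) _; rewrite distrC.
by apply: le_trans (lerD (Lp i j) (Lq i j)) _; rewrite -splitr.
Qed.

End general_linear_group.

Section constant_sections.
Context {R : realType} {d : nat}.

(** The two semicontinuities of the synthesis norm. *)
Lemma const_section_norm_continuous (f : M1space R d) :
  continuous (fun L : GL R (d + d) => fiber_norm (const_section f L)).
Proof.
apply: continuousPdist_le => L0 e e0.
set b := fiber_norm (const_section f L0); have Mf := M1P f.
have fn0 L : 0 <= fiber_norm (const_section f L) by exact: fiber_norm_ge0.
have b0 : 0 <= b := fn0 L0.
have bP L (a : R) : 0 <= a ->
    fiber_norm (const_section f L) <= a <-> syn_bound (atom f (set_val L)) a.
  by move=> a0; exact: (fiber_norm_leP (GL_unitmx L)).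
have [r1 r10 up] := syn_bound_upper Mf (GL_unitmx L0) b0 e0 ((bP _ _ b0).1 (lexx b)).
have [r2 r20 low] : exists2 r : R, 0 < r & forall L : GL R (d + d),
    entries_within (set_val L0) r (set_val L) -> b - e <= fiber_norm (const_section f L).
  have [be|be] := ltP (b - e) 0.
    by exists 1; [exact: ltr01|move=> L _; exact: le_trans (ltW be) (fn0 L)].
  have [|r r0 h] := @syn_bound_lower _ _ f Mf (set_val L0) (b - e).
    by move=> /(bP L0 _ be).2; rewrite -/b; move: (b) e0 => c; lra.
  exists r; first exact: r0.
  move=> L hL; rewrite leNgt; apply/negP => lt; apply: (h _ hL).
  exact: (bP L _ be).1 (ltW lt).
have be0 : 0 <= b + e by lra.
have h1 := GL_entries_near L0 r10; have h2 := GL_entries_near L0 r20.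
apply: filterS (filterI h1 h2) => L [hL1 hL2].
have := low L hL2; have : fiber_norm (const_section f L) <= b + e.
  exact: (bP L _ be0).2 (up _ (GL_unitmx L) hL1).
move: (fiber_norm (const_section f L)) (b) => x y xy yx.
by rewrite ler_norml; lra.
Qed.

End constant_sections.

(** * The bundle of Heisenberg modules *)

Section constant_sections_theory.
Context {R : realType} {d : nat}.

Lemma const_section_lin (a : R[i]) (f g : M1space R d) :
  exists h : M1space R d, forall L : GL R (d + d),
    const_section h L = a *: const_section f L + const_section g L.
Proof.
have Mh : M1 (a *: (f : L2 (@lebesgue_cV R d)) + (g : L2 (@lebesgue_cV R d))).
  by apply/asboolP; apply: (proj2 (@M1_submod_closed R d)); apply/asboolP; exact: M1P.
exists (M1Space Mh) => L; apply: val_inj.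
by rewrite [RHS](heis_valD (L := set_val L)) (heis_valZ (L := set_val L)).
Qed.

Lemma const_section_dense (L : GL R (d + d)) (s : heis_fiber L) (e : R) : 0 < e ->
  exists f : M1space R d, fiber_norm (s - const_section f L) < e.
Proof. exact: (M1_dense (GL_unitmx L)). Qed.

Lemma fiber_norm_banach (L : GL R (d + d)) : banach_norm (@fiber_norm R d L).
Proof. exact: (heis_banach_norm (GL_unitmx L)). Qed.

End constant_sections_theory.

Theorem theorem3p10 (R : realType) (d : nat) (hd : (1 <= d)%N) :
  [/\ forall f : M1space R d,
        continuous (fun L : GL R (d + d) => fiber_norm (const_section f L)),
      forall (L : GL R (d + d)) (s : heis_fiber L) (e : R), 0 < e ->
        exists f : M1space R d, fiber_norm (s - const_section f L) < e &
      exists tau : topology_on (heis_total R d),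
        [/\ @basis (topologized tau) (W_basis R d),
            banach_bundle (@fiber_norm R d) tau /\
              (forall f : M1space R d, continuous (section_of tau (const_section f))),
            forall tau' : topology_on (heis_total R d),
              banach_bundle (@fiber_norm R d) tau' ->
              (forall f : M1space R d, continuous (section_of tau' (const_section f))) ->
              opens tau' = opens tau &
            forall Y : forall L : GL R (d + d), heis_fiber L,
              continuous (section_of tau Y) <->
              forall (e : R) (L0 : GL R (d + d)), 0 < e ->
              exists (f0 : M1space R d) (U0 : set (GL R (d + d))),
                [/\ open U0, U0 L0 &
                    forall L, U0 L -> fiber_norm (Y L - const_section f0 L) < e]]].
Proof.
have Nb := @fiber_norm_banach R d; have lin := @const_section_lin R d.
have cont := @const_section_norm_continuous R d; have dense := @const_section_dense R d.
split; [exact: cont|exact: dense|].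
exists (section_topology Nb lin cont dense); split.
- exact: section_topology_basis.
- split; last exact: section_topology_continuous.
  exact: section_topology_bundle GL_hausdorff.
- move=> tau' B' c'; exact: (bundle_topology_unique dense B' c').
- exact: section_continuousP.
Qed.
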